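(* Let $H=\sum_{X\in S}\lambda_X h_X$ be a $k$-local Hamiltonian whose interaction graph has maximum degree $\mathfrak{d}\ge 1$, let $\rho$ be a product state, let $L(t)=\mathrm{tr}(e^{-iHt}\rho)$, and let $t_L^*=1/[2e^2\mathfrak{d}(\mathfrak{d}+1)]$. For times $|t|<t_L^*$ and $\varepsilon>0$, there exists a classical algorithm with run time $$|S|\times\mathrm{poly}\left[\left(\frac{|S|}{1-|t|/t_L^*}\,\frac{1}{\varepsilon}\right)^{1/\log(t_L^*/|t|)}\right]$$ that outputs $\hat f_L(t)$ such that $|\log L(t)-\hat f_L(t)|\le\varepsilon$.
   Context: Setting. $V$ is a set of $n$ spins; each $v\in V$ carries a Hilbert space $\mathcal{H}^v$ of dimension $d$, and $\mathcal{H}=\bigotimes_{v\in V}\mathcal{H}^v$. A subsystem is a subset $X\subseteq V$. The support $\mathrm{supp}(B)$ of a linear operator $B$ on $\mathcal{H}$ is the smallest subsystem on which $B$ acts nontrivially. $S$ is a set of subsystems and $H=\sum_{X\in S}\lambda_X h_X$, where $\lambda_X\in\mathbb{R}$, $|\lambda_X|\le1$, and $h_X$ is Hermitian with $\mathrm{supp}(h_X)=X$ and operator norm $\|h_X\|=1$. $H$ is $k$-local if $|X|\le k$ for all $X\in S$. The interaction graph is the simple graph with vertex set $S$ in which two distinct $X,Y\in S$ are joined by an edge iff $X\cap Y\ne\emptyset$; $\mathfrak{d}$ is its maximum degree. A product state is $\rho=\bigotimes_{v\in V}\rho_v$ with each $\rho_v$ a density operator on $\mathcal{H}^v$. $L$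 has no zeros in the disk $|t|<t_L^*$, and $\log L$ denotes the analytic branch on this disk with $\log L(0)=0$. The exponent $1/\log(t_L^*/|t|)$ is read as $0$ for $t=0$. Computational conventions. The algorithm is given $S$, the coefficients $\lambda_X$, the matrices of the $h_X$ on their supports, the single-site states $\rho_v$, $t$ and $\varepsilon$. Issues of finite numerical precision are ignored: run time counts elementary operations, where arithmetic on complex numbers, comparisons of reals, and evaluation of elementary functions have unit cost, and the data attached to any given subsystem or site (including the list of neighbours of a subsystem in the interaction graph) can be accessed at unit cost. The quantities $k$, $d$, $\mathfrak{d}$ are treated as constants: $\mathrm{poly}[x]$ stands for a bound of the form $C(1+x)^c$ with $C,c$ depending only on $k,d,\mathfrak{d}$. *)

(* Defs.v *)
From HB Require Import structures.
From mathcomp Require Import all_boot all_order all_algebra.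
From mathcomp Require Import complex.
From mathcomp Require Import all_classical all_reals all_analysis.

Set Implicit Arguments.
Unset Strict Implicit.
Unset Printing Implicit Defensive.

Import Order.TTheory GRing.Theory Num.Theory.
Import numFieldNormedType.Exports.

Local Open Scope classical_set_scope.
Local Open Scope complex_scope.
Local Open Scope sesquilinear_scope.
Local Open Scope ring_scope.

Section ComplexNumbers.
Variable R : realType.
Implicit Types (z : R[i]).

(* On R[i] the MathComp norm `|z| takes values in R[i]; this is the same
   modulus as an element of R. *)
Definition cabs z : R := complex.Re `|z|.

Definition cexp z : R[i] :=
  (expR (complex.Re z))%:C * (cos (complex.Im z) +i* sin (complex.Im z)).

(* derivable over the scalar field R[i] is complex differentiability. *)
Definition holomorphic_at (g : R[i] -> R[i]) z : Prop :=
  derivable (g : R[i]^o -> R[i]^o) z 1.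

(* g is the analytic branch of log F on the open disk of radius r about 0 with
   g 0 = 0; in particular F has no zeros there. Two such branches
   agree on the disk. *)
Definition log_branch (F : R[i] -> R[i]) (r : R) (g : R[i] -> R[i]) : Prop :=
  [/\ forall z, cabs z < r -> holomorphic_at g z,
      forall z, cabs z < r -> cexp (g z) = F z
    & g 0 = 0].

Definition expmx n (A : 'M[R[i]]_n) : 'M[R[i]]_n :=
  \matrix_(a, b)
    limn (series (fun m : nat => (A ^+ m) a b / (m`!)%:R) : nat -> R[i]^o).

Definition l2norm n (v : 'cV[R[i]]_n) : R :=
  Num.sqrt (\sum_a cabs (v a 0) ^+ 2).

Definition opnorm n (A : 'M[R[i]]_n) : R :=
  sup [set l2norm (A *m v) | v in [set v : 'cV[R[i]]_n | l2norm v = 1]].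

Definition selfadjoint n (A : 'M[R[i]]_n) : Prop := A ^t* = A.

(* 0 <= z in R[i] means that z is real and nonnegative. *)
Definition density_op n (A : 'M[R[i]]_n) : Prop :=
  [/\ selfadjoint A,
      forall v : 'cV[R[i]]_n, 0 <= (v ^t* *m A *m v) 0 0
    & \tr A = 1].

End ComplexNumbers.

Section Spins.
Variables (R : realType) (V : finType) (d : nat).

(* Labels of the product basis of the tensor product over V of copies
   of C^d. *)
Definition config := {ffun V -> 'I_d}.

Definition op := 'M[R[i]]_#|{: config}|.

Definition entry (B : op) (s s' : config) : R[i] :=
  B (enum_rank s) (enum_rank s').

Definition agree_on (X : {set V}) (s s' : config) : bool :=
  [forall v in X, s v == s' v].

(* B = A (x) 1 for an operator A on the tensor factors in X. *)
Definition acts_within (X : {set V}) (B : op) : Prop :=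
  exists A : {ffun {v : V | v \in X} -> 'I_d} ->
             {ffun {v : V | v \in X} -> 'I_d} -> R[i],
    forall s s' : config,
      entry B s s' =
        if agree_on (~: X) s s'
        then A [ffun v => s (val v)] [ffun v => s' (val v)] else 0.

Definition is_supp (B : op) (X : {set V}) : Prop :=
  acts_within X B /\ forall Y : {set V}, acts_within Y B -> X \subset Y.

Definition product_state (rho : V -> 'M[R[i]]_d) : op :=
  \matrix_(a, b) \prod_(v : V)
    rho v ((enum_val a : config) v) ((enum_val b : config) v).

Definition hamiltonian (S : {set {set V}}) (lam : {set V} -> R)
    (h : {set V} -> op) : op :=
  \sum_(X in S) (lam X)%:C *: h X.

Definition loschmidt (H rho : op) (t : R[i]) : R[i] :=
  \tr (expmx ((- ('i%C * t)) *: H) *m rho).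

End Spins.

Definition neighbours (V : finType) (S : {set {set V}}) (X : {set V}) :
    {set {set V}} :=
  [set Y in S | (Y != X) && (X :&: Y != finset.set0)].

Definition max_degree (V : finType) (S : {set {set V}}) : nat :=
  \max_(X in S) #|neighbours S X|.

Definition tL (R : realType) (D : nat) : R :=
  1 / (2 * expR 1 ^+ 2 * D%:R * (D%:R + 1)).

(* A read-only input. Sites and subsystems are referred to by
   numbers; what is returned for meaningless arguments is unspecified. *)
Record input (R : realType) := Input {
  in_nsites : nat;
  in_nsubs : nat;
  in_size : nat -> nat;                   (* subsystem |-> number of sites *)
  in_site : nat -> nat -> nat;            (* subsystem, position |-> site *)
  in_deg : nat -> nat;                    (* subsystem |-> degree *)
  in_nbr : nat -> nat -> nat;             (* subsystem, position |-> subsystem *)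
  in_coef : nat -> R;
  in_term : nat -> nat -> nat -> R[i];    (* subsystem, row, column *)
  in_state : nat -> nat -> nat -> R[i];   (* site, row, column *)
  in_time : R[i];
  in_eps : R
}.

(* Row or column number, in the matrix of an operator on the sites listed in r,
   of the restriction of s to these sites (base d, least significant digit
   first). *)
Definition config_code (V : finType) (d : nat) (r : seq V) (s : config V d) :
    nat :=
  foldr (fun v m => s v + d * m)%N 0%N r.

(* The numberings vid of the sites and sid of the subsystems, the order
   ord X in which the sites of X are listed, and the order of the lists of
   neighbours are arbitrary. When agree_on (~: X) s s' and h X is
   supported on X, entry (h X) s s' is a matrix element of h X as an operator
   on X. *)
Definition presents (R : realType) (V : finType) (d : nat) (S : {set {set V}})
    (lam : {set V} -> R) (h : {set V} -> op R V d) (rho : V -> 'M[R[i]]_d)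
    (t : R[i]) (eps : R) (inp : input R) : Prop :=
  exists (vid : V -> nat) (sid : {set V} -> nat) (ord : {set V} -> seq V),
    [/\ [/\ in_nsites inp = #|V|, in_nsubs inp = #|S|,
            in_time inp = t & in_eps inp = eps],
        injective vid /\ (forall v, (vid v < #|V|)%N),
        {in S &, injective sid} /\ (forall X, X \in S -> (sid X < #|S|)%N),
        forall X, X \in S ->
          [/\ perm_eq (ord X) (enum X),
              mkseq (in_site inp (sid X)) (in_size inp (sid X))
                = [seq vid v | v <- ord X],
              perm_eq (mkseq (in_nbr inp (sid X)) (in_deg inp (sid X)))
                      [seq sid Y | Y <- enum (neighbours S X)],
              in_coef inp (sid X) = lam X
            & forall s s' : config V d, agree_on (~: X) s s' ->
                in_term inp (sid X)
                    (config_code (ord X) s) (config_code (ord X) s')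
                  = entry (h X) s s']
      & forall (v : V) (a b : 'I_d), in_state inp (vid v) a b = rho v a b].

(* Programs for a random access machine with finitely many named unbounded
   arrays of natural numbers and of complex numbers. A complex number cannot
   be converted to a natural number; the only numerical constants are
   natural numbers and 'i. *)
Inductive iexp : Type :=
| INum of nat
| IGet of nat & iexp                      (* array, index *)
| IAdd of iexp & iexp
| ISub of iexp & iexp
| IMul of iexp & iexp
| INSites
| INSubs
| ISize of iexp
| ISite of iexp & iexp
| IDeg of iexp
| INbr of iexp & iexp.

Inductive cexpr : Type :=
| CNat of iexp
| CI
| CGet of nat & iexp                      (* array, index *)
| CAdd of cexpr & cexpr
| CSub of cexpr & cexpr
| CMul of cexpr & cexpr
| CDiv of cexpr & cexpr
| CRe of cexpr
| CIm of cexpr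
| CAbs of cexpr
| CExp of cexpr
| CLn of cexpr
| CAtan of cexpr
| CCoef of iexp
| CTerm of iexp & iexp & iexp
| CState of iexp & iexp & iexp
| CTime
| CEps.

Inductive bexp : Type :=
| BEq of iexp & iexp
| BLe of iexp & iexp
| BLeRe of cexpr & cexpr
| BNot of bexp
| BAnd of bexp & bexp.

Inductive cmd : Type :=
| Skip
| ISet of nat & iexp & iexp               (* array, index, value *)
| CSet of nat & iexp & cexpr              (* array, index, value *)
| Seq of cmd & cmd
| If of bexp & cmd & cmd
| While of bexp & cmd.

Fixpoint icost (e : iexp) : nat :=
  match e with
  | INum _ | INSites | INSubs => 1
  | IGet _ e1 | ISize e1 | IDeg e1 => (icost e1).+1
  | IAdd e1 e2 | ISub e1 e2 | IMul e1 e2 | ISite e1 e2 | INbr e1 e2 =>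
      (icost e1 + icost e2).+1
  end.

Fixpoint ccost (e : cexpr) : nat :=
  match e with
  | CI | CTime | CEps => 1
  | CNat e1 | CGet _ e1 | CCoef e1 => (icost e1).+1
  | CAdd e1 e2 | CSub e1 e2 | CMul e1 e2 | CDiv e1 e2 =>
      (ccost e1 + ccost e2).+1
  | CRe e1 | CIm e1 | CAbs e1 | CExp e1 | CLn e1 | CAtan e1 => (ccost e1).+1
  | CTerm e1 e2 e3 | CState e1 e2 e3 => (icost e1 + icost e2 + icost e3).+1
  end.

Fixpoint bcost (e : bexp) : nat :=
  match e with
  | BEq e1 e2 | BLe e1 e2 => (icost e1 + icost e2).+1
  | BLeRe e1 e2 => (ccost e1 + ccost e2).+1
  | BNot e1 => (bcost e1).+1
  | BAnd e1 e2 => (bcost e1 + bcost e2).+1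
  end.

Section Semantics.
Variables (R : realType) (inp : input R).

Record state := State {
  imem : nat -> nat -> nat;               (* array, index |-> content *)
  cmem : nat -> nat -> R[i]
}.

Definition init : state := State (fun _ _ => 0%N) (fun _ _ => 0).

Definition upd (T : Type) (m : nat -> nat -> T) (x j : nat) (w : T) :
    nat -> nat -> T :=
  fun x' j' => if (x' == x) && (j' == j) then w else m x' j'.

Fixpoint ieval (s : state) (e : iexp) : nat :=
  match e with
  | INum n => n
  | IGet x e1 => imem s x (ieval s e1)
  | IAdd e1 e2 => (ieval s e1 + ieval s e2)%N
  | ISub e1 e2 => (ieval s e1 - ieval s e2)%N
  | IMul e1 e2 => (ieval s e1 * ieval s e2)%N
  | INSites => in_nsites inp
  | INSubs => in_nsubs inp
  | ISize e1 => in_size inp (ieval s e1)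
  | ISite e1 e2 => in_site inp (ieval s e1) (ieval s e2)
  | IDeg e1 => in_deg inp (ieval s e1)
  | INbr e1 e2 => in_nbr inp (ieval s e1) (ieval s e2)
  end.

(* CLn and CAtan are the real functions, applied to the real part. *)
Fixpoint ceval (s : state) (e : cexpr) : R[i] :=
  match e with
  | CNat e1 => (ieval s e1)%:R
  | CI => 'i%C
  | CGet x e1 => cmem s x (ieval s e1)
  | CAdd e1 e2 => ceval s e1 + ceval s e2
  | CSub e1 e2 => ceval s e1 - ceval s e2
  | CMul e1 e2 => ceval s e1 * ceval s e2
  | CDiv e1 e2 => ceval s e1 / ceval s e2
  | CRe e1 => (complex.Re (ceval s e1))%:C
  | CIm e1 => (complex.Im (ceval s e1))%:C
  | CAbs e1 => (cabs (ceval s e1))%:C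
  | CExp e1 => cexp (ceval s e1)
  | CLn e1 => (ln (complex.Re (ceval s e1)))%:C
  | CAtan e1 => (atan (complex.Re (ceval s e1)))%:C
  | CCoef e1 => (in_coef inp (ieval s e1))%:C
  | CTerm e1 e2 e3 => in_term inp (ieval s e1) (ieval s e2) (ieval s e3)
  | CState e1 e2 e3 => in_state inp (ieval s e1) (ieval s e2) (ieval s e3)
  | CTime => in_time inp
  | CEps => (in_eps inp)%:C
  end.

Fixpoint beval (s : state) (e : bexp) : bool :=
  match e with
  | BEq e1 e2 => ieval s e1 == ieval s e2
  | BLe e1 e2 => (ieval s e1 <= ieval s e2)%N
  | BLeRe e1 e2 => complex.Re (ceval s e1) <= complex.Re (ceval s e2)
  | BNot e1 => ~~ beval s e1
  | BAnd e1 e2 => beval s e1 && beval s e2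
  end.

(* exec c s T s': started in s, the program c halts in s' after T elementary
   operations. *)
Inductive exec : cmd -> state -> nat -> state -> Prop :=
| ExSkip s : exec Skip s 1 s
| ExISet s x e1 e2 :
    exec (ISet x e1 e2) s (icost e1 + icost e2).+1
      (State (upd (imem s) x (ieval s e1) (ieval s e2)) (cmem s))
| ExCSet s x e1 e2 :
    exec (CSet x e1 e2) s (icost e1 + ccost e2).+1
      (State (imem s) (upd (cmem s) x (ieval s e1) (ceval s e2)))
| ExSeq c1 c2 s s1 s2 T1 T2 :
    exec c1 s T1 s1 -> exec c2 s1 T2 s2 -> exec (Seq c1 c2) s (T1 + T2)%N s2
| ExIf b c1 c2 s s1 T :
    exec (if beval s b then c1 else c2) s T s1 ->
    exec (If b c1 c2) s (bcost b + T).+1 s1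
| ExWhileF b c s :
    ~~ beval s b -> exec (While b c) s (bcost b).+1 s
| ExWhileT b c s s1 s2 T1 T2 :
    beval s b -> exec c s T1 s1 -> exec (While b c) s1 T2 s2 ->
    exec (While b c) s (bcost b + T1 + T2).+1 s2.

Definition output (s : state) : R[i] := cmem s 0 0.

End Semantics.

(* Main.v *)
(* For a set B of subsystems let f_B be the Taylor series of the Loschmidt echo of the sum H_B of the
   terms of H in B. The state being a product, f_B factorizes over sets of subsystems that do not touch
   each other. So the Moebius inverse of B |-> log f_B vanishes on disconnected sets, and its m-th
   coefficient vanishes on sets with more than m elements. Removing one subsystem changes f_B by a
   factor whose logarithm has norm at most 1 / (D + 1) in the weighted l1 norm with radius t_L; this is
   proved by induction on B, with the count (D + 1) ^ (2 (n - 1)) of connected sets of size n around a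
   point. Hence the coefficients a_m of log L satisfy sum_m |a_m| t_L^m <= |S|, which gives the
   analytic branch and the truncation error |S| (|t| / t_L)^(M + 1) at order M.

   The algorithm takes the least M for which this error is at most eps. It visits the connected sets of
   at most M subsystems by walks of length 2 M in the interaction graph, computes for all subsets of a
   visited set the moments tr (H_B^m rho) on the visited sites, passes to the coefficients of the
   logarithm by recursion, and adds the Moebius inverses. For each starting point of the walks this is a
   bounded number of nested loops of length exponential in M, and minimality of M bounds e^M by the
   power in the statement. *)

(* The estimates are made for polynomials modulo X^N with bounds that do not depend on N. A ratio of
   two partition functions then makes sense formally, and absence of zeros need not be known in
   advance. Analysis enters afterwards: the formal logarithm has absolutely summable coefficients at
   [tL], and its sum is a true logarithm because its truncations satisfy f' = a' f up to terms of
   order N. Of the constant in [tL] only 2 e^2 >= 10 is used, as the induction closes for 10 D (D +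
   1) r <= 1. The program is not written out. The predicate [comp] states that some program computes
   a function within a time polynomial in a base quantity, and it is closed under arithmetic,
   branching, loops and tabulation. Hence recursive functions are evaluated through tables. *)
Require Import Defs.
From HB Require Import structures.
From mathcomp Require Import all_boot all_order all_algebra.
From mathcomp Require Import complex reals.
From mathcomp Require Import ring lra zify.
Set Implicit Arguments.
Unset Strict Implicit.
Unset Printing Implicit Defensive.
Import Order.TTheory GRing.Theory Num.Theory.

(** * Truncated power series and their logarithms *)

Local Open Scope ring_scope.

Section TruncatedSeries.
Variables (K : numFieldType) (N : nat).
Implicit Types p q : {poly K}.

Definition eqX p q := forall i, (i < N)%N -> p`_i = q`_i.

Lemma eqX_sym p q : eqX p q -> eqX q p.
Proof. by move=> h i iN; rewrite h. Qed.

Lemma eqX_trans q p s : eqX p q -> eqX q s -> eqX p s.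
Proof. by move=> h1 h2 i iN; rewrite h1 ?h2. Qed.

Lemma eqXD p p' q q' : eqX p p' -> eqX q q' -> eqX (p + q) (p' + q').
Proof. by move=> h1 h2 i iN; rewrite !coefD h1 ?h2. Qed.

Lemma eqX_sum (I : Type) (s : seq I) (P : pred I) (F G : I -> {poly K}) :
  (forall i, P i -> eqX (F i) (G i)) ->
  eqX (\sum_(i <- s | P i) F i) (\sum_(i <- s | P i) G i).
Proof. by move=> h; apply: (big_ind2 eqX) => //; apply: eqXD. Qed.

Lemma eqXM p p' q q' : eqX p p' -> eqX q q' -> eqX (p * q) (p' * q').
Proof.
move=> h1 h2 i iN; rewrite !coefM; apply: eq_bigr => j _.
by rewrite h1 ?h2 //; have := ltn_ord j; lia.
Qed.

Lemma eqX_expr0 p : p`_0 = 0 -> eqX (p ^+ N) 0.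
Proof.
move=> p0 i; rewrite coef0.
elim: N i => // n IH i iN; rewrite exprS coefM big1 // => j _.
case: (posnP j) => [-> | j0]; first by rewrite p0 mul0r.
by rewrite IH ?mulr0 //; have := ltn_ord j; lia.
Qed.

(** Unlike the plain derivative, the Euler operator keeps degrees, so it respects congruence modulo
    X^N without losing an order. *)
Definition eul p := 'X * p^`().

Lemma coef_eul p i : (eul p)`_i = p`_i *+ i.
Proof. by rewrite coefXM; case: i => [|i] //=; rewrite coef_deriv. Qed.

Lemma eulM p q : eul (p * q) = eul p * q + p * eul q.
Proof. by rewrite /eul derivM; ring. Qed.

Lemma eulD p q : eul (p + q) = eul p + eul q.
Proof. by rewrite /eul derivD; ring. Qed.

Lemma eul_sum (I : Type) (s : seq I) (P : pred I) (F : I -> {poly K}) :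
  eul (\sum_(i <- s | P i) F i) = \sum_(i <- s | P i) eul (F i).
Proof. by rewrite /eul raddf_sum mulr_sumr. Qed.

Lemma eqX_eul p q : eqX p q -> eqX (eul p) (eul q).
Proof. by move=> h i iN; rewrite !coef_eul h. Qed.

(** The equation p' = a' p characterizes the logarithm without composing power series. *)
Definition islog (a p : {poly K}) := a`_0 = 0 /\ eqX (eul p) (eul a * p).

Lemma islog_eqX a p q : eqX p q -> islog a p -> islog a q.
Proof.
move=> h [a0 ap]; split=> //.
apply: eqX_trans (eqX_eul (eqX_sym h)) _; apply: eqX_trans ap _.
by apply: eqXM.
Qed.

Lemma islogM a b p q : islog a p -> islog b q -> islog (a + b) (p * q).
Proof.
move=> [a0 ap] [b0 bq]; split; first by rewrite coefD a0 b0 addr0.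
rewrite eulM eulD.
have -> : (eul a + eul b) * (p * q) = eul a * p * q + p * (eul b * q) by ring.
by apply: eqXD; apply: eqXM.
Qed.

(** Since p has constant term 1, coefficient i of [eul (a - b) * p] reduces to i (a_i - b_i) once
    the lower coefficients agree. *)
Lemma islog_uniq a b p : p`_0 = 1 -> islog a p -> islog b p -> eqX a b.
Proof.
move=> p0 [a0 ap] [b0 bp].
have h : eqX (eul (a - b) * p) 0.
  move=> i iN; rewrite /eul derivB mulrBr mulrBl coefB coef0 -/(eul a) -/(eul b).
  by rewrite -ap // -bp // subrr.
move=> i; elim/ltn_ind: i => i IH iN.
case: (posnP i) => [-> | i0]; first by rewrite a0 b0.
have := h _ iN; rewrite coefM coef0 big_ord_recr /= subnn p0 mulr1.
rewrite big1 => [|j _]; last first.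
  by rewrite coef_eul coefB IH ?ltn_ord ?subrr ?mul0rn ?mul0r //; apply: ltn_trans (ltn_ord j) iN.
by rewrite add0r coef_eul coefB => /eqP; rewrite mulrn_eq0 eqn0Ngt i0 subr_eq0 => /eqP.
Qed.

Definition log1D (u : {poly K}) : {poly K} :=
  \sum_(j < N) ((-1) ^+ j / j.+1%:R)%:P * u ^+ j.+1.

Lemma islog_log1D (u : {poly K}) : u`_0 = 0 -> islog (log1D u) (1 + u).
Proof.
move=> u0; split.
  rewrite coef_sum big1 // => j _; rewrite coefCM exprS coefM big_ord1 u0.
  by rewrite mul0r mulr0.
(* Differentiating the Mercator series leaves a geometric sum, which telescopes against [1 + u] up
   to a multiple of u^N, and this vanishes modulo X^N. *)
have -> : eul (log1D u) = eul u * \sum_(j < N) (- u) ^+ j.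
  rewrite eul_sum mulr_sumr; apply: eq_bigr => j _.
  rewrite /eul derivM derivC mul0r add0r deriv_exp /= -[u^`() * _ *+ j.+1]mulr_natl.
  have -> : 'X * (((-1) ^+ j / j.+1%:R)%:P * (j.+1%:R * (u^`() * u ^+ j)))
     = ((-1) ^+ j / j.+1%:R * j.+1%:R)%:P * ('X * u^`() * u ^+ j).
    by rewrite (polyCM _ j.+1%:R) polyCMn polyC1; ring.
  by rewrite -mulrA mulVf ?pnatr_eq0 // mulr1 rmorphXn /= polyCN [(- u) ^+ j]exprNn; ring.
have -> : eul u * (\sum_(j < N) (- u) ^+ j) * (1 + u) = eul u * (1 - (- u) ^+ N).
  rewrite -mulrA; congr (_ * _).
  by rewrite -[RHS]opprB subrX1; ring.
rewrite [eul (1 + u)]eulD /eul derivC mulr0 add0r.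
move=> i iN; rewrite mulrBr mulr1 coefB.
rewrite [X in _ - X](_ : _ = (('X * u^`()) * 0)`_i); first by rewrite mulr0 coef0 subr0.
by apply: eqXM iN => //; apply: eqX_expr0; rewrite coefN u0 oppr0.
Qed.

(** * Weighted l1 norms of truncated series *)

Section Norm.
Variable r : K.
Hypothesis r0 : 0 <= r.

Definition nrm p : K := \sum_(i < N) `|p`_i| * r ^+ i.

Lemma nrm_ge0 p : 0 <= nrm p.
Proof. by apply: sumr_ge0 => i _; rewrite mulr_ge0 ?exprn_ge0. Qed.

Lemma nrm_eqX p q : eqX p q -> nrm p = nrm q.
Proof. by move=> h; apply: eq_bigr => i _; rewrite h. Qed.

Lemma nrmD p q : nrm (p + q) <= nrm p + nrm q.
Proof.
rewrite -big_split /=; apply: ler_sum => i _.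
by rewrite coefD -mulrDl ler_wpM2r ?exprn_ge0 ?ler_normD.
Qed.

Lemma nrm0 : nrm 0 = 0.
Proof. by rewrite /nrm big1 // => i _; rewrite coef0 normr0 mul0r. Qed.

Lemma nrm_sum (I : Type) (s : seq I) (P : pred I) (F : I -> {poly K}) :
  nrm (\sum_(i <- s | P i) F i) <= \sum_(i <- s | P i) nrm (F i).
Proof.
elim/big_rec2: _ => [|i x y _ h]; first by rewrite nrm0.
by apply: le_trans (nrmD _ _) _; rewrite lerD2l.
Qed.

Lemma nrmN p : nrm (- p) = nrm p.
Proof. by apply: eq_bigr => i _; rewrite coefN normrN. Qed.

Lemma nrm1 : nrm 1 <= 1.
Proof.
rewrite /nrm; case: N => [|n]; first by rewrite big_ord0.
rewrite big_ord_recl big1 ?coef1 ?normr1 ?mul1r ?addr0 // => i _.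
by rewrite coef1 normr0 mul0r.
Qed.

Lemma nrmCM c p : nrm (c%:P * p) = `|c| * nrm p.
Proof. by rewrite mulr_sumr; apply: eq_bigr => i _; rewrite coefCM normrM mulrA. Qed.

(** Truncation only discards nonnegative terms from the product of the two sums. *)
Lemma nrmM p q : nrm (p * q) <= nrm p * nrm q.
Proof.
pose a i := `|p`_i| * r ^+ i; pose b i := `|q`_i| * r ^+ i.
have a0 i : 0 <= a i by rewrite mulr_ge0 ?exprn_ge0.
have b0 i : 0 <= b i by rewrite mulr_ge0 ?exprn_ge0.
have h1 : nrm (p * q) <= \sum_(i < N) \sum_(j < N | (j <= i)%N) a j * b (i - j)%N.
  apply: ler_sum => i _; rewrite coefM.
  apply: le_trans (ler_wpM2r (exprn_ge0 _ r0) (ler_norm_sum _ _ _)) _.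
  rewrite mulr_suml (big_ord_widen N (fun j => `|p`_j * q`_(i - j)| * r ^+ i)) //.
  rewrite le_eqVlt; apply/orP; left; apply/eqP.
  apply: eq_big => j; first by rewrite ltnS.
  by rewrite ltnS => ji; rewrite normrM /a /b -[in r ^+ i](subnKC ji) exprD; ring.
apply: le_trans h1 _.
rewrite (exchange_big_dep xpredT) //= mulr_suml; apply: ler_sum => j _.
rewrite -mulr_sumr ler_wpM2l //.
rewrite -(big_mkord (fun i => j <= i)%N (fun i => b (i - j)%N)).
have -> : \sum_(0 <= i < N | (j <= i)%N) b (i - j)%N = \sum_(j <= i < N) b (i - j)%N.
  by rewrite [RHS](big_nat_widenl _ 0).
rewrite -{1}(add0n j) big_addn.
under eq_bigr do rewrite addnK.
rewrite (big_mkord xpredT) /nrm -[X in _ <= X](big_mkord xpredT b).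
rewrite [leRHS](@big_cat_nat _ _ _ (N - j)%N) ?leq_subr //= big_mkord lerDl.
by apply: sumr_ge0.
Qed.

Lemma nrmX p n : nrm (p ^+ n) <= nrm p ^+ n.
Proof.
elim: n => [|n IH]; first by rewrite !expr0 nrm1.
by rewrite !exprS; apply: le_trans (nrmM _ _) _; rewrite ler_wpM2l ?nrm_ge0.
Qed.

Lemma geom_le (d : K) n : 0 <= d -> d < 1 -> \sum_(j < n) d ^+ j <= (1 - d)^-1.
Proof.
move=> d0 d1; have h : 0 < 1 - d by rewrite subr_gt0.
rewrite -[(1 - d)^-1]mul1r ler_pdivlMr //.
have -> : (\sum_(j < n) d ^+ j) * (1 - d) = 1 - d ^+ n.
  by rewrite -[RHS]opprB subrX1; ring.
by rewrite lerBlDr lerDl exprn_ge0.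
Qed.

(** The inverse is the Neumann series; N terms suffice modulo X^N. *)
Lemma inv1D (u : {poly K}) d : u`_0 = 0 -> nrm u <= d -> d < 1 ->
  exists2 q, eqX (q * (1 + u)) 1 & nrm q <= (1 - d)^-1.
Proof.
move=> u0 ud d1; have d0 : 0 <= d by apply: le_trans ud; apply: nrm_ge0.
exists (\sum_(j < N) (- u) ^+ j).
  have -> : (\sum_(j < N) (- u) ^+ j) * (1 + u) = 1 - (- u) ^+ N.
    by rewrite -[RHS]opprB subrX1; ring.
  move=> i iN; rewrite coefB (eqX_expr0 _ iN) ?coef0 ?subr0 //.
  by rewrite coefN u0 oppr0.
apply: le_trans (geom_le N d0 d1).
apply: le_trans (nrm_sum _ _ _) _; apply: ler_sum => j _.
apply: le_trans (nrmX _ _) _; rewrite nrmN.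
by rewrite lerXn2r ?nnegrE ?nrm_ge0.
Qed.

Lemma nrm_log1D (u : {poly K}) d : nrm u <= d -> d < 1 -> nrm (log1D u) <= d / (1 - d).
Proof.
move=> ud d1; have d0 : 0 <= d by apply: le_trans ud; apply: nrm_ge0.
apply: le_trans (ler_wpM2l d0 (geom_le N d0 d1)); rewrite mulr_sumr.
apply: le_trans (nrm_sum _ _ _) _; apply: ler_sum => j _.
rewrite nrmCM normrM normrX normrN1 expr1n mul1r -exprS.
apply: le_trans (_ : _ <= 1 * nrm (u ^+ j.+1)) _.
  by rewrite ler_wpM2r ?nrm_ge0 // normfV normr_nat invf_le1 ?ltr0n ?ler1n.
rewrite mul1r; apply: le_trans (nrmX _ _) _.
by rewrite lerXn2r ?nnegrE ?nrm_ge0.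
Qed.

End Norm.
End TruncatedSeries.

(** * Moebius inversion on finite sets *)

Lemma cardsU_disj (T : finType) (A B : {set T}) :
  [disjoint A & B] -> #|A :|: B| = (#|A| + #|B|)%N.
Proof. by rewrite -setI_eq0 cardsU => /eqP ->; rewrite cards0 subn0. Qed.

Section Moebius.
Variables (T : finType) (V : comNzRingType).
Implicit Types (A B C : {set T}) (f g : {set T} -> V).

(** For x in A but not in C, toggling membership of x is an involution of the interval that reverses
    all signs. *)
Lemma sum_sign_interval A C :
  C \subset A ->
  \sum_(B : {set T} | (C \subset B) && (B \subset A)) (-1) ^+ #|B|
    = (-1) ^+ #|A| *+ (C == A) :> V.
Proof.
move=> CA; have [<-|CneA] := eqVneq.
  rewrite (big_pred1 C) ?mulr1n // => B /=.
  by rewrite eqEsubset andbC.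
rewrite mulr0n.
have [x xA xC] : exists2 x, x \in A & x \notin C.
  by apply/subsetPn; apply: contra CneA => AC; rewrite eqEsubset CA.
(* In a ring of characteristic 2 one cannot conclude from s = - s, so the sum is computed over the
   integers and then mapped to [V]. *)
pose s : int := \sum_(B : {set T} | (C \subset B) && (B \subset A)) (-1) ^+ #|B|.
have s0 : s = 0.
  suff : s = - s by lia.
  pose h B := if x \in B then B :\ x else x |: B.
  have hK : involutive h.
    move=> B; rewrite /h; case xB : (x \in B).
      by rewrite setD11 setD1K.
    by rewrite setU11 setU1K // xB.
  rewrite {1}/s (reindex_inj (inv_inj hK)) /= -sumrN; apply: eq_big => [B|B _].
    rewrite /h; case: ifPn => xB.
      rewrite subsetD1 xC andbT; congr (_ && _).
      apply/idP/idP => [k|]; last by apply: subset_trans (subD1set _ _).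
      by rewrite -(setD1K xB) subUset sub1set xA.
    rewrite subUset sub1set xA; congr (_ && _).
    apply/idP/idP => [/subsetP k|k]; last by apply: subset_trans k (subsetUr _ _).
    apply/subsetP => y yC; have := k _ yC.
    by rewrite !inE; case: eqP yC xC => [-> ->|].
  rewrite /h; case: ifPn => xB; last by rewrite cardsU1 xB exprS mulN1r.
  by rewrite [in RHS](cardsD1 x) xB exprS mulN1r opprK.
have := congr1 (fun z : int => z%:~R : V) s0; rewrite rmorph0 => s0V.
by rewrite -[RHS]s0V rmorph_sum; apply: eq_bigr => B _; rewrite rmorphXn /= rmorphN1.
Qed.

Definition mob f A := \sum_(B : {set T} | B \subset A) (-1) ^+ (#|A| + #|B|) * f B.

Lemma mob_uniq f g :
  (forall A, f A = \sum_(B : {set T} | B \subset A) g B) -> mob f =1 g.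
Proof.
move=> fg A; rewrite /mob.
under eq_bigr do rewrite fg mulr_sumr.
rewrite (exchange_big_dep (fun C => C \subset A)) /=; last first.
  by move=> B C BA CB; apply: subset_trans BA.
rewrite (bigD1 A) //= [X in _ + X]big1 ?addr0 => [|C /andP[CA CneA]].
  rewrite (big_pred1 A) => [|B]; first by rewrite addnn -signr_odd odd_double mul1r.
  by rewrite /= -eqEsubset.
rewrite -mulr_suml (eq_bigl (fun B : {set T} => (C \subset B) && (B \subset A))); last first.
  by move=> B; rewrite andbC.
under eq_bigr do rewrite exprD.
by rewrite -mulr_sumr sum_sign_interval // (negPf CneA) mulr0n mulr0 mul0r.
Qed.

Lemma mob_sum f A : f A = \sum_(B : {set T} | B \subset A) mob f B.
Proof.
rewrite /mob (exchange_big_dep (fun C => C \subset A)) /=; last first.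
  by move=> B C BA CB; apply: subset_trans BA.
rewrite (bigD1 A) //= [X in _ + X]big1 ?addr0 => [|C /andP[CA CneA]].
  rewrite (big_pred1 A) => [|B]; first by rewrite addnn -signr_odd odd_double mul1r.
  by rewrite /= -eqEsubset.
rewrite -mulr_suml (eq_bigl (fun B : {set T} => (C \subset B) && (B \subset A))); last first.
  by move=> B; rewrite andbC.
under eq_bigr do rewrite exprD.
by rewrite -mulr_suml sum_sign_interval // (negPf CneA) mulr0n !mul0r.
Qed.

Lemma sum_subsetU (W : nmodType) (F : {set T} -> W) A A' : [disjoint A & A'] ->
  \sum_(B : {set T} | B \subset A :|: A') F B
   = \sum_(B : {set T} | B \subset A) \sum_(B' : {set T} | B' \subset A') F (B :|: B').
Proof.
move=> AA'; rewrite pair_big /=.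
rewrite (reindex_onto (fun p : {set T} * {set T} => p.1 :|: p.2)
                      (fun B => (B :&: A, B :&: A'))) /=; last first.
  by move=> B BA; rewrite -setIUr; apply/setIidPl.
apply: eq_bigl => -[B B'] /=; apply/andP/andP => -[].
  move=> _ /eqP[<- <-]; split; apply: subsetIr.
move=> BA BA'; split; first by apply: setUSS.
rewrite !setIUl (setIidPl BA) (setIidPl BA').
have /eqP -> : B' :&: A == set0.
  by rewrite setI_eq0 disjoint_sym; apply: disjointWr BA' _.
have /eqP -> : B :&: A' == set0 by rewrite setI_eq0; apply: disjointWl BA _.
by rewrite setU0 set0U.
Qed.

Lemma sum_sign_subset A : A != set0 ->
  \sum_(B : {set T} | B \subset A) (-1) ^+ #|B| = 0 :> V.
Proof.
move=> A0; have := sum_sign_interval (sub0set A).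
by rewrite eq_sym (negPf A0) mulr0n => h; rewrite -[RHS]h; apply: eq_bigl => B; rewrite sub0set.
Qed.

(** Additivity splits the double sum over subsets into two products, each with an alternating sum
    over the subsets of a nonempty set as a factor. *)
Lemma mob_eq0 f A A' : [disjoint A & A'] -> A != set0 -> A' != set0 ->
  (forall B B' : {set T}, B \subset A -> B' \subset A' -> f (B :|: B') = f B + f B') ->
  mob f (A :|: A') = 0.
Proof.
move=> dA A0 A'0 fD; rewrite /mob sum_subsetU //.
transitivity (\sum_(B : {set T} | B \subset A) \sum_(B' : {set T} | B' \subset A')
   ((-1) ^+ #|A :|: A'| * ((-1) ^+ #|B| * f B * (-1) ^+ #|B'|)
    + (-1) ^+ #|A :|: A'| * ((-1) ^+ #|B| * ((-1) ^+ #|B'| * f B')))).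
  apply: eq_bigr => B BA; apply: eq_bigr => B' BA'.
  have -> : #|B :|: B'| = (#|B| + #|B'|)%N.
    apply: cardsU_disj; apply: disjointWl BA _; exact: disjointWr BA' dA.
  by rewrite fD // !exprD; ring.
under eq_bigr do rewrite big_split /= -!mulr_sumr (sum_sign_subset A'0) !mulr0 add0r.
by rewrite -mulr_sumr -mulr_suml (sum_sign_subset A0) mul0r mulr0.
Qed.

End Moebius.

(** * Connected sets and walks *)

Local Open Scope nat_scope.

Section Connected.
Variables (T : finType) (e : rel T).
Hypothesis e_sym : symmetric e.
Implicit Types (A B C : {set T}) (x y : T).

Definition separated A B :=
  [forall u in A, forall v in B, (u != v) && ~~ e u v].

Lemma separatedP A B :
  reflect (forall u v, u \in A -> v \in B -> (u != v) && ~~ e u v) (separated A B).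
Proof.
apply: (iffP 'forall_in_forall_inP) => h u v; first by move=> uA vB; apply: h.
by move=> vB ; apply: h.
Qed.

Lemma separatedS A A' B B' :
  A \subset A' -> B \subset B' -> separated A' B' -> separated A B.
Proof.
move=> /subsetP AA /subsetP BB /separatedP h; apply/separatedP => u v uA vB.
by apply: h; [apply: AA | apply: BB].
Qed.

Lemma separated_disjoint A B : separated A B -> [disjoint A & B].
Proof.
move=> /separatedP h; rewrite disjoint_subset; apply/subsetP => u uA.
by apply/negP => uB; have := h _ _ uA uB; rewrite eqxx.
Qed.

(* Connectedness by separations instead of paths, as the clusters are found by Moebius inversion. *)
Definition conn A x := (x \in A) &&
  [forall B : {set T}, [&& x \in B, B \subset A & separated B (A :\: B)] ==> (B == A)].

Lemma connP A x :
  reflect (x \in A /\ forall B, x \in B -> B \subset A -> separated B (A :\: B) -> B = A)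
    (conn A x).
Proof.
apply: (iffP andP) => -[xA h]; split=> //.
  by move=> B xB BA sB; apply/eqP; have /forallP/(_ B) := h; rewrite xB BA sB.
by apply/forallP => B; apply/implyP => /and3P[xB BA sB]; apply/eqP/h.
Qed.

Definition component A x :=
  \bigcap_(B : {set T} | [&& x \in B, B \subset A & separated B (A :\: B)]) B.

Section Component.
Variables (A : {set T}) (x : T).
Hypothesis xA : x \in A.

Lemma component_id : x \in component A x.
Proof. by apply/bigcapP => B /and3P[]. Qed.

Lemma component_sub : component A x \subset A.
Proof.
apply: bigcap_inf; rewrite xA subxx setDv /=.
by apply/separatedP => u v _; rewrite inE.
Qed.

Lemma component_sep : separated (component A x) (A :\: component A x).
Proof.
apply/separatedP => u v uC; rewrite inE => /andP[vC vA].
have [B /and3P[xB BA sB] vB] : exists2 B : {set T},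
    [&& x \in B, B \subset A & separated B (A :\: B)] & v \notin B.
  apply/exists_inP; apply: contraR vC => /exists_inPn h.
  by apply/bigcapP => B /h; rewrite negbK.
have uB : u \in B by move/bigcapP: uC; apply; rewrite xB BA.
by move/separatedP: sB; apply=> //; rewrite inE vB.
Qed.

Lemma component_min B : x \in B -> B \subset A -> separated B (A :\: B) ->
  component A x \subset B.
Proof. by move=> xB BA sB; apply: bigcap_inf; rewrite xB BA. Qed.

Lemma component_conn : conn (component A x) x.
Proof.
apply/connP; split; first exact: component_id.
move=> B xB BC sB; apply/eqP; rewrite eqEsubset BC /=.
apply: component_min => //; first by apply: subset_trans BC component_sub.
apply/separatedP => u v uB; rewrite inE => /andP[vB vA].
have [vC|vC] := boolP (v \in component A x).
  by move/separatedP: sB; apply=> //; rewrite inE vB.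
move/separatedP: component_sep; apply; last by rewrite inE vC.
exact: (subsetP BC).
Qed.

End Component.

(** This is what allows sets containing x to be reindexed as a connected set around x together with
    a separated remainder. *)
Lemma componentU A A' x : conn A x -> separated A A' -> component (A :|: A') x = A.
Proof.
move=> /connP[xA cA] sA; have xU : x \in A :|: A' by rewrite inE xA.
have CA : component (A :|: A') x \subset A.
  apply: component_min => //; first exact: subsetUl.
  by apply: separatedS sA => //; rewrite setDUl setDv set0U subsetDl.
apply: cA => //; first exact: component_id.
apply: separatedS (component_sep _ _) => //.
by apply: setSD; apply: subsetUl.
Qed.

Lemma component_eq A x : x \in A -> (component A x == A) = conn A x.
Proof.
move=> xA; apply/eqP/idP => [<-|cA]; first exact: component_conn.
rewrite -{1}(setU0 A) componentU //.
by apply/separatedP => u v _; rewrite inE.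
Qed.

Section Walks.
Variables (D : nat) (nb : T -> nat -> T).
Hypothesis nb_adj : forall x y, e x y -> exists2 j, (j <= D)%N & nb x j = y.
Hypothesis nb_stay : forall x, nb x D = x.

Definition visited x (s : seq nat) : {set T} := [set y in x :: scanl nb x s].

(** The closed path grows by one new element at a time through a detour to it and back. Each costs
    two steps, whence the length 2 (|A| - 1). *)
Lemma conn_closed_path A x : conn A x ->
  exists p : seq T, [/\ path e x p, last x p = x, size p = (2 * #|A|.-1)%N
    & [set y in x :: p] = A].
Proof.
move=> /connP[xA cA].
suff h n : (0 < n <= #|A|)%N -> exists p : seq T,
    [/\ path e x p, last x p = x, size p = (2 * n.-1)%N,
        [set y in x :: p] \subset A & #|[set y in x :: p]| = n].
  have A0 : (0 < #|A|)%N by apply/card_gt0P; exists x.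
  have [|p [h1 h2 h3 h4 h5]] := h #|A|; first by rewrite A0 leqnn.
  by exists p; split=> //; apply/eqP; rewrite eqEcard h4 h5 leqnn.
elim: n => // -[_ _|n IH nA].
  exists [::]; split=> //.
    by apply/subsetP => y; rewrite !inE => /eqP ->.
  by rewrite (_ : [set y in [:: x]] = [set x]) ?cards1 //; apply/setP => y; rewrite !inE.
have [|p [pp lp sp pA cp]] := IH; first by lia.
pose B := [set y in x :: p].
have BE : B =i x :: p by move=> y; rewrite inE.
(* If no edge led from B to the rest of A, connectedness would force B = A, against the
   cardinality. *)
have [u [v [uB vA vB euv]]] : exists u v, [/\ u \in B, v \in A, v \notin B & e u v].
  have : ~~ separated B (A :\: B).
    apply/negP => sB; have BA : B = A by apply: cA => //; rewrite !inE eqxx.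
    by move: nA; rewrite -BA cp; lia.
  case/forallPn => u; rewrite negb_imply => /andP[uB /forallPn[v]].
  rewrite negb_imply inE => /andP[/andP[vB vA]]; rewrite negb_and !negbK => /orP[/eqP uv|euv].
    by rewrite -uv uB in vB.
  by exists u, v.
have uxp : u \in x :: p by move: uB; rewrite inE.
have cB : #|B| = n.+1 by [].
have BA : B \subset A by [].
move: B BE uB vB cB BA {pA cp} => B.
case/splitPl: uxp pp lp sp => p1 p2 lp1 pp lp sp BE uB vB cB BA.
move: pp; rewrite cat_path lp1 => /andP[pp1 pp2].
exists (p1 ++ v :: u :: p2).
have setE : [set y in x :: (p1 ++ [:: v, u & p2])] = v |: B.
  apply/setP => y; rewrite !inE BE !inE !mem_cat !inE.
  have : u \in x :: p1 by rewrite -lp1 mem_last.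
  rewrite !inE; case: (y =P u) => [->|_]; last first.
    by rewrite orFb orbA [in RHS]orbA; do ! case: (_ == _); do ! case: (_ \in _).
  by case/orP => [/eqP ->|->]; rewrite ?eqxx ?orbT.
split.
- by rewrite cat_path pp1 lp1 /= euv e_sym euv.
- by move: lp; rewrite !last_cat /= lp1.
- by move: sp; rewrite !size_cat /=; lia.
- by rewrite setE subUset sub1set vA.
- by rewrite setE cardsU1 vB cB.
Qed.

Lemma conn_walk A x L : conn A x -> (2 * #|A|.-1 <= L)%N ->
  exists s : seq nat, [/\ size s = L, all (fun j => j <= D)%N s & visited x s = A].
Proof.
move=> /conn_closed_path[p [pp lp sp pA]] pL.
have [s [ss sD sE]] : exists s : seq nat,
    [/\ size s = size p, all (fun j => j <= D)%N s & scanl nb x s = p].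
  elim: p x pp {lp sp pL pA} => [|y p IH] x /=; first by exists [::].
  case/andP=> /nb_adj[j jD jy] /IH[s [ss sD sE]].
  by exists (j :: s); rewrite /= jy ss sE jD.
(* The move [D] stays in place, so it pads the walk to the prescribed length. *)
exists (s ++ nseq (L - size p) D); split.
- by rewrite size_cat size_nseq ss; lia.
- by rewrite all_cat sD all_nseq leqnn orbT.
rewrite -pA; apply/setP => y; rewrite !inE scanl_cat sE.
have -> : foldl nb x s = x by rewrite -[RHS]lp -sE; elim: (s) {+}x => //=.
have h n : (y \in scanl nb x (nseq n D)) -> y == x.
  by elim: n => //= n IH; rewrite nb_stay inE => /orP[//|/IH].
rewrite mem_cat orbA; case: (boolP (y \in scanl nb _ _)); last by rewrite orbF.
by move/h => ->.
Qed.

(** A connected set is recovered from the moves of a walk that visits it, so there are at most as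
    many sets as sequences of moves. *)
Lemma card_conn_le x n :
  #|[set A : {set T} | conn A x & #|A| == n]| <= D.+1 ^ (2 * n.-1).
Proof.
pose F (s : (2 * n.-1).-tuple 'I_D.+1) := visited x [seq val j | j <- s].
apply: leq_trans (_ : #|F @: [set: (2 * n.-1).-tuple 'I_D.+1]| <= _).
  apply: subset_leq_card; apply/subsetP => A; rewrite inE => /andP[cA /eqP An].
  have [|s [sz sD <-]] := conn_walk (L := (2 * n.-1)%N) cA; first by rewrite An.
  have sz' : size (map (fun j => inord j : 'I_D.+1) s) == (2 * n.-1)%N by rewrite size_map sz.
  apply/imsetP; exists (Tuple sz') => //; rewrite /F /= -map_comp.
  congr (visited x _); rewrite -[LHS]map_id; apply/eq_in_map => j js /=.
  by rewrite inordK // ltnS; move/allP: sD; apply.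
by apply: leq_trans (leq_imset_card _ _) _; rewrite cardsT card_tuple card_ord.
Qed.

End Walks.

Section Neighbourhood.
Variable D : nat.
Hypothesis deg_le : forall x, #|[set y | e x y]| <= D.

Definition nbhd A : {set T} := [set v | [exists u in A, (u == v) || e u v]].

Lemma nbhd_separated A B : separated A B = [disjoint B & nbhd A].
Proof.
apply/separatedP/pred0P => h.
  move=> v /=; apply/negbTE/negP => /andP[vB]; rewrite inE => /exists_inP[u uA].
  by have /andP[/negbTE -> /negbTE ->] := h _ _ uA vB.
move=> u v uA vB; have := h v; rewrite /= vB inE /= => /negbT/exists_inPn/(_ u uA).
by rewrite negb_or.
Qed.

Lemma card_nbhd A : #|nbhd A| <= D.+1 * #|A|.
Proof.
have -> : nbhd A = \bigcup_(u in A) (u |: [set v | e u v]).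
  apply/setP => v; rewrite inE; apply/exists_inP/bigcupP => -[u uA h]; exists u => //.
    by rewrite !inE eq_sym.
  by move: h; rewrite !inE eq_sym.
rewrite mulnC -sum_nat_const; apply: leq_trans (_ : \sum_(u in A) #|u |: [set v | e u v]| <= _).
  elim/big_rec2: _ => [|u k B _ h]; first by rewrite cards0.
  by apply: leq_trans (leq_card_setU _ _) _; rewrite leq_add2l.
apply: leq_sum => u _; rewrite cardsU1; have := deg_le u; case: (_ \notin _); lia.
Qed.

(** The default value x turns every position past the degree, in particular [D], into the staying
    move. *)
Definition enum_nb x j := nth x (enum [set y | e x y]) j.

Lemma enum_nb_adj x y : e x y -> exists2 j, (j <= D)%N & enum_nb x j = y.
Proof.
move=> exy; have yx : y \in enum [set y | e x y] by rewrite mem_enum inE.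
exists (index y (enum [set y | e x y])); last by rewrite /enum_nb nth_index.
by apply: leq_trans (deg_le x); rewrite cardE ltnW // index_mem.
Qed.

Lemma enum_nb_stay x : enum_nb x D = x.
Proof. by rewrite /enum_nb nth_default // -cardE. Qed.

Lemma card_connected x n :
  #|[set A : {set T} | conn A x & #|A| == n]| <= D.+1 ^ (2 * n.-1).
Proof. exact: card_conn_le enum_nb_adj enum_nb_stay _ _. Qed.

End Neighbourhood.
End Connected.

(** * Convergence of the cluster expansion *)

Local Open Scope ring_scope.

Section SurjectionCount.
Variables (K : numFieldType).

Fixpoint surj (m n : nat) : nat :=
  if m is m'.+1 then (n * (surj m' n + surj m' n.-1))%N else (n == 0%N).

Lemma card_surj (T : finType) m (A : {set T}) :
  #|[set s : m.-tuple T | [set y in s] == A]| = surj m #|A|.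
Proof.
elim: m A => [|m IH] A.
  rewrite /= cards_eq0; case: eqVneq => [->|A0].
    rewrite (_ : [set _ | _] = [set [tuple]]) ?cards1 //; apply/setP => s.
    by rewrite !inE tuple0 eqxx; apply/eqP/setP => y; rewrite !inE.
  apply/eqP; rewrite cards_eq0; apply/eqP/setP => s.
  rewrite !inE tuple0; apply/negbTE; rewrite eq_sym; apply: contra A0 => /eqP ->.
  by apply/eqP/setP => y; rewrite !inE.
rewrite -sum1_card.
rewrite (reindex (fun p : T * m.-tuple T => [tuple of p.1 :: p.2])) /=; last first.
  exists (fun s : m.+1.-tuple T => (thead s, [tuple of behead s])).
    by move=> [a s] _ /=; rewrite theadE; congr pair; apply/val_inj.
  by move=> s _; rewrite /= -tuple_eta.
(* Either the tail already covers A, or it misses exactly the head: the two terms in the recursion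
   of [surj]. *)
rewrite (eq_bigl (fun p : T * m.-tuple T => (p.1 \in A) &&
   (([set y in p.2] == A) || ([set y in p.2] == A :\ p.1)))); last first.
  move=> [a s] /=; rewrite inE.
  have -> : [set y in a :: s] = a |: [set y in s].
    by apply/setP => y; rewrite !inE.
  apply/eqP/andP => [<-|[aA /orP[]/eqP->]]; last 2 first.
  - by apply/setUidPr; rewrite sub1set.
  - by rewrite setD1K.
  rewrite setU11; split=> //; case: (boolP (a \in [set y in s])) => h.
    by apply/orP; left; apply/eqP; rewrite (setUidPr _) ?sub1set.
  by rewrite setU1K // eqxx orbT.
rewrite -(pair_big_dep (mem A) (fun a (s : m.-tuple T) =>
   ([set y in s] == A) || ([set y in s] == A :\ a)) (fun _ _ => 1%N)) /=.
rewrite -sum_nat_const; apply: eq_bigr => a aA.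
rewrite -(IH A) (_ : #|A|.-1 = #|A :\ a|); last by rewrite (cardsD1 a A) aA.
rewrite -(IH (A :\ a)) -cardsU_disj.
  by rewrite -sum1_card; apply: eq_bigl => s; rewrite !inE.
rewrite -setI_eq0; apply/eqP/setP => s; rewrite !inE; apply/negbTE/negP.
move=> /andP[/eqP -> /eqP h]; move: aA; rewrite h.
by rewrite !inE eqxx.
Qed.

(** With E = e^X - 1 one has (E^n)' = n (E^n + E^(n-1)); on coefficients this is the recursion of
    [surj], up to factorials. *)
Lemma coef_expX N m n : (m < N)%N ->
  ((\poly_(j < N) (if j == 0 then 0 else j`!%:R^-1)) ^+ n : {poly K})`_m
    = (surj m n)%:R / m`!%:R.
Proof.
set E := \poly_(j < N) _.
have E1 i : (i.+1 < N)%N -> E^`()`_i = (1 + E)`_i.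
  move=> iN; rewrite coef_deriv coefD coef1 !coef_poly iN (ltnW iN) /=.
  have -> : (i == 0)%:R + (if i == 0%N then 0 else i`!%:R^-1) = i`!%:R^-1 :> K.
    by case: i {iN} => [|i]; rewrite ?fact0 ?invr1 ?addr0 ?add0r.
  rewrite -[_ *+ i.+1]mulr_natr factS natrM.
  by rewrite invfM mulrAC mulVf ?pnatr_eq0 // mul1r.
elim: m n => [|m IH] n mN.
  rewrite /= fact0 divr1; case: n => [|n]; first by rewrite expr0 coef1.
  by rewrite exprS coefM big_ord1 coef_poly mN mul0r.
have : (E ^+ n)^`()`_m = ((E ^+ n + E ^+ n.-1) *+ n)`_m.
  case: n => [|n]; first by rewrite expr0 derivC coef0.
  rewrite deriv_exp !coefMn; congr (_ *+ _).
  have -> : E ^+ n.+1 + E ^+ n.+1.-1 = (1 + E) * E ^+ n by rewrite exprS /=; ring.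
  rewrite !coefM.
  by apply: eq_bigr => j _; rewrite E1 //; have := ltn_ord j; lia.
rewrite coef_deriv coefMn coefD !IH 1?ltnW // => h.
have m0 : m.+1%:R != 0 :> K by rewrite pnatr_eq0.
apply: (mulIf m0); rewrite mulr_natr h -[_ *+ n]mulr_natr.
have -> : surj m.+1 n = (n * (surj m n + surj m n.-1))%N by [].
rewrite factS 2!natrM invfM -[RHS]mulrA [_ * m.+1%:R]mulrAC mulVf // natrD; ring.
Qed.

End SurjectionCount.

(** * An abstract polymer model: weighted words, multiplicative over separated sets *)

Section Cluster.
Variables (K : numFieldType) (T : finType) (e : rel T) (D : nat).
Hypothesis e_sym : symmetric e.
Hypothesis deg_le : forall x, (#|[set y | e x y]| <= D)%N.
Hypothesis D_gt0 : (0 < D)%N.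
Variables (f : {set T} -> nat -> K) (tau : seq T -> K).
Hypothesis f_tau : forall B m,
  f B m = \sum_(s : m.-tuple T | all (fun x => x \in B) s) tau s.
Hypothesis tau_le : forall s, `|tau s| <= (size s)`!%:R^-1.
Hypothesis f0 : forall B, f B 0 = 1.
Hypothesis fM : forall B C m, separated e B C ->
  f (B :|: C) m = \sum_(j < m.+1) f B j * f C (m - j).

Section Truncated.
Variables (N : nat) (r : K).
Hypothesis r0 : 0 < r.
Hypothesis r_le : 10%:R * D%:R * D.+1%:R * r <= 1.

Implicit Types (A B C S : {set T}) (x y : T).

Definition Zser B : {poly K} := \poly_(m < N) f B m.

(** The words that use every letter of A: the Moebius inverse of the partition function, defined
    directly so that its norm can be bounded by counting. *)
Definition polymer A : {poly K} :=
  \poly_(m < N) \sum_(s : m.-tuple T | [set y in s] == A) tau s.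

Lemma Zser_sum B : Zser B = \sum_(A : {set T} | A \subset B) polymer A.
Proof.
apply/polyP => m; rewrite coef_sum coef_poly; case: ltnP => mN; last first.
  by rewrite big1 // => A _; rewrite coef_poly ltnNge mN.
rewrite f_tau (partition_big (fun s : m.-tuple T => [set y in s]) (fun A => A \subset B)) /=.
  apply: eq_bigr => A AB; rewrite coef_poly mN; apply: eq_bigl => s.
  rewrite andb_idl // => /eqP sA; apply/allP => y ys.
  by apply: (subsetP AB); rewrite -sA inE.
by move=> s /allP h; apply/subsetP => y; rewrite inE => /h.
Qed.

Lemma mob_Zser A : mob Zser A = polymer A.
Proof. by apply: mob_uniq; apply: Zser_sum. Qed.

Lemma ZserM B C : separated e B C -> eqX N (Zser (B :|: C)) (Zser B * Zser C).
Proof.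
move=> sBC m mN; rewrite coef_poly mN fM // coefM; apply: eq_bigr => j _.
have jm : (j <= m)%N by rewrite -ltnS.
by rewrite !coef_poly (leq_ltn_trans jm mN) (leq_ltn_trans (leq_subr j m) mN).
Qed.

(** Multiplicativity is assumed for [f] and not for the single weights [tau], so it is transferred
    to polymers by Moebius inversion. *)
Lemma polymerM A A' : separated e A A' ->
  eqX N (polymer (A :|: A')) (polymer A * polymer A').
Proof.
move=> sA; have dA := separated_disjoint sA.
rewrite -!mob_Zser /mob sum_subsetU // mulr_suml.
apply: eqX_sum => B BA; rewrite mulr_sumr; apply: eqX_sum => B' BA'.
have sB : separated e B B' by apply: separatedS sA.
rewrite !cardsU_disj ?(separated_disjoint sB) //.
have -> : (-1) ^+ (#|A| + #|B|) * Zser B * ((-1) ^+ (#|A'| + #|B'|) * Zser B')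
  = (-1) ^+ (#|A| + #|A'| + (#|B| + #|B'|)) * (Zser B * Zser B').
  by rewrite !exprD; ring.
by apply: eqXM => //; apply: ZserM.
Qed.

Let y := r / (1 - r).

Lemma r_le20 : r <= 20%:R^-1.
Proof.
rewrite -[_^-1]mul1r ler_pdivlMr ?ltr0n //; apply: le_trans r_le.
rewrite [leLHS]mulrC ler_wpM2r ?(ltW r0) // -!natrM ler_nat.
by move: D_gt0; nia.
Qed.

Lemma r_lt1 : r < 1.
Proof. by apply: le_lt_trans r_le20 _; rewrite invf_lt1 ?ltr0n // ltr1n. Qed.

Lemma y_gt0 : 0 < y.
Proof. by rewrite divr_gt0 // subr_gt0 r_lt1. Qed.

(** There are [surj m #|A|] words of length m with letter set A, each of weight at most 1/m!. So
    (e^X - 1)^|A| dominates the polymer, and e^r - 1 <= r / (1 - r). *)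
Lemma nrm_polymer A : nrm N r (polymer A) <= y ^+ #|A|.
Proof.
have r1 := r_lt1.
pose E : {poly K} := \poly_(j < N) (if j == 0%N then 0 else j`!%:R^-1).
apply: (@le_trans _ _ (nrm N r (E ^+ #|A|))).
  apply: ler_sum => m _; rewrite ler_wpM2r ?exprn_ge0 ?(ltW r0) // coef_poly ltn_ord.
  rewrite coef_expX // -card_surj [leRHS]ger0_norm; last by rewrite divr_ge0.
  apply: le_trans (ler_norm_sum _ _ _) _.
  rewrite mulr_natl -sumr_const; apply: le_trans (_ : _ <= \sum_(s : m.-tuple T | [set y in s] == A) m`!%:R^-1) _.
    by apply: ler_sum => s _; have := tau_le s; rewrite size_tuple.
  by rewrite le_eqVlt; apply/orP; left; apply/eqP/eq_bigl => s; rewrite inE.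
apply: le_trans (nrmX N (ltW r0) _ _) _.
rewrite lerXn2r ?nnegrE ?nrm_ge0 ?(ltW r0) ?(ltW y_gt0) //.
have -> : y = r * (1 - r)^-1 by [].
apply: le_trans (ler_wpM2l (ltW r0) (geom_le N (ltW r0) r1)).
rewrite mulr_sumr; case: N @E => [|N'] E; first by rewrite /nrm !big_ord0.
rewrite /nrm big_ord_recl coef_poly /= normr0 mul0r add0r [leRHS]big_ord_recr /=.
rewrite ler_wpDr ?mulr_ge0 ?exprn_ge0 ?(ltW r0) //.
apply: ler_sum => j _; rewrite coef_poly /bump leq0n add1n ltnS ltn_ord /= -exprS.
rewrite -[leRHS]mul1r ler_wpM2r ?exprn_ge0 ?(ltW r0) // ger0_norm ?invr_ge0 //.
by rewrite invf_le1 ?ltr0n ?fact_gt0 // ler1n fact_gt0.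
Qed.

(** Sets containing x are sorted by the component g of x; what remains of such a set avoids the
    neighbourhood of g and sums to a partition function again. *)
Lemma Zser_split S x : x \in S -> eqX N (Zser S) (Zser (S :\ x)
  + \sum_(g : {set T} | (g \subset S) && conn e g x) polymer g * Zser (S :\: nbhd e g)).
Proof.
move=> xS; rewrite Zser_sum (bigID (fun A : {set T} => x \notin A)) /=.
apply: eqXD.
  rewrite Zser_sum [X in eqX N X _](eq_bigl (fun A : {set T} => A \subset S :\ x)) // => A.
  by rewrite subsetD1.
rewrite (eq_bigl (fun A : {set T} => (A \subset S) && (x \in A))); last first.
  by move=> A; rewrite negbK.
rewrite (partition_big (fun A => component e A x)
   (fun g : {set T} => (g \subset S) && conn e g x)) /=; last first.
  move=> A /andP[AS xA]; rewrite component_conn // andbT.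
  exact: subset_trans (component_sub _ xA) AS.
apply: eqX_sum => g /andP[gS cg]; have xg : x \in g by case/connP: cg.
rewrite (reindex_onto (fun A' => g :|: A') (fun A => A :\: g)) /=; last first.
  move=> A /andP[/andP[AS xA] /eqP <-].
  by rewrite setDE setUIr setUCr setIT; apply/setUidPr/component_sub.
rewrite Zser_sum mulr_sumr.
rewrite [X in eqX N X _](_ : _ = \sum_(A' : {set T} | A' \subset S :\: nbhd e g) polymer (g :|: A')).
  apply: eqX_sum => A'; rewrite subsetD => /andP[_ dA'].
  by apply: polymerM; rewrite nbhd_separated.
apply: eq_bigl => A'; rewrite subsetD -nbhd_separated subUset gS inE xg /= andbT.
apply/andP/andP => [[/andP[A'S /eqP cE] /eqP A'E]|[A'S sg]].
  split=> //; rewrite -{1}cE -[A' in separated _ _ A']A'E -{3}cE.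
  by apply: component_sep; rewrite inE xg.
rewrite A'S componentU // eqxx; split=> //.
by rewrite setDUl setDv set0U; apply/eqP/setDidPl; rewrite disjoint_sym (separated_disjoint sg).
Qed.

(* Bernoulli's inequality gives [(1 - dlt) ^ D.+1 >= 1/2]. *)
Let dlt : K := (2 * D.+1)%:R^-1.
Let th : K := (1 - dlt)^-1.

Lemma dlt_bounds : 0 < dlt /\ dlt <= 4%:R^-1.
Proof.
rewrite invr_gt0 ltr0n; split=> //; rewrite lef_pV2 ?posrE ?ltr0n // ler_nat; lia.
Qed.

Lemma dlt_lt1 : dlt < 1.
Proof.
by case: dlt_bounds => _ /le_lt_trans; apply; rewrite invf_lt1 ?ltr0n // ltr1n.
Qed.

Lemma th_ge1 : 1 <= th.
Proof.
by rewrite invf_ge1 ?subr_gt0 ?dlt_lt1 // gerBl ltW //; case: dlt_bounds.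
Qed.

Lemma thX_le2 : th ^+ D.+1 <= 2%:R.
Proof.
have h n : 1 - n%:R * dlt <= (1 - dlt) ^+ n.
  elim: n => [|n IH]; first by rewrite mul0r subr0 expr0.
  rewrite exprS; apply: le_trans (ler_wpM2l _ IH); last by rewrite subr_ge0 ltW ?dlt_lt1.
  rewrite -natr1 -subr_ge0.
  have -> : (1 - dlt) * (1 - n%:R * dlt) - (1 - (n%:R + 1) * dlt) = n%:R * dlt * dlt by ring.
  by rewrite !mulr_ge0 ?ler0n ?(ltW (proj1 dlt_bounds)).
rewrite exprVn -[2%:R]invrK lef_pV2 ?posrE ?invr_gt0 ?ltr0n ?exprn_gt0 ?subr_gt0 ?dlt_lt1 //.
apply: le_trans (h _); rewrite /dlt natrM invfM mulrCA divff ?pnatr_eq0 // mulr1.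
by rewrite le_eqVlt; apply/orP; left; apply/eqP; field.
Qed.

Lemma sum_polymer_le x :
  \sum_(g : {set T} | conn e g x) (2%:R * y) ^+ #|g| <= dlt.
Proof.
pose q : K := D.+1%:R ^+ 2 * (2%:R * y).
rewrite (partition_big (fun g : {set T} => inord #|g| : 'I_#|T|.+1) xpredT) //=.
have -> : \sum_(n < #|T|.+1)
    \sum_(g : {set T} | conn e g x && (inord #|g| == n)) (2%:R * y) ^+ #|g|
  = \sum_(n < #|T|.+1) (#|[set g : {set T} | conn e g x & #|g| == n]|)%:R * (2%:R * y) ^+ n.
  apply: eq_bigr => n _; rewrite [RHS]mulr_natl -sumr_const; apply: eq_big => g.
    rewrite inE; congr (_ && _); rewrite -val_eqE /= inordK // ltnS; exact: max_card.
  by move=> /andP[_ /eqP <-]; rewrite inordK // ltnS; apply: max_card.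
have y0 := y_gt0.
have y0' := ltW y0.
have q0 : 0 <= q by rewrite /q; apply: mulr_ge0; [rewrite exprn_ge0 // ler0n | apply: mulr_ge0].
rewrite big_ord_recl [X in X * _](_ : _ = 0) ?mul0r ?add0r; last first.
  apply/eqP; rewrite pnatr_eq0 cards_eq0; apply/eqP/setP => g; rewrite !inE.
  by apply/negbTE/negP => /andP[/connP[xg _]]; rewrite cards_eq0 => /eqP g0; rewrite g0 inE in xg.
apply: le_trans (_ : _ <= \sum_(n < #|T|) (2%:R * y) * q ^+ n) _.
  apply: ler_sum => n _; rewrite lift0.
  apply: le_trans (ler_wpM2r _ (_ : _ <= (D.+1 ^ (2 * n))%:R)) _.
  - by rewrite exprn_ge0 // mulr_ge0.
  - by rewrite ler_nat; apply: card_connected e_sym _ deg_le _ _.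
  rewrite natrX exprM [_ ^+ n.+1]exprS /q [in leRHS]exprMn.
  by rewrite le_eqVlt; apply/orP; left; apply/eqP; ring.
(* The geometric series starting at n = 1 has sum 2y / (1 - q), so the bound [dlt] amounts to 2y (D
   + 1)(D + 3) <= 1. From D + 3 <= 4 D and y <= 5/4 r one gets the constant 10 of [r_le]. *)
have key : 2%:R * y * (2 * D.+1)%:R <= 1 - q.
  rewrite lerBrDr /q -natrX [_ * (2%:R * y)]mulrC -mulrDr -natrD.
  have y_le : y <= 5%:R / 4%:R * r.
    rewrite ler_pdivrMr ?subr_gt0 ?r_lt1 //.
    rewrite -subr_ge0.
    have -> : 5%:R / 4%:R * r * (1 - r) - r = r * 5%:R / 4%:R * (5%:R^-1 - r) by field.
    rewrite mulr_ge0 ?subr_ge0 //; first by rewrite !mulr_ge0 ?(ltW r0) ?invr_ge0.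
    by apply: le_trans r_le20 _; rewrite lef_pV2 ?posrE ?ltr0n // ler_nat.
  apply: le_trans r_le.
  apply: le_trans (_ : _ <= 2%:R * (5%:R / 4%:R * r) * (4 * D * D.+1)%:R) _.
    apply: ler_pM; [exact: mulr_ge0 | exact: ler0n | exact: ler_wpM2l |].
    by rewrite ler_nat; move: D_gt0; nia.
  by rewrite !natrM le_eqVlt; apply/orP; left; apply/eqP; field.
have q1 : q < 1.
  by rewrite -subr_gt0; apply: lt_le_trans key; rewrite pmulr_rgt0 ?ltr0n // pmulr_rgt0 ?ltr0n.
rewrite -mulr_sumr; apply: le_trans (ler_wpM2l _ (geom_le _ q0 q1)) _.
  exact: mulr_ge0.
by rewrite ler_pdivrMr ?subr_gt0 // /dlt [leRHS]mulrC ler_pdivlMr ?ltr0n.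
Qed.

(** Dividing a term of [Zser_split] by [Zser (S :\ x)] means deleting at most (D + 1)|g| further
    elements, at the cost of a factor [th ^+ D.+1 <= 2] per element of g. The sum of (2y)^|g| is at
    most [dlt], so the induction reproduces its own bound. *)
Lemma Zser_ratio S x : x \in S -> exists u : {poly K},
  [/\ u`_0 = 0, nrm N r u <= dlt & eqX N (Zser S) ((1 + u) * Zser (S :\ x))].
Proof.
have [n] := ubnP #|S|; elim: n S x => // n IH S x Sn xS.
(* Elements of A are deleted one at a time. The induction hypothesis applies to these smaller sets,
   and each deletion multiplies by an inverse of some [1 + u], of norm at most [th]. *)
have rem A S' : S' \subset S :\ x -> exists2 Q : {poly K},
    eqX N (Zser (S' :\: A)) (Q * Zser S') & nrm N r Q <= th ^+ #|A|.
  have [m] := ubnP #|A|; elim: m A => // m IHm A Am S'S.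
  have [->|[a aA]] := set_0Vmem A.
    exists 1; last by rewrite cards0 expr0 nrm1.
    by rewrite setD0 mul1r.
  have [|Q QE Qn] := IHm (A :\ a) _ S'S; first by move: Am; rewrite (cardsD1 a A) aA; lia.
  have cA : #|A| = #|A :\ a|.+1 by rewrite (cardsD1 a A) aA.
  have [aS|aS] := boolP (a \in S' :\: (A :\ a)); last first.
    exists Q; last by apply: le_trans Qn _; rewrite cA exprS ler_peMl ?exprn_ge0 ?th_ge1 // (le_trans ler01) ?th_ge1.
    rewrite (_ : S' :\: A = S' :\: (A :\ a)) //.
    apply/setP => z; move: aS; rewrite !inE eqxx /=.
    by case: (z =P a) => [-> /negbTE ->|_ _] //=; rewrite ?andbF.
  have [|u [u0 un uE]] := IH (S' :\: (A :\ a)) a _ aS.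
    apply: leq_ltn_trans (subset_leq_card (subset_trans (subsetDl _ _) S'S)) _.
    by move: Sn; rewrite (cardsD1 x S) xS; lia.
  have [q qE qn] := inv1D (ltW r0) u0 un dlt_lt1.
  exists (q * Q); last first.
    apply: le_trans (nrmM N (ltW r0) _ _) _; rewrite cA exprS.
    by apply: ler_pM => //; apply: nrm_ge0 (ltW r0) _.
  have -> : S' :\: A = (S' :\: (A :\ a)) :\ a.
    apply/setP => z; rewrite !inE; case: (z =P a) => [->|_] //=; by rewrite aA.
  apply: eqX_trans (_ : eqX N (q * (1 + u) * Zser ((S' :\: (A :\ a)) :\ a)) _).
    by rewrite -[X in eqX _ X _]mul1r; apply: eqXM => //; apply: eqX_sym.
  rewrite -!mulrA; apply: eqXM => //; apply: eqX_trans QE; exact: eqX_sym.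
have [W [WE Wn W0]] : exists W : {poly K}, [/\
    eqX N (\sum_(g : {set T} | (g \subset S) && conn e g x)
             polymer g * Zser (S :\: nbhd e g)) (W * Zser (S :\ x)),
    nrm N r W <= \sum_(g : {set T} | (g \subset S) && conn e g x) (2%:R * y) ^+ #|g|
    & W`_0 = 0].
  elim/big_rec2: _ => [|g b p /andP[gS cg] [W [WE Wn W0]]].
    by exists 0; rewrite mul0r nrm0 coef0.
  have xg : x \in g by case/connP: cg.
  have [|Q QE Qn] := rem (nbhd e g :\ x) (S :\ x); first exact: subxx.
  exists (polymer g * Q + W); split.
  - rewrite mulrDl; apply: eqXD => //; rewrite -mulrA; apply: eqXM => //.
    rewrite (_ : S :\: nbhd e g = (S :\ x) :\: (nbhd e g :\ x)) //.
    apply/setP => z; rewrite !inE negb_and; case: (z =P x) => [->|] //=.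
    by apply/negbTE; rewrite negb_and negbK; apply/orP; left; apply/exists_inP; exists x; rewrite ?eqxx.
  - apply: le_trans (nrmD N (ltW r0) _ _) _; apply: lerD => //.
    apply: le_trans (nrmM N (ltW r0) _ _) _.
    rewrite exprMn mulrC; apply: ler_pM; rewrite ?nrm_ge0 ?(ltW r0) ?nrm_polymer //.
    apply: le_trans Qn _; apply: (@le_trans _ _ (th ^+ (D.+1 * #|g|))).
      apply: ler_weXn2l; first exact: th_ge1.
      apply: leq_trans (card_nbhd deg_le g); apply: subset_leq_card; exact: subD1set.
    rewrite exprM lerXn2r ?nnegrE ?exprn_ge0 ?(le_trans ler01 th_ge1) //.
    exact: thX_le2.
  (* The empty word cannot have the letter x, so these polymers have no constant term. *)
  - rewrite coefD W0 addr0 coefM big_ord1 coef_poly; case: ifP => _; last by rewrite mul0r.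
    rewrite big1 ?mul0r // => s; rewrite tuple0 => /eqP g0.
    by move: xg; rewrite -g0 inE.
exists W; split=> //.
  apply: le_trans Wn _; apply: le_trans (sum_polymer_le x).
  rewrite [leRHS](bigID (fun g : {set T} => g \subset S)) /=.
  rewrite (eq_bigl (fun g : {set T} => conn e g x && (g \subset S))); last first.
    by move=> g; rewrite andbC.
  rewrite lerDl; apply: sumr_ge0 => g _; rewrite exprn_ge0 // mulr_ge0 //.
  exact: ltW y_gt0.
rewrite mulrDl mul1r; apply: eqX_trans (Zser_split xS) _.
by apply: eqXD.
Qed.

(** The partition function is the product of the ratios met while emptying S, and each has a
    logarithm of norm at most dlt / (1 - dlt) <= 1. *)
Lemma Zser_log S : exists2 a : {poly K}, islog N a (Zser S) & nrm N r a <= #|S|%:R.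
Proof.
have [n] := ubnP #|S|; elim: n S => // n IH S Sn.
have [->|[x xS]] := set_0Vmem S.
  exists 0; last by rewrite nrm0 cards0.
  split; first by rewrite coef0.
  move=> i iN; rewrite coef_eul coef_poly iN /eul deriv0 mulr0 mul0r coef0.
  case: i iN => // i iN; rewrite f_tau big1 ?mul0rn // => s.
  by case: s => -[|z s] //= h; rewrite inE.
have cS : #|S| = #|S :\ x|.+1 by rewrite (cardsD1 x S) xS.
have [|a al an] := IH (S :\ x); first by move: Sn; rewrite cS; lia.
have [u [u0 un uE]] := Zser_ratio xS.
exists (log1D N u + a).
  by apply: islog_eqX (eqX_sym uE) _; apply: islogM => //; apply: islog_log1D.
rewrite cS -natr1 addrC; apply: le_trans (nrmD N (ltW r0) _ _) _.
apply: lerD => //; apply: le_trans (nrm_log1D (ltW r0) un dlt_lt1) _.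
rewrite ler_pdivrMr ?subr_gt0 ?dlt_lt1 // mul1r.
have [_ h4] := dlt_bounds.
rewrite lerBrDr; apply: le_trans (lerD h4 h4) _.
have -> : 4%:R^-1 + 4%:R^-1 = 2%:R^-1 :> K by field.
by rewrite invf_le1 ?ltr0n // ler1n.
Qed.

End Truncated.
End Cluster.

(** * Coefficients of the logarithm *)

Section LogCoefficients.
Variable K : numFieldType.
Implicit Types (f g : nat -> K).

(** Comparing coefficients in f' = a' f with [f 0 = 1] gives n a_n = n f_n - sum_(j < n) j a_j
    f_(n-j). Keeping the list of all earlier values makes this course-of-values recursion
    structural. *)
Fixpoint logs f n : seq K :=
  if n is n'.+1 then
    rcons (logs f n')
      (if n' == 0%N then 0 else
         f n' - (\sum_(0 <= j < n') j%:R * (logs f n')`_j * f (n' - j)%N) / n'%:R)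
  else [::].

Definition logc f n := (logs f n.+1)`_n.

Lemma size_logs f n : size (logs f n) = n.
Proof. by elim: n => //= n IH; rewrite size_rcons IH. Qed.

Lemma nth_logs f n m : (m < n)%N -> (logs f n)`_m = logc f m.
Proof.
elim: n => // n IH; rewrite ltnS leq_eqVlt => /orP[/eqP -> //|mn].
by rewrite /= nth_rcons size_logs mn IH.
Qed.

Lemma logcE f n : logc f n = if n == 0%N then 0 else
  f n - (\sum_(0 <= j < n) j%:R * logc f j * f (n - j)%N) / n%:R.
Proof.
rewrite /logc /= nth_rcons size_logs ltnn eqxx; case: ifP => // _.
congr (_ - _ / _); apply: eq_big_nat => j /andP[_ jn].
by rewrite nth_logs.
Qed.

Lemma eq_logc f g : f =1 g -> logc f =1 logc g.
Proof.
move=> fg n; elim/ltn_ind: n => n IH; rewrite !logcE fg; case: ifP => // _.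
congr (_ - _ / _); apply: eq_big_nat => j /andP[_ jn].
by rewrite IH // fg.
Qed.

Lemma islog_logc N f : f 0%N = 1 ->
  islog N (\poly_(m < N) logc f m) (\poly_(m < N) f m).
Proof.
move=> f0; split.
  by rewrite coef_poly; case: ifP => // _; rewrite logcE.
move=> m mN; rewrite coef_eul coef_poly mN coefM big_ord_recr /= subnn.
rewrite !coef_eul !coef_poly mN (leq_trans _ mN) // f0 mulr1.
have [->|m0] := posnP m; first by rewrite big_ord0 !mulr0n addr0.
rewrite [logc f m in RHS]logcE eqn0Ngt m0 /= mulrnBl.
rewrite -[(_ / _) *+ m]mulr_natr divfK ?pnatr_eq0 -?lt0n //.
rewrite addrC [X in _ = _ + X](_ : _ = \sum_(0 <= j < m) j%:R * logc f j * f (m - j)%N).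
  by rewrite subrK.
rewrite big_mkord; apply: eq_bigr => j _.
rewrite coef_eul !coef_poly (ltn_trans _ mN) ?ltn_ord // ifT; last by lia.
by rewrite mulr_natl.
Qed.

End LogCoefficients.

(** * Set functions of bounded degree *)

Section SetDegree.
Variables (T : finType) (V : comNzRingType).
Implicit Types (h : {set T} -> V).

Definition deg_le_fun m h := forall A : {set T}, (m < #|A|)%N -> mob h A = 0.

Lemma eq_deg_le_fun m h1 h2 : h1 =1 h2 -> deg_le_fun m h1 -> deg_le_fun m h2.
Proof.
move=> h12 d1 A mA; rewrite -(d1 A mA); apply: eq_bigr => B _; by rewrite h12.
Qed.

Lemma deg_le_funD m h1 h2 : deg_le_fun m h1 -> deg_le_fun m h2 ->
  deg_le_fun m (fun A => h1 A + h2 A).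
Proof.
move=> d1 d2 A mA; rewrite /mob.
under eq_bigr do rewrite mulrDr.
by rewrite big_split /= -[X in X + _]/(mob h1 A) -[X in _ + X]/(mob h2 A) d1 ?d2 ?addr0.
Qed.

Lemma deg_le_funZ m c h : deg_le_fun m h -> deg_le_fun m (fun A => c * h A).
Proof.
move=> d1 A mA; rewrite /mob.
under eq_bigr do rewrite mulrCA.
by rewrite -mulr_sumr -[X in _ * X]/(mob h A) d1 ?mulr0.
Qed.

Lemma deg_le_fun0 m : deg_le_fun m (fun _ => 0).
Proof. by move=> A mA; rewrite /mob big1 // => B _; rewrite mulr0. Qed.

Lemma deg_le_fun_sum m (I : Type) (s : seq I) (F : I -> {set T} -> V) :
  (forall i, deg_le_fun m (F i)) -> deg_le_fun m (fun A => \sum_(i <- s) F i A).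
Proof.
move=> dF; elim: s => [|i s IH].
  by apply: eq_deg_le_fun (@deg_le_fun0 m) => A; rewrite big_nil.
by apply: eq_deg_le_fun (deg_le_funD (dF i) IH) => A; rewrite big_cons.
Qed.

(** The Moebius inverse of a product collects the pairs with a given union; a union of more than m +
    n elements makes one of the two sets too large. *)
Lemma deg_le_funM m n h1 h2 : deg_le_fun m h1 -> deg_le_fun n h2 ->
  deg_le_fun (m + n) (fun A => h1 A * h2 A).
Proof.
move=> d1 d2.
pose G C := \sum_(p : {set T} * {set T} | p.1 :|: p.2 == C) mob h1 p.1 * mob h2 p.2.
have hG A : h1 A * h2 A = \sum_(C : {set T} | C \subset A) G C.
  rewrite (mob_sum h1) (mob_sum h2) big_distrlr /= pair_big /=.
  rewrite (partition_big (fun p : {set T} * {set T} => p.1 :|: p.2) (fun C => C \subset A)) /=.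
    apply: eq_bigr => C CA; apply: eq_bigl => p; rewrite andb_idl // => /eqP pC.
    by rewrite -!subUset pC.
  by move=> p; rewrite subUset.
move=> A mnA; rewrite (mob_uniq hG) /G big1 // => p /eqP pA.
have := leq_card_setU p.1 p.2; rewrite pA => /(leq_trans mnA) le.
have [mp|mp] := ltnP m #|p.1|; first by rewrite d1 ?mul0r.
by rewrite [mob h2 _]d2 ?mulr0 // -(ltn_add2l m) (leq_trans le) // leq_add2r.
Qed.

End SetDegree.

(** * Moebius inverses of the logarithmic coefficients *)

Section ClusterLog.
Variables (K : numFieldType) (T : finType) (e : rel T) (D : nat).
Hypothesis e_sym : symmetric e.
Hypothesis deg_le : forall x, (#|[set y | e x y]| <= D)%N.
Hypothesis D_gt0 : (0 < D)%N.
Variables (f : {set T} -> nat -> K) (tau : seq T -> K).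
Hypothesis f_tau : forall B m,
  f B m = \sum_(s : m.-tuple T | all (fun x => x \in B) s) tau s.
Hypothesis tau_le : forall s, `|tau s| <= (size s)`!%:R^-1.
Hypothesis f0 : forall B, f B 0 = 1.
Hypothesis fM : forall B C m, separated e B C ->
  f (B :|: C) m = \sum_(j < m.+1) f B j * f C (m - j).
Implicit Types (A B C g : {set T}).

Lemma logc_norm_le (r : K) S N : 0 < r -> 10%:R * D%:R * D.+1%:R * r <= 1 ->
  \sum_(m < N) `|logc (f S) m| * r ^+ m <= #|S|%:R.
Proof.
case: N => [|N] r0 r_le; first by rewrite big_ord0.
have [a al an] := Zser_log e_sym deg_le D_gt0 f_tau tau_le fM N.+1 r0 r_le S.
apply: le_trans an; rewrite le_eqVlt; apply/orP; left; apply/eqP.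
have Z0 : (Zser f N.+1 S)`_0 = 1 by rewrite coef_poly f0.
rewrite (nrm_eqX _ (islog_uniq Z0 al (islog_logc N.+1 (f0 S)))).
by apply: eq_bigr => m _; rewrite coef_poly ltn_ord.
Qed.

Lemma logc_separated B C m : separated e B C ->
  logc (f (B :|: C)) m = logc (f B) m + logc (f C) m.
Proof.
move=> sBC.
have Z0 : (Zser f m.+1 (B :|: C))`_0 = 1 by rewrite coef_poly f0.
have := islog_eqX (eqX_sym (@ZserM _ _ _ _ fM m.+1 _ _ sBC))
  (islogM (islog_logc m.+1 (f0 B)) (islog_logc m.+1 (f0 C))).
move/(islog_uniq Z0 (islog_logc m.+1 (f0 (B :|: C))))/(_ m (leqnn _)).
by rewrite coefD !coef_poly ltnSn.
Qed.

Lemma logc_set0 m : logc (f set0) m = 0.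
Proof.
elim/ltn_ind: m => m IH; rewrite logcE; case: eqVneq => // m0.
rewrite f_tau big1; last first.
  by move=> s; case: s => -[|x s] sz /= h; [rewrite -(eqP sz) in m0 | rewrite inE in h].
rewrite sub0r big_nat big1 ?mul0r ?oppr0 // => j /andP[_ jm].
by rewrite IH // mulr0 mul0r.
Qed.

(** A word of length m has at most m letters, so [f B m] has degree m in B, and the recursion for
    the logarithm adds the degrees j and m - j. *)
Lemma deg_logc m : deg_le_fun m (fun B => logc (f B) m).
Proof.
have df j : deg_le_fun j (fun B => f B j).
  move=> A jA.
  rewrite (@mob_uniq _ _ _ (fun C => (polymer tau j.+1 C)`_j)); last first.
    by move=> B; rewrite -coef_sum -(Zser_sum f_tau) coef_poly ltnSn.
  rewrite coef_poly ltnSn big1 // => s /eqP sA.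
  by move: jA; rewrite -sA cardsE ltnNge (leq_trans (card_size s)) // size_tuple.
elim/ltn_ind: m => m IH.
case: (posnP m) => [->|m0].
  by move=> A mA; rewrite /mob big1 // => B _; rewrite logcE mulr0.
apply: (@eq_deg_le_fun _ _ _ (fun B => f B m +
    (- m%:R^-1) * \sum_(j <- index_enum 'I_m) j%:R * (logc (f B) j * f B (m - j)%N))).
  move=> B; rewrite [RHS]logcE eqn0Ngt m0 /= big_mkord mulNr mulrC.
  by congr (_ - _ / _); apply: eq_bigr => j _; rewrite mulrA.
apply: deg_le_funD => //; apply: deg_le_funZ; apply: deg_le_fun_sum => j.
apply: deg_le_funZ; rewrite -{1}(subnKC (ltnW (ltn_ord j))).
by apply: deg_le_funM => //; apply: IH.
Qed.

Lemma mob_logc_eq0 m g x : x \in g -> ~~ conn e g x -> mob (fun B => logc (f B) m) g = 0.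
Proof.
move=> xg ncg; have cg := component_sub e xg; have xc := component_id e g x.
rewrite -(setID g (component e g x)) (setIidPr cg).
have sc := component_sep e g x.
apply: mob_eq0 (separated_disjoint sc) _ _ _.
- by apply/set0Pn; exists x.
- rewrite setD_eq0; apply: contra ncg => gc.
  by rewrite -component_eq // eqEsubset cg.
- by move=> B B' BA BA'; rewrite logc_separated //; apply: separatedS sc.
Qed.

(** The family may contain further sets: by full Moebius summation, only connected sets of at most m
    elements contribute anyway. *)
Lemma logc_sum_family (Fam : {set {set T}}) m :
  (forall g x, conn e g x -> (#|g| <= m)%N -> g \in Fam) ->
  logc (f [set: T]) m = \sum_(g in Fam) mob (fun B => logc (f B) m) g.
Proof.
move=> hF; rewrite (mob_sum (fun B => logc (f B) m)).
rewrite (eq_bigl xpredT) => [|g]; last by rewrite subsetT.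
rewrite (bigID (mem Fam)) /= [X in _ + X]big1 ?addr0 // => g gF.
have [->|[x xg]] := set_0Vmem g.
  by rewrite /mob big1 // => B; rewrite subset0 => /eqP ->; rewrite logc_set0 mulr0.
have [cg|ncg] := boolP (conn e g x); last exact: mob_logc_eq0 ncg.
by apply: deg_logc; rewrite ltnNge; apply: contra gF => /(hF _ _ cg).
Qed.

End ClusterLog.

(** * Contractions *)

Local Open Scope complex_scope.
Local Open Scope sesquilinear_scope.
Local Open Scope ring_scope.

Section Gram.
Variable C : numClosedFieldType.

Lemma psd_gram n (A : 'M[C]_n) : A ^t* = A ->
  (forall v : 'cV[C]_n, 0 <= (v ^t* *m A *m v) 0 0) ->
  exists B : 'M[C]_n, A = B ^t* *m B.
Proof.
move=> Ah Apos.
have An : A \is normalmx by apply/normalmxP; rewrite Ah.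
have /orthomx_spectralP := An; set P := spectralmx A; set sp := spectral_diag A => AE.
have Pu : P \is unitarymx by apply: spectral_unitarymx.
have PP : P *m P ^t* = 1%:M by apply/unitarymxP.
have Ai : invmx P = P ^t* by apply: invmx_unitary.
have sp0 i : 0 <= sp 0 i.
  (* The eigenvector for the i-th eigenvalue shows that this eigenvalue is nonnegative. *)
  have := Apos (P ^t* *m delta_mx i 0).
  rewrite trmx_mul map_mxM /= trmxCK AE Ai !mulmxA -[_ *m P *m P ^t*]mulmxA PP mulmx1.
  rewrite -!mulmxA [P *m (P ^t* *m _)]mulmxA PP mul1mx trmx_delta.
  have -> : map_mx Num.Def.conjC (delta_mx 0 i : 'rV[C]_n) = delta_mx 0 i.
    by apply/matrixP => a b; rewrite !mxE rmorph_nat.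
  rewrite mulmxA -rowE -colE !mxE eqxx mulr1n; exact.
exists (diag_mx (map_mx sqrtC sp) *m P).
rewrite trmx_mul map_mxM /= tr_diag_mx map_diag_mx -!mulmxA.
rewrite [diag_mx _ *m (diag_mx _ *m P)]mulmxA mulmx_diag AE Ai -mulmxA.
congr (_ *m (diag_mx _ *m _)); apply/rowP => i; rewrite !mxE.
have h : 0 <= sqrtC (sp 0 i) by rewrite sqrtC_ge0.
have hc : Num.Def.conjC (sqrtC (sp 0 i)) = sqrtC (sp 0 i) by apply/CrealP/ger0_real.
by rewrite -[LHS]sqrtCK expr2; congr (_ * _); apply: esym hc.
Qed.

Definition sqn n (v : 'cV[C]_n) : C := \sum_a `|v a 0| ^+ 2.

Lemma sqnE n (v : 'cV[C]_n) : sqn v = (v ^t* *m v) 0 0.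
Proof. by rewrite mxE; apply: eq_bigr => a _; rewrite !mxE mulrC -normCK. Qed.

(** Contractivity is stated with squared norms, so that products of terms are handled without
    suprema or square roots. *)
Definition contr n (A : 'M[C]_n) := forall v : 'cV[C]_n, sqn (A *m v) <= sqn v.

Lemma contr1 n : contr (1%:M : 'M[C]_n).
Proof. by move=> v; rewrite mul1mx. Qed.

Lemma contrM n (A B : 'M[C]_n) : contr A -> contr B -> contr (A *m B).
Proof. by move=> cA cB v; rewrite -mulmxA; apply: le_trans (cA _) (cB _). Qed.

Lemma contrZ n (c : C) (A : 'M[C]_n) : `|c| <= 1 -> contr A -> contr (c *: A).
Proof.
move=> c1 cA v; apply: le_trans (cA v).
apply: ler_sum => a _; rewrite -scalemxAl mxE normrM exprMn.
by rewrite -[leRHS]mul1r ler_wpM2r ?exprn_ge0 // expr_le1.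
Qed.

(** The inequality 2xy <= x^2 + y^2 in each coordinate takes the place of Cauchy-Schwarz. *)
Lemma contr_form n (A : 'M[C]_n) (v : 'cV[C]_n) : contr A ->
  `|(v ^t* *m (A *m v)) 0 0| <= sqn v.
Proof.
move=> cA; rewrite mxE; apply: le_trans (ler_norm_sum _ _ _) _.
apply: le_trans (_ : _ <= \sum_a (`|v a 0| ^+ 2 + `|(A *m v) a 0| ^+ 2) / 2%:R) _.
  apply: ler_sum => a _; rewrite ler_pdivlMr ?ltr0n // normrM !mxE norm_conjC.
  set x := `|v a 0|; set y := `|_|; rewrite -subr_ge0.
  have -> : x ^+ 2 + y ^+ 2 - x * y * 2%:R = (x - y) ^+ 2 by ring.
  by apply: real_exprn_even_ge0 => //; rewrite realB ?normr_real.
rewrite -mulr_suml big_split /= -/(sqn v) -/(sqn (A *m v)) ler_pdivrMr ?ltr0n //.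
by rewrite mulr_natr mulr2n lerD.
Qed.

(** The trace is a sum of quadratic forms of A, one for each row of B. *)
Lemma contr_gram n (A B : 'M[C]_n) : contr A ->
  `|\tr (A *m (B ^t* *m B))| <= \tr (B ^t* *m B).
Proof.
move=> cA.
have trE (M : 'M[C]_n) : \tr (M *m (B ^t* *m B)) =
    \sum_k ((row k B) ^t* ^t* *m (M *m (row k B) ^t*)) 0 0.
  rewrite mulmxA mxtrace_mulC mulmxA /mxtrace; apply: eq_bigr => k _.
  rewrite trmxCK -mulmxA mxE [RHS]mxE; apply: eq_bigr => a _.
  rewrite [row k B 0 a]mxE; congr (_ * _).
  by rewrite [LHS]mxE [RHS]mxE; apply: eq_bigr => b _; rewrite !mxE.
rewrite -[X in _ <= \tr X]mul1mx !trE.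
apply: le_trans (ler_norm_sum _ _ _) _; apply: ler_sum => k _.
by rewrite mul1mx -sqnE contr_form.
Qed.

End Gram.

(** * Local operators and product states *)

Section LocalOperators.
Variables (R : realType) (V : finType) (d : nat) (i0 : 'I_d).
Local Notation config := (config V d).
Local Notation op := (op R V d).
Implicit Types (W : {set V}) (s z x y : config) (A B : op).

Definition glue W x z : config := [ffun v => if v \in W then x v else z v].

Definition blank : config := [ffun _ => i0].

(** A configuration of the sites in W is represented by the full configuration that has the value
    [i0] elsewhere; this avoids functions on subtypes when W varies. *)
Definition restr W s := glue W s blank.

Definition cfg W : {set config} := [set s | restr W s == s].

Lemma agreeP W s z : reflect (forall v, v \in W -> s v = z v) (agree_on W s z).
Proof. exact: 'forall_in_eqP. Qed.

Lemma agreeCP W s z : reflect (forall v, v \notin W -> s v = z v) (agree_on (~: W) s z).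
Proof.
by apply: (iffP (agreeP _ _ _)) => h v; have := h v; rewrite inE.
Qed.

Lemma glueE W x z v : glue W x z v = if v \in W then x v else z v.
Proof. by rewrite ffunE. Qed.

Lemma restrE W s v : restr W s v = if v \in W then s v else i0.
Proof. by rewrite glueE ffunE. Qed.

Let cfE := (restrE, glueE).

Lemma restr_glue W x z : restr W (glue W x z) = restr W x.
Proof. by apply/ffunP => v; rewrite !cfE; case: (v \in W). Qed.

Lemma restr_cfg W s : restr W s \in cfg W.
Proof. by rewrite inE; apply/eqP/ffunP => v; rewrite !cfE; case: (v \in W). Qed.

Lemma cfgE W x : x \in cfg W -> restr W x = x.
Proof. by rewrite inE => /eqP. Qed.

Lemma sum_agree (M : nmodType) W s (F : config -> M) :
  \sum_(z | agree_on (~: W) s z) F (restr W z) = \sum_(x in cfg W) F x.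
Proof.
rewrite (reindex_onto (fun x => glue W x s) (restr W)) /=; last first.
  move=> z /agreeCP h; apply/ffunP => v; rewrite !cfE.
  by case: (boolP (v \in W)) => // /h.
apply: eq_big => [x|x /andP[_ /eqP ->]] //.
rewrite restr_glue inE andb_idl // => _.
by apply/agreeCP => v vW; rewrite cfE (negPf vW).
Qed.

Lemma sum_glue (M : nmodType) W (F : config -> M) :
  \sum_s F s = \sum_(x in cfg W) \sum_(u in cfg (~: W)) F (glue W x u).
Proof.
rewrite pair_big /=.
rewrite (reindex_onto (fun p : config * config => glue W p.1 p.2)
                      (fun s => (restr W s, restr (~: W) s))) /=; last first.
  by move=> s _; apply/ffunP => v; rewrite !cfE inE; case: (v \in W).
apply: eq_bigl => -[x u] /=; rewrite !inE restr_glue.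
have -> : restr (~: W) (glue W x u) = restr (~: W) u.
  by apply/ffunP => v; rewrite !cfE inE; case: (v \in W).
by [].
Qed.

(** [acts_within] without its existential: the matrix on W is read off from A at the
    representatives. *)
Definition loc W A := forall s z,
  entry A s z = if agree_on (~: W) s z then entry A (restr W s) (restr W z) else 0.

Lemma loc_acts W A : acts_within W A -> loc W A.
Proof.
move=> [F FE] s z; rewrite FE; case: ifP => // h.
rewrite FE ifT; last by apply/agreeCP => v vW; rewrite !cfE (negPf vW).
by congr F; apply/ffunP => -[v vW]; rewrite !ffunE /= vW.
Qed.

Lemma loc_mono W W' A : W \subset W' -> loc W A -> loc W' A.
Proof.
move=> /subsetP WW lA s z; rewrite lA [in RHS]lA.
have rr x : restr W (restr W' x) = restr W x.
  by apply/ffunP => v; rewrite !cfE; case: ifP => // /WW ->.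
rewrite !rr; case: (boolP (agree_on (~: W') s z)) => h'.
  congr (if _ then _ else _); apply/agreeCP/agreeCP => h v vW; rewrite ?ffunE.
    by case: ifP => // _; apply: h.
  by have := h v vW; rewrite !cfE; case: (boolP (v \in W')) => // vW' _; move/agreeCP: h'; apply.
case: ifP => // /agreeCP h; case/negP: h'; apply/agreeCP => v vW.
by apply: h; apply: contra vW; apply: WW.
Qed.

Lemma entryD A B s z : entry (A + B) s z = entry A s z + entry B s z.
Proof. by rewrite /entry mxE. Qed.

Lemma entryZ c A s z : entry (c *: A) s z = c * entry A s z.
Proof. by rewrite /entry mxE. Qed.

Lemma entry1 s z : entry (1%:M : op) s z = (s == z)%:R.
Proof. by rewrite /entry mxE (inj_eq enum_rank_inj). Qed.

Lemma entryM A B s z : entry (A *m B) s z = \sum_u entry A s u * entry B u z.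
Proof.
rewrite /entry mxE (reindex (fun u : config => enum_rank u)) //=.
by exists enum_val => i _; rewrite ?enum_rankK ?enum_valK.
Qed.

Lemma loc0 W : loc W 0.
Proof. by move=> s z; rewrite /entry !mxE; case: ifP. Qed.

Lemma locD W A B : loc W A -> loc W B -> loc W (A + B).
Proof. by move=> lA lB s z; rewrite !entryD lA lB; case: ifP; rewrite ?addr0. Qed.

Lemma locZ W c A : loc W A -> loc W (c *: A).
Proof. by move=> lA s z; rewrite !entryZ lA; case: ifP; rewrite ?mulr0. Qed.

Lemma loc_sum W (I : Type) (r : seq I) (P : pred I) (F : I -> op) :
  (forall i, P i -> loc W (F i)) -> loc W (\sum_(i <- r | P i) F i).
Proof.
by move=> h; elim/big_ind: _; [apply: loc0 | apply: locD | apply: h].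
Qed.

Lemma loc1 W : loc W 1%:M.
Proof.
move=> s z; rewrite !entry1; case: (boolP (agree_on _ _ _)) => [/agreeCP h|h].
  rewrite (_ : (s == z) = (restr W s == restr W z)) //.
  apply/idP/idP => [/eqP -> //|/eqP/ffunP hr]; apply/eqP/ffunP => v.
  by have := hr v; rewrite !cfE; case: (boolP (v \in W)) => // /h.
by case: eqP => // sz; case/negP: h; apply/agreeCP => v _; rewrite sz.
Qed.

Lemma locM_entry W A B s z : loc W A -> loc W B -> agree_on (~: W) s z ->
  entry (A *m B) s z =
    \sum_(x in cfg W) entry A (restr W s) x * entry B x (restr W z).
Proof.
move=> lA lB sz; rewrite entryM (bigID (agree_on (~: W) s)) /= [X in _ + X]big1 ?addr0; last first.
  by move=> u su; rewrite lA (negPf su) mul0r.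
rewrite -(sum_agree W s (fun x => entry A (restr W s) x * entry B x (restr W z))).
apply: eq_bigr => u su; rewrite lA su lB ifT //.
by apply/agreeCP => v vW; move/agreeCP: su => <- //; move/agreeCP: sz; apply.
Qed.

Lemma restr_id W s : restr W (restr W s) = restr W s.
Proof. by apply/eqP; have := restr_cfg W s; rewrite inE. Qed.

Lemma agreeC_restr W s z : agree_on (~: W) (restr W s) (restr W z).
Proof. by apply/agreeCP => v vW; rewrite !cfE (negPf vW). Qed.

Lemma locM W A B : loc W A -> loc W B -> loc W (A *m B).
Proof.
move=> lA lB s z; case: ifPn => sz.
  by rewrite !(locM_entry lA lB) ?agreeC_restr // !restr_id.
rewrite entryM big1 // => u _; rewrite lA lB.
case: ifP => su; last by rewrite mul0r.
case: ifP => uz; last by rewrite mulr0.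
case/negP: sz; apply/agreeCP => v vW; move/agreeCP: su => -> //.
by move/agreeCP: uz; apply.
Qed.

Lemma locX W A m : loc W A -> loc W (A ^+ m).
Proof.
move=> lA; elim: m => [|m IH]; first exact: loc1.
by rewrite exprS; apply: locM.
Qed.

(** A single intermediate configuration contributes, the one that equals z on W and s elsewhere. *)
Lemma entryM_disj W A B s z : loc W A -> loc (~: W) B ->
  entry (A *m B) s z = entry A (restr W s) (restr W z) *
                       entry B (restr (~: W) s) (restr (~: W) z).
Proof.
move=> lA lB; rewrite entryM (bigD1 (glue W z s)) //= big1 ?addr0.
  rewrite lA lB setCK restr_glue.
  rewrite ifT; last by apply/agreeCP => v vW; rewrite cfE (negPf vW).
  rewrite ifT; last by apply/agreeP => v vW; rewrite cfE vW.
  congr (_ * entry B _ _).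
  by apply/ffunP => v; rewrite !cfE inE; case: (v \in W).
move=> u uz; rewrite lA lB setCK.
case: ifP => su; last by rewrite mul0r.
case: ifP => hu; last by rewrite mulr0.
case/eqP: uz; apply/ffunP => v; rewrite cfE; case: ifPn => vW.
  by move/agreeP: hu; apply.
by move/agreeCP: su => ->.
Qed.

Lemma loc_comm W A B : loc W A -> loc (~: W) B -> A *m B = B *m A.
Proof.
move=> lA lB; apply/matrixP => a b.
have := entryM_disj (enum_val a) (enum_val b) lA lB.
have lA' : loc (~: ~: W) A by rewrite setCK.
have := entryM_disj (enum_val a) (enum_val b) lB lA'.
rewrite /entry !enum_valK setCK => -> ->; exact: mulrC.
Qed.

(** * Expectations in a product state *)

Section ProductState.
Variable rho : V -> 'M[R[i]]_d.

Definition expect A := \tr (A *m product_state rho).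

Lemma expectE A : expect A =
  \sum_s \sum_z entry A s z * \prod_v rho v (z v) (s v).
Proof.
rewrite /expect /mxtrace (reindex (fun u : config => enum_rank u)) /=; last first.
  by exists enum_val => i _; rewrite ?enum_rankK ?enum_valK.
apply: eq_bigr => s _; rewrite mxE (reindex (fun u : config => enum_rank u)) /=; last first.
  by exists enum_val => i _; rewrite ?enum_rankK ?enum_valK.
by apply: eq_bigr => z _; rewrite mxE !enum_rankK.
Qed.

Lemma expectD A B : expect (A + B) = expect A + expect B.
Proof. by rewrite /expect mulmxDl mxtraceD. Qed.

Lemma expectZ c A : expect (c *: A) = c * expect A.
Proof. by rewrite /expect -scalemxAl mxtraceZ. Qed.

Lemma expectMn A n : expect (A *+ n) = n%:R * expect A.
Proof.
elim: n => [|n IH]; first by rewrite mulr0n mul0r /expect mul0mx mxtrace0.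
by rewrite mulrS expectD IH -nat1r mulrDl mul1r.
Qed.

Lemma expect_sum (I : Type) (r : seq I) (P : pred I) (F : I -> op) :
  expect (\sum_(i <- r | P i) F i) = \sum_(i <- r | P i) expect (F i).
Proof. by rewrite /expect mulmx_suml raddf_sum. Qed.

Hypothesis rho_tr : forall v, \tr (rho v) = 1.

Lemma sum_diag W : \sum_(u in cfg W) \prod_(v in W) rho v (u v) (u v) = 1.
Proof.
transitivity (\prod_v \sum_(j | (v \in W) || (j == i0))
    (if v \in W then rho v j j else 1)).
  rewrite bigA_distr_big_dep; apply: eq_big => u.
    rewrite inE; apply/eqP/familyP => [<- v|h]; first by rewrite !cfE unfold_in /=; case: (v \in W) => /=; rewrite ?eqxx.
    apply/ffunP => v; rewrite !cfE; have := h v; rewrite unfold_in.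
    by case: (v \in W) => //= /eqP ->.
  by move=> _; rewrite big_mkcond.
rewrite big1 // => v _; case: (boolP (v \in W)) => vW /=.
  exact: rho_tr.
by rewrite (big_pred1 i0).
Qed.

(** A partial trace: the sites outside W contribute the traces of their states, which are 1. *)
Lemma expect_loc W A : loc W A -> expect A =
  \sum_(x in cfg W) \sum_(y in cfg W) entry A x y * \prod_(v in W) rho v (y v) (x v).
Proof.
move=> lA; rewrite expectE (sum_glue W); apply: eq_bigr => x xW.
pose G := \sum_(y in cfg W) entry A x y * \prod_(v in W) rho v (y v) (x v).
rewrite -/G.
transitivity (\sum_(u in cfg (~: W)) G * \prod_(v in ~: W) rho v (u v) (u v)); last first.
  by rewrite -mulr_sumr sum_diag mulr1.
apply: eq_bigr => u uW.
set s := glue W x u; have rs : restr W s = x by rewrite restr_glue cfgE.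
rewrite (bigID (agree_on (~: W) s)) /= [X in _ + X]big1 ?addr0; last first.
  by move=> z sz; rewrite lA (negPf sz) mul0r.
rewrite /G -(sum_agree W s) mulr_suml; apply: eq_bigr => z sz.
rewrite lA sz rs -mulrA; congr (_ * _).
rewrite (bigID (mem W)) /=; congr (_ * _).
  by apply: eq_bigr => v vW; rewrite !cfE vW.
apply: eq_big => v; first by rewrite inE.
move=> vW; move/agreeCP: sz => <- //.
by rewrite !cfE (negPf vW).
Qed.

Lemma expectM W A B : loc W A -> loc (~: W) B -> expect (A *m B) = expect A * expect B.
Proof.
move=> lA lB; rewrite (expect_loc lA) (expect_loc lB) expectE (sum_glue W).
rewrite mulr_suml; apply: eq_bigr => x xW; rewrite mulr_sumr; apply: eq_bigr => u uW.
rewrite (sum_glue W) mulr_suml; apply: eq_bigr => y yW; rewrite mulr_sumr; apply: eq_bigr => w wW.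
have rg (p q : config) : q \in cfg (~: W) -> restr (~: W) (glue W p q) = q.
  move=> /cfgE <-; apply/ffunP => v; rewrite !cfE inE; by case: (v \in W).
rewrite (entryM_disj _ _ lA lB) !restr_glue !rg // (cfgE xW) (cfgE yW).
rewrite -!mulrA; congr (_ * _); rewrite mulrCA; congr (_ * _).
rewrite (bigID (mem W)) /=; congr (_ * _).
  by apply: eq_bigr => v vW; rewrite !cfE vW.
apply: eq_big => v; first by rewrite inE.
by move=> vW; rewrite !cfE (negPf vW).
Qed.

End ProductState.
End LocalOperators.

(** * The Loschmidt echo as a polymer model *)

Section Modulus.
Variable R : realType.
Implicit Types z : R[i].

Lemma cabsE z : `|z| = (cabs z)%:C.
Proof. by rewrite /cabs RRe_real // normr_real. Qed.

Lemma cabs_ge0 z : 0 <= cabs z.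
Proof. by rewrite -ler0c -cabsE. Qed.

Lemma cabsM z w : cabs (z * w) = cabs z * cabs w.
Proof. by apply: complexI; rewrite rmorphM -!cabsE normrM. Qed.

Lemma cabs_norm x : cabs (x%:C : R[i]) = `|x|.
Proof. by apply: complexI; rewrite -cabsE normc_def /= expr0n addr0 sqrtr_sqr. Qed.

Lemma cabsD z w : cabs (z + w) <= cabs z + cabs w.
Proof. by rewrite -lecR rmorphD -!cabsE ler_normD. Qed.

Lemma cabs_eq0 z : (cabs z == 0) = (z == 0).
Proof.
by apply/eqP/eqP => [z0|->]; [apply/eqP; rewrite -normr_eq0 cabsE z0 | apply: complexI; rewrite -cabsE normr0].
Qed.

Lemma sqn_l2norm n (v : 'cV[R[i]]_n) : sqn v = (l2norm v ^+ 2)%:C.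
Proof.
rewrite sqr_sqrtr ?rmorph_sum; last by apply: sumr_ge0 => a _; rewrite exprn_ge0 ?cabs_ge0.
by apply: eq_bigr => a _; rewrite cabsE rmorphXn.
Qed.

Lemma l2normZ n c (v : 'cV[R[i]]_n) : l2norm (c *: v) = cabs c * l2norm v.
Proof.
rewrite /l2norm -[cabs c]ger0_norm ?cabs_ge0 // -sqrtr_sqr -sqrtrM ?sqr_ge0 //.
by congr (Num.sqrt _); rewrite mulr_sumr; apply: eq_bigr => a _; rewrite mxE cabsM exprMn.
Qed.

Lemma opnorm1_contr n (A : 'M[R[i]]_n) : opnorm A = 1 -> contr A.
Proof.
move=> A1 v; rewrite !sqn_l2norm lecR lerXn2r ?nnegrE ?sqrtr_ge0 //.
have unit_le u : l2norm u = 1 -> l2norm (A *m u) <= 1.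
  move=> u1; rewrite -A1; apply: sup_upper_bound; last by exists u.
  (* A set without supremum has [sup] equal to 0 by convention, so the norm being 1 guarantees that
     the supremum exists. *)
  apply: boolp.contrapT => /sup_out; rewrite -/(opnorm A) A1.
  by move/eqP; rewrite oner_eq0.
have [v0|v0] := eqVneq (l2norm v) 0.
  suff -> : v = 0 by rewrite mulmx0.
  have := sqn_l2norm v; rewrite v0 expr0n => /eqP; rewrite psumr_eq0; last first.
    by move=> a _; rewrite exprn_ge0.
  move=> /allP h; apply/matrixP => a b; rewrite !mxE ord1.
  by have := h a (mem_index_enum _); rewrite /= sqrf_eq0 normr_eq0 => /eqP.
have c0 : 0 < l2norm v by rewrite lt_def v0 sqrtr_ge0.
have := unit_le ((l2norm v)^-1%:C *: v); rewrite -scalemxAr !l2normZ cabs_norm.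
rewrite ger0_norm ?invr_ge0 ?(ltW c0) // mulVf // => /(_ erefl).
by rewrite mulrC ler_pdivrMr // mul1r.
Qed.

End Modulus.

Section Expectation.
Variables (R : realType) (V : finType) (d : nat).
Variable rho : V -> 'M[R[i]]_d.
Hypothesis rho_density : forall v, density_op (rho v).

(** B is the tensor product of the Gram factors of the single-site states. *)
Lemma product_state_gram : exists B : op R V d, product_state rho = B ^t* *m B.
Proof.
have /fin_all_exists[G GE] v : exists B : 'M[R[i]]_d, rho v = B ^t* *m B.
  by case: (rho_density v) => h1 h2 _; apply: psd_gram.
exists (\matrix_(a, b) \prod_(v : V) G v ((enum_val a : config V d) v) ((enum_val b : config V d) v)).
apply/matrixP => a b; rewrite !mxE.
transitivity (\prod_v \sum_(j < d) (G v j (enum_val a v))^* * G v j (enum_val b v)).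
  by apply: eq_bigr => v _; rewrite GE mxE; apply: eq_bigr => j _; rewrite !mxE.
rewrite bigA_distr_bigA (reindex (fun c : 'I_#|{: config V d}| => enum_val c)) /=; last first.
  by exists enum_rank => i _; rewrite ?enum_rankK ?enum_valK.
by apply: eq_bigr => c _; rewrite !mxE rmorph_prod -big_split.
Qed.

Lemma product_state_tr : \tr (product_state rho) = 1.
Proof.
rewrite /mxtrace (reindex (fun c : config V d => enum_rank c)) /=; last first.
  by exists enum_val => i _; rewrite ?enum_rankK ?enum_valK.
transitivity (\prod_(v : V) \sum_(j < d) rho v j j).
  rewrite bigA_distr_bigA; apply: eq_bigr => c _.
  by rewrite mxE !enum_rankK.
by rewrite big1 // => v _; case: (rho_density v) => _ _; apply.
Qed.

Lemma expect_contr (A : op R V d) : contr A -> `|expect rho A| <= 1.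
Proof.
have [B BE] := product_state_gram.
by move=> /(contr_gram B); rewrite -BE product_state_tr.
Qed.

Lemma expect_id : expect rho 1%:M = 1.
Proof. by rewrite /expect mul1mx product_state_tr. Qed.

Lemma density_tr v : \tr (rho v) = 1.
Proof. by case: (rho_density v). Qed.

End Expectation.

Lemma sum_expr_tuple (A : pzRingType) (T : finType) (P : pred T) (a : T -> A) m :
  (\sum_(i | P i) a i) ^+ m =
    \sum_(s : m.-tuple T | all P s) \prod_(j <- s) a j.
Proof.
elim: m => [|m IH].
  rewrite expr0 (big_pred1 [tuple]) ?big_nil // => s.
  by rewrite tuple0 /= eqxx.
rewrite exprS IH big_distrlr /= pair_big_dep /=.
rewrite [RHS](reindex (fun p : T * m.-tuple T => [tuple of p.1 :: p.2])) /=; last first.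
  exists (fun s : m.+1.-tuple T => (thead s, [tuple of behead s])).
    by move=> [i s] _ /=; rewrite theadE; congr pair; apply/val_inj.
  by move=> s _; rewrite /= -tuple_eta.
by apply: eq_bigr => -[i s] _ /=; rewrite big_cons.
Qed.

(** * Taylor coefficients of the echo satisfy the hypotheses on polymers *)

Section Model.
Variables (R : realType) (V : finType) (d : nat) (i0 : 'I_d).
Variable rho : V -> 'M[R[i]]_d.
Hypothesis rho_density : forall v, density_op (rho v).
Variables (T : finType) (X : T -> {set V}) (lam : T -> R) (h : T -> op R V d).
Hypothesis lam_le : forall i, `|lam i| <= 1.
Hypothesis h_supp : forall i, acts_within (X i) (h i).
Hypothesis h_norm : forall i, opnorm (h i) = 1.

Definition partial_ham (B : {set T}) : op R V d := \sum_(i in B) (lam i)%:C *: h i.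

Definition echo_coef (H : op R V d) m : R[i] :=
  (- 'i%C) ^+ m / m`!%:R * expect rho (H ^+ m).

Definition seq_coef (s : seq T) : R[i] :=
  (- 'i%C) ^+ size s / (size s)`!%:R * expect rho (\prod_(i <- s) ((lam i)%:C *: h i)).

Definition touch : rel T := [rel i j | (i != j) && (X i :&: X j != finset.set0)].

Lemma touch_sym : symmetric touch.
Proof. by move=> i j; rewrite /touch /= eq_sym setIC. Qed.

Lemma echo_coef_seq B m : echo_coef (partial_ham B) m =
  \sum_(s : m.-tuple T | all (fun i => i \in B) s) seq_coef s.
Proof.
rewrite /echo_coef /partial_ham sum_expr_tuple expect_sum mulr_sumr.
by apply: eq_bigr => s _; rewrite /seq_coef size_tuple.
Qed.

Lemma seq_coef_le s : `|seq_coef s| <= (size s)`!%:R^-1.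
Proof.
have n1 : `|- 'i%C| = 1 :> R[i].
  by rewrite normrN normc_def /= expr0n add0r expr1n sqrtr1.
rewrite /seq_coef !normrM normrX n1 expr1n mul1r normfV normr_nat.
rewrite -[leRHS]mulr1 ler_wpM2l ?invr_ge0 // expect_contr //.
elim: s => [|i s IH]; first by rewrite big_nil; apply: contr1.
have ci : contr ((lam i)%:C *: h i).
  apply: contrZ; last by apply: opnorm1_contr; apply: h_norm.
  by rewrite cabsE cabs_norm lecR.
rewrite big_cons; exact: (contrM ci IH).
Qed.

Lemma echo_coef0 H : echo_coef H 0 = 1.
Proof. by rewrite /echo_coef fact0 divr1 !expr0 mul1r expect_id. Qed.

Lemma partial_ham_loc (W : {set V}) (B : {set T}) : (forall i, i \in B -> X i \subset W) ->
  loc i0 W (partial_ham B).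
Proof.
move=> BW; apply: loc_sum => i iB; apply: locZ.
by apply: loc_mono (BW i iB) _; apply: loc_acts.
Qed.

(** The two Hamiltonians act on disjoint sites, hence commute and have factorizing expectations; the
    binomial coefficients are absorbed by the factorials. *)
Lemma echo_coefM (B C : {set T}) m : separated touch B C ->
  echo_coef (partial_ham (B :|: C)) m =
    \sum_(j < m.+1) echo_coef (partial_ham B) j * echo_coef (partial_ham C) (m - j).
Proof.
move=> sBC; pose W := cover [set X i | i in B].
have lB : loc i0 W (partial_ham B).
  apply: partial_ham_loc => i iB; apply: bigcup_sup; exact: imset_f.
have lC : loc i0 (~: W) (partial_ham C).
  apply: partial_ham_loc => i iC; rewrite -disjoints_subset disjoint_sym.
  rewrite -setI_eq0; apply/eqP/setP => v; rewrite !inE.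
  apply/negbTE/negP => /andP[/bigcupP[_ /imsetP[j jB ->] vj] vi].
  move/separatedP: sBC => /(_ j i jB iC) /andP[ji]; rewrite /touch /= ji /=.
  by rewrite negbK => /eqP/setP/(_ v); rewrite !inE vj vi.
have -> : partial_ham (B :|: C) = partial_ham B + partial_ham C.
  rewrite /partial_ham -bigU ?(separated_disjoint sBC) //.
  by apply: eq_bigl => i; rewrite inE.
rewrite /echo_coef addrC exprDn_comm; last first.
  by apply: esym; apply: (loc_comm lB lC).
rewrite expect_sum mulr_sumr; apply: eq_bigr => j _.
have jm : (j <= m)%N by rewrite -ltnS.
have -> : partial_ham C ^+ (m - j) * partial_ham B ^+ j
  = partial_ham B ^+ j *m partial_ham C ^+ (m - j).
  by apply: esym; apply: (loc_comm (locX _ lB) (locX _ lC)).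
rewrite expectMn (expectM (density_tr rho_density) (locX _ lB) (locX _ lC)).
rewrite -{1}(subnKC jm) exprD.
have -> : ('C(m, j))%:R = m`!%:R / (j`!%:R * (m - j)`!%:R) :> R[i].
  by rewrite -(bin_fact jm) !natrM mulfK // mulf_neq0 // pnatr_eq0 -lt0n fact_gt0.
have m0 : m`!%:R != 0 :> R[i] by rewrite pnatr_eq0 -lt0n fact_gt0.
rewrite invfM; set a := expect _ _; set b := expect _ _.
transitivity ((m`!%:R / m`!%:R) * ((- 'i%C) ^+ j * (- 'i%C) ^+ (m - j) * (j`!%:R^-1 * (m - j)`!%:R^-1) * (a * b))).
  by ring.
by rewrite divff // mul1r; ring.
Qed.

End Model.

(** * Computability on the random access machine *)

Local Open Scope nat_scope.

Section Computability.
Variable R : realType.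
Local Notation state := (state R).
Local Notation input := (input R).

Variant kind := KNat | KCpx.

Definition kty (q : kind) : Type := if q is KNat then nat else R[i].

Definition cell q (s : state) (a j : nat) : kty q :=
  match q with KNat => imem s a j | KCpx => cmem s a j end.

Definition kexp (q : kind) : Type := if q is KNat then iexp else cexpr.

Definition keval q (inp : input) (s : state) : kexp q -> kty q :=
  match q with KNat => ieval inp s | KCpx => ceval inp s end.

Definition kcost q : kexp q -> nat :=
  match q with KNat => icost | KCpx => ccost end.

Definition kget q (a : nat) (e : iexp) : kexp q :=
  match q with KNat => IGet a e | KCpx => CGet a e end.

Definition kset q (a : nat) (e : iexp) : kexp q -> cmd :=
  match q with KNat => ISet a e | KCpx => CSet a e end.

Definition kupd q (s : state) (a j : nat) : kty q -> state :=
  match q with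
  | KNat => fun w => State (upd (imem s) a j w) (cmem s)
  | KCpx => fun w => State (imem s) (upd (cmem s) a j w)
  end.

Lemma exec_kset q inp s a e (w : kexp q) :
  exec inp (kset a e w) s (icost e + kcost w).+1
    (kupd s a (ieval inp s e) (keval inp s w)).
Proof. by case: q w => w; [apply: ExISet | apply: ExCSet]. Qed.

Lemma keval_get q inp s a e : keval inp s (kget q a e) = cell q s a (ieval inp s e).
Proof. by case: q. Qed.

Lemma cell_upd_same q s a j (w : kty q) : cell q (kupd s a j w) a j = w.
Proof. by case: q w => w; rewrite /= /upd !eqxx. Qed.

Lemma cell_upd_ne q q' s a j (w : kty q) a' j' :
  (a' == a) && (j' == j) = false -> cell q' (kupd s a j w) a' j' = cell q' s a' j'.
Proof. by case: q w => w; case: q' => //=; rewrite /upd => ->. Qed.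

(** The frame condition: a computation started at level k treats the arrays from k on as scratch
    space. *)
Definition same_below k (s s' : state) :=
  forall q a j, (a < k)%N -> cell q s' a j = cell q s a j.

Lemma same_below_trans k s1 s2 s3 :
  same_below k s1 s2 -> same_below k s2 s3 -> same_below k s1 s3.
Proof. by move=> h1 h2 q a j ak; rewrite h2 // h1. Qed.

Lemma same_below_le k k' s s' : (k <= k')%N -> same_below k' s s' -> same_below k s s'.
Proof. by move=> kk h q a j ak; apply: h; apply: leq_trans kk. Qed.

Lemma same_below_upd q k s a j (w : kty q) : (k <= a)%N -> same_below k s (kupd s a j w).
Proof.
move=> ka q' a' j' ak; rewrite cell_upd_ne // (_ : a' == a = false) //.
by apply/eqP => aa; move: ak; rewrite aa ltnNge ka.
Qed.

Lemma while_loop inp b p (I : nat -> state -> Prop) N Tb :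
  (forall i s, (i <= N)%N -> I i s -> beval inp s b = (i < N)%N) ->
  (forall i s, (i < N)%N -> I i s ->
     exists T s', [/\ exec inp p s T s', (T <= Tb)%N & I i.+1 s']) ->
  forall s, I 0 s -> exists T s', [/\ exec inp (While b p) s T s',
    (T <= N * (bcost b + Tb).+1 + (bcost b).+1)%N & I N s'].
Proof.
move=> hb hp.
suff h n i s : (i + n = N)%N -> I i s -> exists T s', [/\ exec inp (While b p) s T s',
    (T <= n * (bcost b + Tb).+1 + (bcost b).+1)%N & I N s'].
  by move=> s I0; apply: (h N 0%N).
elim: n i s => [|n IH] i s iN Ii.
  rewrite addn0 in iN; exists (bcost b).+1, s; split=> //; last by rewrite -iN.
  by apply: ExWhileF; rewrite (hb i) // iN ?ltnn.
have iltN : (i < N)%N by lia.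
have [T1 [s1 [e1 T1b I1]]] := hp i s iltN Ii.
have [|T2 [s2 [e2 T2b I2]]] := IH i.+1 s1 _ I1; first by lia.
exists (bcost b + T1 + T2).+1, s2; split=> //; last by lia.
by apply: ExWhileT e1 e2; rewrite (hb i) // ltnW.
Qed.

(* A context describes the machine states in which a computation is started: the state represents
   a value e of the environment in the arrays below clev, and computations may use all other
   arrays. Run times are measured as polynomials in cbase. *)
Record ctx := Ctx {
  cenv :> Type;
  cinp : cenv -> input;
  cbase : cenv -> nat;
  cdom : cenv -> Prop;
  crep : cenv -> state -> Prop;
  clev : nat;
  crep_stable : forall e s s', same_below clev s s' -> crep e s -> crep e s'
}.

Implicit Types (c : ctx) (q : kind).

Definition poly_le (c : ctx) (T : c -> nat) :=
  exists K n, forall e, cdom e -> (T e <= K * (cbase e).+1 ^ n)%N.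

(** Only arrays from k on may change, and the result is left at index 0 of array k. Quantifying over
    k lets programs be composed without clashes; [p], [K] and [n] precede the environment, so one
    program serves all inputs. *)
Definition comp q (c : ctx) (f : c -> kty q) := forall k, (clev c <= k)%N ->
  exists p K n, forall e s, cdom e -> crep e s -> exists T s',
    [/\ exec (cinp e) p s T s', (T <= K * (cbase e).+1 ^ n)%N,
        same_below k s s' & cell q s' k 0 = f e].

Notation compN := (@comp KNat).
Notation compC := (@comp KCpx).

Lemma comp_eq q c (f g : c -> kty q) :
  (forall e, cdom e -> f e = g e) -> comp f -> comp g.
Proof.
move=> fg cf k kc; have [p [K [n h]]] := cf k kc; exists p, K, n => e s de re.
by have [T [s' [h1 h2 h3 h4]]] := h e s de re; exists T, s'; rewrite -fg.
Qed.

Lemma comp_weak q (c c' : ctx) (phi : c' -> c) (f : c -> kty q) :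
  (forall e, cinp (phi e) = cinp e) -> (forall e, cbase (phi e) = cbase e) ->
  (forall e, cdom e -> cdom (phi e)) -> (forall e s, crep e s -> crep (phi e) s) ->
  (clev c <= clev c')%N ->
  comp f -> comp (fun e => f (phi e)).
Proof.
move=> hi hb hd hr lc cf k kc.
have [|p [K [n h]]] := cf k; first exact: leq_trans kc.
exists p, K, n => e s de re; have := h (phi e) s (hd _ de) (hr _ _ re).
by rewrite hi hb.
Qed.

Lemma poly_le_weak (c c' : ctx) (phi : c' -> c) (T : c -> nat) :
  (forall e, cbase (phi e) = cbase e) -> (forall e, cdom e -> cdom (phi e)) ->
  poly_le T -> poly_le (fun e => T (phi e)).
Proof.
by move=> hb hd [K [n h]]; exists K, n => e de; rewrite -hb; apply: h; apply: hd.
Qed.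

Lemma comp_leaf q c (f : c -> kty q) (E : kexp q) :
  (forall e s, cdom e -> crep e s -> keval (cinp e) s E = f e) -> comp f.
Proof.
move=> h k kc; exists (kset k (INum 0) E), (icost (INum 0) + kcost E).+1, 0%N => e s de re.
eexists; eexists; split; first exact: exec_kset.
- by rewrite expn0 muln1.
- exact: same_below_upd.
- by rewrite cell_upd_same; apply: h.
Qed.

Lemma cost_add K1 n1 K2 n2 G a b t : (a <= K1 * G.+1 ^ n1)%N -> (b <= K2 * G.+1 ^ n2)%N ->
  (a + b + t <= (K1 + K2 + t) * G.+1 ^ (n1 + n2))%N.
Proof.
move=> h1 h2; have p n m : (G.+1 ^ n <= G.+1 ^ (n + m))%N by rewrite leq_pexp2l // leq_addr.
rewrite !mulnDl; apply: leq_add; last by rewrite leq_pmulr // expn_gt0.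
apply: leq_add; first by apply: leq_trans h1 _; rewrite leq_mul2l p orbT.
by apply: leq_trans h2 _; rewrite leq_mul2l addnC p orbT.
Qed.

Program Definition letctx (c : ctx) (k : nat) (P : c -> state -> Prop)
    (st : forall e s s', same_below k.+1 s s' -> P e s -> P e s') (kc : (clev c <= k)%N) : ctx :=
  @Ctx c (@cinp c) (@cbase c) (@cdom c) (fun e s => crep e s /\ P e s) k.+1 _.
Next Obligation.
move=> c k P st kc e s s' ss [re pe]; split; last exact: st ss pe.
by apply: crep_stable re; apply: same_below_le ss; apply: leqW.
Qed.

Lemma cell_stable q c k (f : c -> kty q) e s s' :
  same_below k.+1 s s' -> cell q s k 0 = f e -> cell q s' k 0 = f e.
Proof. by move=> ss <-; apply: ss. Qed.

Definition valctx q (c : ctx) k (f : c -> kty q) (kc : (clev c <= k)%N) : ctx :=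
  letctx (P := fun e s => cell q s k 0 = f e) (@cell_stable q c k f) kc.

Lemma comp_let q q' c (f : c -> kty q) (g : c -> kty q') :
  comp f -> (forall k (kc : (clev c <= k)%N), comp (c := valctx f kc) g) -> comp g.
Proof.
move=> cf cg k kc; have [p1 [K1 [n1 h1]]] := cf k kc.
have [|p2 [K2 [n2 h2]]] := cg k kc k.+1; first exact: leqnn.
pose mv := kset k (INum 0) (kget q' k.+1 (INum 0)).
exists (Seq p1 (Seq p2 mv)), (K1 + K2 + (icost (INum 0) + kcost (kget q' k.+1 (INum 0))).+1)%N, (n1 + n2)%N.
move=> e s de re; have [T1 [s1 [e1 t1 b1 v1]]] := h1 e s de re.
have [|T2 [s2 [e2 t2 b2 v2]]] := h2 e s1 de.
  by split=> //; apply: crep_stable re; apply: same_below_le b1.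
eexists; eexists; split.
- by apply: ExSeq e1 _; apply: ExSeq e2 _; apply: exec_kset.
- by rewrite addnA; apply: cost_add.
- apply: same_below_trans b1 _; apply: same_below_trans (same_below_le (leqnSn k) b2) _.
  exact: same_below_upd.
- by rewrite cell_upd_same keval_get.
Qed.

Lemma comp_valctx_weak q q' c (g : c -> kty q') k (kc : (clev c <= k)%N) (f : c -> kty q) :
  comp f -> comp (c := valctx g kc) f.
Proof.
by move=> cf; apply: (@comp_weak q c (valctx g kc) id) => //= [e s []|] //; apply: leqW.
Qed.

Lemma comp_op1 q q' c (f : c -> kty q) (g : c -> kty q') (E : kexp q -> kexp q') :
  (forall e s x, cdom e -> crep e s -> keval (cinp e) s x = f e -> keval (cinp e) s (E x) = g e) ->
  comp f -> comp g.
Proof.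
move=> h cf; apply: (comp_let cf) => k kc.
apply: (@comp_leaf _ _ _ (E (kget q k (INum 0)))) => e s /= de [re v].
by apply: h => //; rewrite keval_get.
Qed.

Lemma comp_op2 q1 q2 q' c (f1 : c -> kty q1) (f2 : c -> kty q2) (g : c -> kty q')
    (E : kexp q1 -> kexp q2 -> kexp q') :
  (forall e s x y, cdom e -> keval (cinp e) s x = f1 e -> keval (cinp e) s y = f2 e ->
     keval (cinp e) s (E x y) = g e) ->
  comp f1 -> comp f2 -> comp g.
Proof.
move=> h c1 c2; apply: (comp_let c1) => k kc.
apply: (@comp_op1 q2 q' (valctx f1 kc) f2 g (E (kget q1 k (INum 0)))); last exact: comp_valctx_weak.
by move=> e s y /= de [_ v]; apply: h => //; rewrite keval_get.
Qed.

End Computability.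

Lemma neq_ltn_false k : (k == k.+1) = false.
Proof. by apply/negbTE; rewrite neq_ltn ltnSn. Qed.

(** * Branches, loops and tables *)

Section Loops.
Variable R : realType.
Local Notation state := (state R).
Local Notation ctx := (ctx R).
Implicit Types (c : ctx) (q : kind).
Local Notation kty := (kty R).
Local Notation compN := (@comp R KNat).
Local Notation compC := (@comp R KCpx).

Program Definition varctx c (n : c -> nat) k (kc : (clev c <= k)%N) : ctx :=
  @Ctx R (c * nat) (fun p => cinp p.1) (fun p => cbase p.1)
    (fun p => cdom p.1 /\ (p.2 < n p.1)%N)
    (fun p s => crep p.1 s /\ imem s k 0 = p.2) k.+1 _.
Next Obligation.
move=> c n k kc [e i] s s' ss [/= re si]; split => /=; last first.
  by have /= -> := ss KNat k 0 (ltnSn k).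
by apply: crep_stable re; apply: same_below_le ss; apply: leqW.
Qed.

(** A table under construction: the entry for [p.2] is to be computed while all earlier entries can
    be read from array k. This models course-of-values recursion. *)
Program Definition tabctx c (n : c -> nat) q (A : c -> nat -> kty q) k (kc : (clev c <= k)%N) : ctx :=
  @Ctx R (c * nat) (fun p => cinp p.1) (fun p => cbase p.1)
    (fun p => cdom p.1 /\ (p.2 < n p.1)%N)
    (fun p s => [/\ crep p.1 s, forall y, (y < p.2)%N -> cell q s k y = A p.1 y & imem s k.+1 0 = p.2]) k.+2 _.
Next Obligation.
move=> c n q A k kc [e i] s s' ss [/= re sA si]; split => /=; last first.
- by have /= -> := ss KNat k.+1 0 (ltnSn k.+1).
- by move=> y yi; rewrite ss ?sA.
by apply: crep_stable re; apply: same_below_le ss; apply/leqW/leqW.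
Qed.

Program Definition arrctx c (n : c -> nat) q (A : c -> nat -> kty q) k (kc : (clev c <= k)%N) : ctx :=
  @Ctx R c (@cinp R c) (@cbase R c) (@cdom R c)
    (fun e s => crep e s /\ forall y, (y < n e)%N -> cell q s k y = A e y) k.+1 _.
Next Obligation.
move=> c n q A k kc e s s' ss [/= re sA]; split => /=.
  by apply: crep_stable re; apply: same_below_le ss; apply: leqW.
by move=> y yi; rewrite ss // sA.
Qed.

Definition domctx c (P : c -> Prop) : ctx :=
  @Ctx R c (@cinp R c) (@cbase R c) (fun e => cdom e /\ P e) (@crep R c) (clev c) (@crep_stable R c).

(** Each branch has to be computable on its own part of the domain only; a recursive call needs
    this, as it reads an earlier table entry only when there is one. *)
Lemma comp_if c (b : c -> bool) q (f g : c -> kty q) :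
  compN (fun e => nat_of_bool (b e)) ->
  comp (c := domctx (fun e => b e)) f -> comp (c := domctx (fun e => ~~ b e)) g ->
  comp (fun e => if b e then f e else g e).
Proof.
move=> cb cf cg; apply: (comp_let cb) => k kc k' /= kk.
have [|p1 [K1 [n1 h1]]] := cf k'; first exact: leq_trans (ltnW kk).
have [|p2 [K2 [n2 h2]]] := cg k'; first exact: leq_trans (ltnW kk).
pose bb := BEq (IGet k (INum 0)) (INum 0).
(* The test asks whether the stored truth value is 0, so the branches are exchanged. *)
exists (If bb p2 p1), (K1 + K2 + (bcost bb).+1)%N, (n1 + n2)%N => e s /= de [re v].
have bE : beval (cinp e) s bb = ~~ b e by rewrite /= v; case: (b e).
case be : (b e).
  have [|T [s' [ex t bl vl]]] := h1 e s _ re; first by split.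
  exists (bcost bb + T).+1, s'; split=> //; first by apply: ExIf; rewrite bE be.
  apply: leq_trans (cost_add (a := T) (b := 0) (bcost bb).+1 t (leq0n _)); lia.
have [|T [s' [ex t bl vl]]] := h2 e s _ re; first by split=> //; rewrite be.
exists (bcost bb + T).+1, s'; split=> //; first by apply: ExIf; rewrite bE be.
apply: leq_trans (cost_add (a := 0) (b := T) (bcost bb).+1 (leq0n _) t); lia.
Qed.

Lemma cost_loop N G K1 n1 K2 n2 T w1 w2 :
  (N <= K1 * G.+1 ^ n1)%N -> (T <= K2 * G.+1 ^ n2)%N ->
  (N * (T + w1) + w2 <= (K1 * (K2 + w1) + w2) * G.+1 ^ (n1 + n2))%N.
Proof.
move=> hN hT; rewrite mulnDl; apply: leq_add; last by rewrite leq_pmulr // expn_gt0.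
apply: leq_trans (leq_mul hN (leqnn _)) _.
have h : (T + w1 <= (K2 + w1) * G.+1 ^ n2)%N.
  by rewrite mulnDl leq_add // leq_pmulr // expn_gt0.
by rewrite expnD mulnACA leq_mul.
Qed.

Section Big.
Variables (c : ctx) (q : kind) (idx : kty q) (op : Monoid.law idx).
Variables (Eidx : kexp q) (Eop : kexp q -> kexp q -> kexp q).
Hypothesis Eidx_ok : forall inp s, keval (R := R) inp s Eidx = idx.
Hypothesis Eop_ok : forall inp s x y,
  keval (R := R) inp s (Eop x y) = op (keval inp s x) (keval inp s y).

Lemma comp_big (n : c -> nat) (F : c -> nat -> kty q) :
  compN n -> poly_le n ->
  (forall k (kc : (clev c <= k)%N), comp (c := varctx n kc) (fun p => F p.1 p.2)) ->
  comp (fun e => \big[op/idx]_(0 <= i < n e) F e i).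
Proof.
move=> cn [K1 [n1 hn]] cF; apply: (comp_let cn) => k0 kc0 k /= kk.
have kc : (clev c <= k)%N by apply: leq_trans kc0 (ltnW kk).
have [|p [K2 [n2 hp]]] := cF k kc k.+2; first exact: leqnSn.
pose upd_acc := kset k.+1 (INum 0) (Eop (kget q k.+1 (INum 0)) (kget q k.+2 (INum 0))).
(* Array k holds the counter, k + 1 the accumulator, and k + 2 receives the value of the body. *)
pose step := Seq p (Seq upd_acc (ISet k (INum 0) (IAdd (IGet k (INum 0)) (INum 1)))).
pose b := BNot (BLe (IGet k0 (INum 0)) (IGet k (INum 0))).
pose wu := (1 + kcost (Eop (kget q k.+1 (INum 0)) (kget q k.+2 (INum 0)))).+1%N.
pose wm := (1 + kcost (kget q k.+1 (INum 0))).+1%N.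
pose wi := (1 + kcost Eidx).+1%N.
exists (Seq (ISet k (INum 0) (INum 0)) (Seq (kset k.+1 (INum 0) Eidx)
   (Seq (While b step) (kset k (INum 0) (kget q k.+1 (INum 0)))))).
exists (K1 * (K2 + (bcost b + wu + 6).+1) + ((bcost b).+1 + wi + wm + 3))%N, (n1 + n2)%N.
move=> e s /= de [re v].
pose I i (s' : state) := [/\ same_below k s s', imem s' k 0 = i &
   cell q s' k.+1 0 = \big[op/idx]_(0 <= j < i) F e j].
pose N := n e; pose Tb := (K2 * (cbase e).+1 ^ n2 + (wu + 6))%N.
have hb i s' : (i <= N)%N -> I i s' -> beval (cinp e) s' b = (i < N)%N.
  move=> _ [ss si _]; rewrite /= si -ltnNge.
  by have := ss KNat k0 0 kk; rewrite /= v => ->.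
have hstep i s' : (i < N)%N -> I i s' ->
    exists T s'', [/\ exec (cinp e) step s' T s'', (T <= Tb)%N & I i.+1 s''].
  move=> iN [ss si sa].
  have [||T [s1 [e1 t1 b1 v1]]] := hp (e, i) s'.
  - by split.
  - split=> //=; apply: crep_stable re; exact: same_below_le ss.
  pose s2 := kupd s1 k.+1 0 (keval (cinp e) s1 (Eop (kget q k.+1 (INum 0)) (kget q k.+2 (INum 0)))).
  pose s3 := kupd (q := KNat) s2 k 0 (ieval (cinp e) s2 (IAdd (IGet k (INum 0)) (INum 1))).
  have kne : (k == k.+1) && (0 == 0) = false by rewrite andbT neq_ltn_false.
  have kne' : (k.+1 == k) && (0 == 0) = false by rewrite eq_sym.
  have s2k : cell KNat s2 k 0 = i by rewrite cell_upd_ne // (b1 KNat).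
  eexists; exists s3; split.
  - by apply: ExSeq e1 _; apply: ExSeq (exec_kset _ _ _ _ _) (exec_kset (q := KNat) _ _ _ _ _).
  - rewrite /Tb; apply: leq_add => //; rewrite /= /wu; lia.
  split.
  - apply: same_below_trans ss _.
    apply: same_below_trans (same_below_le _ b1) _; first by lia.
    by apply: (@same_below_trans _ _ _ s2); apply: same_below_upd.
  - have := cell_upd_same (q := KNat) s2 k 0 (ieval (cinp e) s2 (IAdd (IGet k (INum 0)) (INum 1))).
    by rewrite -/s3 /= => ->; move: s2k => /= ->; rewrite addn1.
  - rewrite cell_upd_ne // cell_upd_same Eop_ok !keval_get /= big_nat_recr //= v1 /=.
    by rewrite (b1 q) // sa.
pose s00 := kupd (q := KNat) s k 0 0%N.
pose s0 := kupd s00 k.+1 0 (keval (cinp e) s00 Eidx).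
have I0 : I 0%N s0.
  split.
  - by apply: (@same_below_trans _ _ _ s00); apply: same_below_upd.
  - have : cell KNat s0 k 0 = 0%N by rewrite cell_upd_ne ?andbT ?neq_ltn_false // cell_upd_same.
    by [].
  - by rewrite cell_upd_same Eidx_ok big_geq.
have [T [s1 [e1 t1 [ss si sa]]]] := while_loop hb hstep I0.
eexists; eexists; split.
- apply: ExSeq (exec_kset (q := KNat) _ _ _ _ _) _.
  apply: ExSeq (exec_kset _ _ _ _ _) _.
  exact: ExSeq e1 (exec_kset _ _ _ _ _).
- apply: leq_trans (cost_loop (bcost b + wu + 6).+1 ((bcost b).+1 + wi + wm + 3) (hn e de) (leqnn (K2 * (cbase e).+1 ^ n2))).
  move: t1; rewrite /Tb /N /wi /wm.
  set X := (K2 * _)%N.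
  have -> : (n e * (bcost b + (X + (wu + 6))).+1 = n e * (X + (bcost b + wu + 6).+1))%N.
    by congr (_ * _)%N; lia.
  by move: (n e * _)%N => Y; rewrite /=; lia.
- apply: same_below_trans ss _; exact: same_below_upd.
- by rewrite cell_upd_same keval_get.
Qed.

End Big.

Section Tabulation.
Variables (c : ctx) (q q' : kind).

Lemma comp_tab (n : c -> nat) (A : c -> nat -> kty q) (g : c -> kty q') :
  compN n -> poly_le n ->
  (forall k (kc : (clev c <= k)%N), comp (c := tabctx n A kc) (fun p => A p.1 p.2)) ->
  (forall k (kc : (clev c <= k)%N), comp (c := arrctx n A kc) g) ->
  comp g.
Proof.
move=> cn [K1 [n1 hn]] cA cg; apply: (comp_let cn) => k0 kc0 k /= kk.
have kc : (clev c <= k)%N by apply: leq_trans kc0 (ltnW kk).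
have [|p [K2 [n2 hp]]] := cA k kc k.+2; first exact: leqnn.
have [|p3 [K3 [n3 hg]]] := cg k kc k.+1; first exact: leqnn.
pose store := kset k (IGet k.+1 (INum 0)) (kget q k.+2 (INum 0)).
pose step := Seq p (Seq store (ISet k.+1 (INum 0) (IAdd (IGet k.+1 (INum 0)) (INum 1)))).
pose b := BNot (BLe (IGet k0 (INum 0)) (IGet k.+1 (INum 0))).
pose wu := (2 + kcost (kget q k.+2 (INum 0))).+1%N.
pose wm := (1 + kcost (kget q' k.+1 (INum 0))).+1%N.
exists (Seq (ISet k.+1 (INum 0) (INum 0))
   (Seq (While b step) (Seq p3 (kset k (INum 0) (kget q' k.+1 (INum 0)))))).
exists ((K1 * (K2 + (bcost b + wu + 6).+1) + ((bcost b).+1 + wm + 3)) + K3 + 0)%N, (n1 + n2 + n3)%N.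
move=> e s /= de [re v].
pose I i (s' : state) := [/\ same_below k s s', imem s' k.+1 0 = i &
   forall y, (y < i)%N -> cell q s' k y = A e y].
pose N := n e; pose Tb := (K2 * (cbase e).+1 ^ n2 + (wu + 6))%N.
have hb i s' : (i <= N)%N -> I i s' -> beval (cinp e) s' b = (i < N)%N.
  move=> _ [ss si _]; rewrite /= si -ltnNge.
  by have := ss KNat k0 0 kk; rewrite /= v => ->.
have kne : (k == k.+1) = false by rewrite neq_ltn_false.
have kne' : (k.+1 == k) = false by rewrite eq_sym.
have hstep i s' : (i < N)%N -> I i s' ->
    exists T s'', [/\ exec (cinp e) step s' T s'', (T <= Tb)%N & I i.+1 s''].
  move=> iN [ss si sa].
  have [||T [s1 [e1 t1 b1 v1]]] := hp (e, i) s'.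
  - by split.
  - split=> //=; apply: crep_stable re; exact: same_below_le ss.
  have s1i : cell KNat s1 k.+1 0 = i by rewrite (b1 KNat).
  pose s2 := kupd s1 k (imem s1 k.+1 0) (keval (cinp e) s1 (kget q k.+2 (INum 0))).
  pose s3 := kupd (q := KNat) s2 k.+1 0 (ieval (cinp e) s2 (IAdd (IGet k.+1 (INum 0)) (INum 1))).
  have s2k : cell KNat s2 k.+1 0 = i by rewrite cell_upd_ne // kne'.
  eexists; exists s3; split.
  - by apply: ExSeq e1 _; apply: ExSeq (exec_kset _ _ _ _ _) (exec_kset (q := KNat) _ _ _ _ _).
  - rewrite /Tb; apply: leq_add => //; rewrite /= /wu; lia.
  split.
  - apply: same_below_trans ss _.
    apply: same_below_trans (same_below_le _ b1) _; first by lia.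
    by apply: (@same_below_trans _ _ _ s2); apply: same_below_upd.
  - have := cell_upd_same (q := KNat) s2 k.+1 0 (ieval (cinp e) s2 (IAdd (IGet k.+1 (INum 0)) (INum 1))).
    by rewrite -/s3 /= => ->; move: s2k => /= ->; rewrite addn1.
  - move=> y yi; rewrite cell_upd_ne ?kne // /s2.
    have -> : imem s1 k.+1 0 = i by [].
    have [-> |yni] := eqVneq y i.
      by rewrite cell_upd_same keval_get /= v1.
    rewrite cell_upd_ne ?eqxx /=; last exact: negbTE.
    by rewrite (b1 q) // sa // ltn_neqAle yni -ltnS.
pose s0 := kupd (q := KNat) s k.+1 0 0%N.
have I0 : I 0%N s0.
  by split=> //; [apply: same_below_upd | rewrite /= /upd !eqxx].
have [T [s1 [e1 t1 [ss si sa]]]] := while_loop hb hstep I0.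
have [|T3 [s3 [e3 t3 b3 v3]]] := hg e s1 de.
  by split=> //; apply: crep_stable re; apply: same_below_le ss.
eexists; eexists; split.
- apply: ExSeq (exec_kset (q := KNat) _ _ _ _ _) _.
  exact: ExSeq e1 (ExSeq e3 (exec_kset _ _ _ _ _)).
- have t1' := cost_loop (bcost b + wu + 6).+1 ((bcost b).+1 + wm + 3) (hn e de) (leqnn (K2 * (cbase e).+1 ^ n2)).
  apply: leq_trans (cost_add 0 t1' t3).
  move: t1; rewrite /Tb /N /wm.
  set X := (K2 * _)%N.
  have -> : (n e * (bcost b + (X + (wu + 6))).+1 = n e * (X + (bcost b + wu + 6).+1))%N.
    by congr (_ * _)%N; lia.
  by move: (n e * _)%N => Y; rewrite /=; lia.
- apply: same_below_trans ss _; apply: same_below_trans (same_below_le (leqnSn k) b3) _.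
  exact: same_below_upd.
- by rewrite cell_upd_same keval_get.
Qed.

End Tabulation.

End Loops.

Definition alln (n : nat) (P : nat -> bool) := all P (iota 0 n).
Definition hasn (n : nat) (P : nat -> bool) := has P (iota 0 n).

Lemma allnP (n : nat) (P : nat -> bool) : reflect (forall i, i < n -> P i) (alln n P).
Proof.
apply: (iffP allP) => h i; first by move=> iN; apply: h; rewrite mem_iota.
by rewrite mem_iota => /andP[_]; apply: h.
Qed.

Lemma hasnP (n : nat) (P : nat -> bool) : reflect (exists2 i, i < n & P i) (hasn n P).
Proof.
apply: (iffP hasP) => -[i iN Pi]; exists i => //; first by rewrite mem_iota in iN.
by rewrite mem_iota.
Qed.

Ltac conj_assumption := first [assumption | split; conj_assumption].

(* The maps between contexts in use are projections from iterated products, so their properties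
   are found by unfolding. *)
Ltac solve_ctxmap :=
  repeat match goal with x := _ |- _ => subst x end;
  split; [intros; reflexivity | intros; reflexivity
  | let e := fresh in let H := fresh in
    intros e H; simpl in *; repeat match goal with K : _ /\ _ |- _ => destruct K end; conj_assumption
  | let e := fresh in let s := fresh in let H := fresh in
    intros e s H; simpl in *;
    repeat match goal with K : _ /\ _ |- _ => destruct K | K : and3 _ _ _ |- _ => destruct K end;
    conj_assumption
  | simpl in *; lia].

(** * Closure rules for computable functions and polynomial bounds *)

Section Rules.
Variable R : realType.
Local Notation ctx := (ctx R).
Implicit Types (c : ctx).
Local Notation compN := (@comp R KNat).
Local Notation compC := (@comp R KCpx).
Definition compB c (b : c -> bool) := compN (fun e => nat_of_bool (b e)).

Definition ctxmap (c' c : ctx) (phi : c' -> c) := [/\ forall e, cinp (phi e) = cinp e,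
  forall e, cbase (phi e) = cbase e, forall e, cdom e -> cdom (phi e),
  forall e s, crep e s -> crep (phi e) s & clev c <= clev c'].

Lemma comp_map q c' c (f : c -> kty R q) (phi : c' -> c) :
  comp f -> ctxmap phi -> comp (fun e => f (phi e)).
Proof. by move=> cf [h1 h2 h3 h4 h5]; apply: comp_weak cf. Qed.

Lemma poly_map c' c (f : c -> nat) (phi : c' -> c) :
  poly_le f -> ctxmap phi -> poly_le (fun e => f (phi e)).
Proof. by move=> cf [h1 h2 h3 h4 h5]; apply: poly_le_weak cf. Qed.

Lemma comp_var c (n : c -> nat) k (kc : clev c <= k) :
  compN (c := varctx n kc) (fun p => p.2).
Proof. by apply: (@comp_leaf R KNat (varctx n kc) _ (IGet k (INum 0))) => e s /= _ []. Qed.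

Lemma comp_tabvar q c (n : c -> nat) (A : c -> nat -> kty R q) k (kc : clev c <= k) :
  compN (c := tabctx n A kc) (fun p => p.2).
Proof. by apply: (@comp_leaf R KNat (tabctx n A kc) _ (IGet k.+1 (INum 0))) => e s /= _ []. Qed.

Lemma comp_tabget q c (n : c -> nat) (A : c -> nat -> kty R q) k (kc : clev c <= k)
    c' (phi : c' -> tabctx n A kc) (i : c' -> nat) :
  ctxmap phi -> (forall e, cdom e -> i e < (phi e).2) ->
  compN i -> comp (fun e => A (phi e).1 (i e)).
Proof.
move=> [_ _ _ h4 _] ip ci; apply: (comp_let ci) => k' kc'.
apply: (@comp_leaf R q _ _ (kget q k (IGet k' (INum 0)))) => e s /= de [re v].
have [_ sA _] := h4 _ _ re.
by rewrite keval_get /= v sA //; apply: ip.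
Qed.

Lemma comp_arrget q c (n : c -> nat) (A : c -> nat -> kty R q) k (kc : clev c <= k)
    (i : c -> nat) :
  (forall e, cdom e -> i e < n e) ->
  compN (c := arrctx n A kc) i -> comp (c := arrctx n A kc) (fun e => A e (i e)).
Proof.
move=> ip ci; apply: (comp_let ci) => k' kc'.
apply: (@comp_leaf R q _ _ (kget q k (IGet k' (INum 0)))) => e s /= de [[re sA] v].
by rewrite keval_get /= v sA //; apply: ip.
Qed.

Section Basic.
Variable c : ctx.
Implicit Types (f g : c -> nat) (b : c -> bool) (z w : c -> R[i]).

Lemma comp_const (n : nat) : compN (fun _ : c => n).
Proof. by apply: (@comp_leaf R KNat _ _ (INum n)). Qed.

Lemma comp_succ f : compN f -> compN (fun e => (f e).+1).
Proof.
apply: (@comp_op1 R KNat KNat c f _ (fun x => IAdd (INum 1) x)) => e s x de re /= ->.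
by rewrite add1n.
Qed.

Lemma comp_pred f : compN f -> compN (fun e => (f e).-1).
Proof.
apply: (@comp_op1 R KNat KNat c f _ (fun x => ISub x (INum 1))) => e s x de re /= ->.
by rewrite subn1.
Qed.

Lemma comp_addn f g : compN f -> compN g -> compN (fun e => f e + g e).
Proof. by apply: (@comp_op2 R KNat KNat KNat c f g _ IAdd) => e s x y _ /= -> ->. Qed.

Lemma comp_subn f g : compN f -> compN g -> compN (fun e => f e - g e).
Proof. by apply: (@comp_op2 R KNat KNat KNat c f g _ ISub) => e s x y _ /= -> ->. Qed.

Lemma comp_muln f g : compN f -> compN g -> compN (fun e => f e * g e).
Proof. by apply: (@comp_op2 R KNat KNat KNat c f g _ IMul) => e s x y _ /= -> ->. Qed.

Lemma comp_size f : compN f -> compN (fun e => in_size (cinp e) (f e)).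
Proof. by apply: (@comp_op1 R KNat KNat c f _ ISize) => e s x _ _ /= ->. Qed.

Lemma comp_deg f : compN f -> compN (fun e => in_deg (cinp e) (f e)).
Proof. by apply: (@comp_op1 R KNat KNat c f _ IDeg) => e s x _ _ /= ->. Qed.

Lemma comp_site f g : compN f -> compN g -> compN (fun e => in_site (cinp e) (f e) (g e)).
Proof. by apply: (@comp_op2 R KNat KNat KNat c f g _ ISite) => e s x y _ /= -> ->. Qed.

Lemma comp_nbr f g : compN f -> compN g -> compN (fun e => in_nbr (cinp e) (f e) (g e)).
Proof. by apply: (@comp_op2 R KNat KNat KNat c f g _ INbr) => e s x y _ /= -> ->. Qed.

Lemma comp_leq f g : compN f -> compN g -> compB (fun e => f e <= g e).
Proof.
apply: (@comp_op2 R KNat KNat KNat c f g _ (fun x y => ISub (INum 1) (ISub x y))).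
by move=> e s x y _ /= -> ->; rewrite -[f e <= g e]subn_eq0; case: (f e - g e) => [|n].
Qed.

Lemma comp_eqn f g : compN f -> compN g -> compB (fun e => f e == g e).
Proof.
apply: (@comp_op2 R KNat KNat KNat c f g _
  (fun x y => ISub (INum 1) (IAdd (ISub x y) (ISub y x)))).
move=> e s x y _ /= -> ->; rewrite eqn_leq -!subn_eq0.
by case: (f e - g e) => [|n]; case: (g e - f e).
Qed.

Lemma comp_andb b (b' : c -> bool) : compB b -> compB b' -> compB (fun e => b e && b' e).
Proof.
apply: (@comp_op2 R KNat KNat KNat c _ _ _ IMul) => e s x y _ /= -> ->.
by case: (b e); case: (b' e).
Qed.

Lemma comp_negb b : compB b -> compB (fun e => ~~ b e).
Proof.
apply: (@comp_op1 R KNat KNat c _ _ (fun x => ISub (INum 1) x)) => e s x _ _ /= ->.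
by case: (b e).
Qed.

Lemma comp_orb b (b' : c -> bool) : compB b -> compB b' -> compB (fun e => b e || b' e).
Proof.
move=> /comp_negb h /comp_negb h'; apply: comp_eq (comp_negb (comp_andb h h')) => e _.
by case: (b e); case: (b' e).
Qed.

Lemma comp_iteT q b (f g : c -> kty R q) :
  compB b -> comp f -> comp g -> comp (fun e => if b e then f e else g e).
Proof.
by move=> cb cf cg; apply: comp_if => //; [apply: (comp_map cf)|apply: (comp_map cg)]; solve_ctxmap.
Qed.

Lemma comp_natC f : compN f -> compC (fun e => (f e)%:R%R).
Proof. by apply: (@comp_op1 R KNat KCpx c f _ CNat) => e s x _ _ /= ->. Qed.

Lemma comp_imag : compC (fun _ : c => 'i%C).
Proof. by apply: (@comp_leaf R KCpx c _ CI). Qed.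

Lemma comp_subC z w : compC z -> compC w -> compC (fun e => z e - w e)%R.
Proof. by apply: (@comp_op2 R KCpx KCpx KCpx c z w _ CSub) => e s x y _ /= -> ->. Qed.

Lemma comp_mulC z w : compC z -> compC w -> compC (fun e => z e * w e)%R.
Proof. by apply: (@comp_op2 R KCpx KCpx KCpx c z w _ CMul) => e s x y _ /= -> ->. Qed.

Lemma comp_divC z w : compC z -> compC w -> compC (fun e => z e / w e)%R.
Proof. by apply: (@comp_op2 R KCpx KCpx KCpx c z w _ CDiv) => e s x y _ /= -> ->. Qed.

Lemma comp_coef f : compN f -> compC (fun e => (in_coef (cinp e) (f e))%:C%C).
Proof. by apply: (@comp_op1 R KNat KCpx c f _ CCoef) => e s x _ _ /= ->. Qed.

Lemma comp_time : compC (fun e : c => in_time (cinp e)).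
Proof. by apply: (@comp_leaf R KCpx c _ CTime). Qed.

End Basic.

Lemma comp_op3 c (op : input R -> nat -> nat -> nat -> R[i]) (E : iexp -> iexp -> iexp -> cexpr)
    (f1 f2 f3 : c -> nat) :
  (forall inp s x y t, ceval inp s (E x y t) = op inp (ieval inp s x) (ieval inp s y) (ieval inp s t)) ->
  compN f1 -> compN f2 -> compN f3 -> compC (fun e => op (cinp e) (f1 e) (f2 e) (f3 e)).
Proof.
move=> h c1 c2 c3; apply: (comp_let c1) => k1 kc1.
have c2' : compN (c := valctx (q := KNat) f1 kc1) f2 by apply: comp_valctx_weak.
have c3' : compN (c := valctx (q := KNat) f1 kc1) f3 by apply: comp_valctx_weak.
refine (@comp_let R KNat KCpx (valctx (q := KNat) f1 kc1) f2 _ c2' _) => k2 kc2.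
have c3'' : compN (c := valctx (c := valctx (q := KNat) f1 kc1) (q := KNat) f2 kc2) f3.
  exact: comp_valctx_weak.
refine (@comp_let R KNat KCpx (valctx (c := valctx (q := KNat) f1 kc1) (q := KNat) f2 kc2) f3 _ c3'' _) => k3 kc3.
apply: (@comp_leaf R KCpx _ _ (E (IGet k1 (INum 0)) (IGet k2 (INum 0)) (IGet k3 (INum 0)))).
by move=> e s /= _ [[[_ v1] v2] v3]; rewrite h /= v1 v2 v3.
Qed.

Lemma comp_term c (f1 f2 f3 : c -> nat) : compN f1 -> compN f2 -> compN f3 ->
  compC (fun e => in_term (cinp e) (f1 e) (f2 e) (f3 e)).
Proof. exact: (@comp_op3 c (@in_term R) CTerm). Qed.

Lemma comp_state c (f1 f2 f3 : c -> nat) : compN f1 -> compN f2 -> compN f3 ->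
  compC (fun e => in_state (cinp e) (f1 e) (f2 e) (f3 e)).
Proof. exact: (@comp_op3 c (@in_state R) CState). Qed.

Lemma comp_sumN c (n : c -> nat) (F : c -> nat -> nat) : compN n -> poly_le n ->
  (forall k (kc : clev c <= k), compN (c := varctx n kc) (fun p => F p.1 p.2)) ->
  compN (fun e => \sum_(0 <= i < n e) F e i).
Proof. exact: (@comp_big R c KNat 0%N addn (INum 0) IAdd). Qed.

Lemma comp_prodN c (n : c -> nat) (F : c -> nat -> nat) : compN n -> poly_le n ->
  (forall k (kc : clev c <= k), compN (c := varctx n kc) (fun p => F p.1 p.2)) ->
  compN (fun e => \prod_(0 <= i < n e) F e i).
Proof. exact: (@comp_big R c KNat 1%N muln (INum 1) IMul). Qed.

Lemma comp_sumC c (n : c -> nat) (F : c -> nat -> R[i]) : compN n -> poly_le n ->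
  (forall k (kc : clev c <= k), compC (c := varctx n kc) (fun p => F p.1 p.2)) ->
  compC (fun e => \sum_(0 <= i < n e) F e i)%R.
Proof. exact: (@comp_big R c KCpx 0%R +%R (CNat (INum 0)) CAdd). Qed.

Lemma comp_prodC c (n : c -> nat) (F : c -> nat -> R[i]) : compN n -> poly_le n ->
  (forall k (kc : clev c <= k), compC (c := varctx n kc) (fun p => F p.1 p.2)) ->
  compC (fun e => \prod_(0 <= i < n e) F e i)%R.
Proof. exact: (@comp_big R c KCpx 1%R *%R (CNat (INum 1)) CMul). Qed.

Lemma comp_alln c (n : c -> nat) (P : c -> nat -> bool) : compN n -> poly_le n ->
  (forall k (kc : clev c <= k), compB (c := varctx n kc) (fun p => P p.1 p.2)) ->
  compB (fun e => alln (n e) (P e)).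
Proof.
move=> cn bn cP.
have h : compN (fun e => \prod_(0 <= i < n e) nat_of_bool (P e i)) by apply: comp_prodN.
apply: comp_eq h => e _; rewrite /alln /index_iota subn0; elim: (iota 0 (n e)) => [|i s IH].
  by rewrite big_nil.
by rewrite big_cons IH /=; case: (P e i); rewrite ?mul0n ?mul1n.
Qed.

Lemma comp_hasn c (n : c -> nat) (P : c -> nat -> bool) : compN n -> poly_le n ->
  (forall k (kc : clev c <= k), compB (c := varctx n kc) (fun p => P p.1 p.2)) ->
  compB (fun e => hasn (n e) (P e)).
Proof.
move=> cn bn cP.
have h : compB (fun e => ~~ alln (n e) (fun i => ~~ P e i)).
  by apply: comp_negb; apply: comp_alln => // k kc; apply: comp_negb.
apply: comp_eq h => e _; congr nat_of_bool.
by rewrite /alln all_predC negbK.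
Qed.

Section PolyBounds.
Variable c : ctx.
Implicit Types (f g : c -> nat).

Lemma poly_le_mono f g : (forall e, cdom e -> f e <= g e) -> poly_le g -> poly_le f.
Proof. by move=> fg [K [n h]]; exists K, n => e de; apply: leq_trans (fg e de) (h e de). Qed.

Lemma poly_const (n : nat) : poly_le (fun _ : c => n).
Proof. by exists n, 0%N => e _; rewrite expn0 muln1. Qed.

Lemma poly_addn f g : poly_le f -> poly_le g -> poly_le (fun e => f e + g e).
Proof.
move=> [K1 [n1 h1]] [K2 [n2 h2]]; exists (K1 + K2 + 0), (n1 + n2) => e de.
by rewrite -[f e + g e]addn0; apply: cost_add; [apply: h1 | apply: h2].
Qed.

Lemma poly_muln f g : poly_le f -> poly_le g -> poly_le (fun e => f e * g e).
Proof.
move=> [K1 [n1 h1]] [K2 [n2 h2]]; exists (K1 * K2), (n1 + n2) => e de.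
by rewrite expnD mulnACA; apply: leq_mul; [apply: h1 | apply: h2].
Qed.

Lemma poly_succ f : poly_le f -> poly_le (fun e => (f e).+1).
Proof.
move=> pf; apply: poly_le_mono (poly_addn pf (poly_const 1)) => e _.
by rewrite addn1.
Qed.

(** Such f is at most logarithmic in the base, which makes every n ^ f polynomially bounded; the
    order of truncation and the lengths of walks are of this kind. *)
Definition explin f := poly_le (fun e => 2 ^ f e).

Lemma explin_poly f : explin f -> poly_le f.
Proof. by apply: poly_le_mono => e _; rewrite ltnW // ltn_expl. Qed.

Lemma explin_mono f g : (forall e, cdom e -> f e <= g e) -> explin g -> explin f.
Proof. by move=> fg; apply: poly_le_mono => e de; rewrite leq_pexp2l // fg. Qed.

Lemma explin_const n : explin (fun _ => n).
Proof. exact: poly_const. Qed.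

Lemma explin_addn f g : explin f -> explin g -> explin (fun e => f e + g e).
Proof.
move=> ef eg; apply: poly_le_mono (poly_muln ef eg) => e _.
by rewrite expnD.
Qed.

Lemma explin_mulc n f : explin f -> explin (fun e => n * f e).
Proof.
move=> ef; elim: n => [|n IH]; first exact: explin_const 0%N.
by apply: explin_mono (explin_addn ef IH) => e _; rewrite mulSn.
Qed.

Lemma poly_expn n f : explin f -> poly_le (fun e => n ^ f e).
Proof.
move=> /(explin_mulc n); apply: poly_le_mono => e _.
by rewrite expnM; have [->|f0] := posnP (f e); rewrite ?expn0 // leq_exp2r // ltnW // ltn_expl.
Qed.

Definition pN f := compN f /\ poly_le f.
Definition eN f := compN f /\ explin f.

Lemma pN_comp f : pN f -> compN f. Proof. by case. Qed.
Lemma pN_poly f : pN f -> poly_le f. Proof. by case. Qed.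

Lemma eN_pN f : eN f -> pN f.
Proof. by case=> cf /explin_poly. Qed.

Lemma pN_const (n : nat) : pN (fun _ => n).
Proof. by split; [apply: comp_const | apply: poly_const]. Qed.

Lemma pN_addn f g : pN f -> pN g -> pN (fun e => f e + g e).
Proof. by move=> [? ?] [? ?]; split; [apply: comp_addn | apply: poly_addn]. Qed.

Lemma pN_muln f g : pN f -> pN g -> pN (fun e => f e * g e).
Proof. by move=> [? ?] [? ?]; split; [apply: comp_muln | apply: poly_muln]. Qed.

Lemma pN_succ f : pN f -> pN (fun e => (f e).+1).
Proof. by move=> [? ?]; split; [apply: comp_succ | apply: poly_succ]. Qed.

Lemma pN_pred f : pN f -> pN (fun e => (f e).-1).
Proof.
move=> [? h]; split; first exact: comp_pred.
by apply: poly_le_mono h => e _; apply: leq_pred.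
Qed.

Lemma eN_succ f : eN f -> eN (fun e => (f e).+1).
Proof.
move=> [? h]; split; first exact: comp_succ.
by apply: explin_mono (explin_addn h (explin_const 1)) => e _; rewrite addn1.
Qed.

Lemma eN_mulc n f : eN f -> eN (fun e => n * f e).
Proof.
move=> [? ?]; split; last exact: explin_mulc.
by apply: comp_muln => //; apply: comp_const.
Qed.

Lemma eN_mulrc n f : eN f -> eN (fun e => f e * n).
Proof.
move=> [? h]; split; first by apply: comp_muln => //; apply: comp_const.
by apply: explin_mono (explin_mulc n h) => e _; rewrite mulnC.
Qed.

Lemma eN_powM b f : compN f -> poly_le f -> compN (fun e => b ^ f e).
Proof.
move=> cf bf; have h : compN (fun e => \prod_(0 <= i < f e) b).
  by apply: comp_prodN => // k kc; apply: comp_const.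
by apply: comp_eq h => e _; rewrite prod_nat_const_nat subn0.
Qed.

Lemma pN_expn b f : eN f -> pN (fun e => b ^ f e).
Proof.
move=> [cf ef]; split; last exact: poly_expn.
by apply: eN_powM => //; apply: explin_poly.
Qed.

(** The machine can only add, subtract and multiply natural numbers, so a quotient is found by
    counting multiples. *)
Lemma divn_count a b : 0 < b -> a %/ b = \sum_(0 <= i < a) (i.+1 * b <= a).
Proof.
move=> b0; have -> : \sum_(0 <= i < a) (i.+1 * b <= a) = \sum_(0 <= i < a | i < a %/ b) 1.
  by rewrite [RHS]big_mkcond; apply: eq_bigr => i _; rewrite leq_divRL //; case: leq.
have := @big_nat_widen _ 0%N addn 0 (a %/ b) a predT (fun _ => 1) (leq_div _ _).
by move=> h; rewrite -[LHS]muln1 -[a %/ b in LHS]subn0 -sum_nat_const_nat h; apply: eq_bigl => i.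
Qed.

Lemma pN_divn f g : pN f -> compN g -> pN (fun e => f e %/ g e).
Proof.
move=> [cf pf] cg; split; last first.
  by apply: poly_le_mono pf => e _; apply: leq_div.
(* The first factor makes the count agree with the convention that a quotient by 0 is 0. *)
have h : compN (fun e => (0 < g e) * \sum_(0 <= i < f e) (i.+1 * g e <= f e)).
  apply: comp_muln; first by apply: comp_leq => //; apply: comp_const.
  apply: comp_sumN => // k kc; apply: comp_leq.
    apply: comp_muln; first by apply: comp_succ; apply: comp_var.
    by apply: (comp_map cg); solve_ctxmap.
  by apply: (comp_map cf); solve_ctxmap.
apply: comp_eq h => e _; have [->|g0] := posnP (g e); first by rewrite divn0.
by rewrite mul1n -divn_count.
Qed.

Lemma pN_modn f g : pN f -> compN g -> pN (fun e => f e %% g e).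
Proof.
move=> pf cg; have [cd _] := pN_divn pf cg; case: pf => cf pf; split; last first.
  by apply: poly_le_mono pf => e _; apply: leq_mod.
have h := comp_subn cf (comp_muln cd cg).
by apply: comp_eq h => e _; rewrite {1}(divn_eq (f e) (g e)) addnC addnK.
Qed.

End PolyBounds.

Lemma pN_map c' c (f : c -> nat) (phi : c' -> c) :
  pN f -> ctxmap phi -> pN (fun e => f (phi e)).
Proof. by move=> [? ?] ?; split; [apply: comp_map | apply: poly_map]. Qed.

Lemma eN_map c' c (f : c -> nat) (phi : c' -> c) :
  eN f -> ctxmap phi -> eN (fun e => f (phi e)).
Proof.
move=> [? h] m; split; first exact: comp_map.
exact: (poly_map h m).
Qed.

Lemma pN_var c (n : c -> nat) k (kc : clev c <= k) : poly_le n ->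
  pN (c := varctx n kc) (fun p => p.2).
Proof.
move=> pn; split; first exact: comp_var.
have h : poly_le (c := varctx n kc) (fun p => n p.1) by apply: (poly_map pn); solve_ctxmap.
by apply: poly_le_mono h => p [_ /ltnW].
Qed.

Lemma pN_tabvar q c (n : c -> nat) (A : c -> nat -> kty R q) k (kc : clev c <= k) : poly_le n ->
  pN (c := tabctx n A kc) (fun p => p.2).
Proof.
move=> pn; split; first exact: comp_tabvar.
have h : poly_le (c := tabctx n A kc) (fun p => n p.1) by apply: (poly_map pn); solve_ctxmap.
by apply: poly_le_mono h => p [_ /ltnW].
Qed.

(** Recursion by dynamic programming: every entry up to [i e] is computed once. *)
Lemma comp_rec q c (i : c -> nat) (A : c -> nat -> kty R q) : pN i ->
  (forall k (kc : clev c <= k), comp (c := tabctx (fun e => (i e).+1) A kc) (fun p => A p.1 p.2)) ->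
  comp (fun e => A e (i e)).
Proof.
move=> pi cA; have [cn pn] := pN_succ pi; apply: (comp_tab cn pn cA) => k kc.
apply: comp_arrget; first by [].
by apply: (comp_map (pN_comp pi)); solve_ctxmap.
Qed.

End Rules.

(** * The algorithm *)

Definition dig (b l a : nat) := a %/ b ^ l %% b.

Section Algorithm.
Variables (R : realType) (k d D : nat) (inp : input R).

Definition step (y j : nat) := if j < in_deg inp y then in_nbr inp y j else y.

(* The digits of w in base D.+1 are the moves of a walk started at r; a digit that is not a position
   in the list of neighbours makes the walk stay. *)
Fixpoint walk (r w i : nat) := if i is i'.+1 then step (walk r w i') (dig D.+1 i' w) else r.

Definition covers (r L w w' : nat) :=
  alln L.+1 (fun i => hasn L.+1 (fun j => walk r w' j == walk r w i)).

Definition fresh (r L w : nat) :=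
  alln w (fun w' => ~~ (covers r L w w' && covers r L w' w)).

Definition minr (r L w : nat) := alln L.+1 (fun i => r <= walk r w i).

Definition first_at (r w i : nat) := alln i (fun j => walk r w j != walk r w i).

Definition bit (q j : nat) := dig 2 j q == 1.

(* Bits are allowed at first visits only, so that the masks of a walk correspond to the subsets of
   the visited set. *)
Definition mask_ok (r L w q : nat) := alln L.+1 (fun i => first_at r w i || ~~ bit q i).

Definition mask_sgn (r L w q : nat) : R[i] :=
  (\prod_(0 <= i < L.+1) if first_at r w i && ~~ bit q i then 0%:R - 1%:R else 1%:R)%R.

(* The slot x = k * j + i stands for the i-th site of the j-th subsystem of the walk. A configuration
   is encoded by its digits in the first slot of each site, all other digits being 0. *)
Definition slot_used (r w x : nat) := x %% k < in_size inp (walk r w (x %/ k)).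

Definition slot_site (r w x : nat) := in_site inp (walk r w (x %/ k)) (x %% k).

Definition slot_first (r w x : nat) :=
  slot_used r w x &&
  alln x (fun y => ~~ (slot_used r w y && (slot_site r w y == slot_site r w x))).

Definition slots (L : nat) := L.+1 * k.

Definition code_ok (r L w a : nat) :=
  alln (slots L) (fun x => slot_first r w x || (dig d x a == 0)).

Definition site_dig (r L w v a : nat) :=
  \sum_(0 <= x < slots L) if slot_first r w x && (slot_site r w x == v) then dig d x a else 0.

Definition term_code (r L w j a : nat) :=
  \sum_(0 <= i < k) if i < in_size inp (walk r w j)
    then site_dig r L w (in_site inp (walk r w j) i) a * d ^ i else 0.

Definition term_has (r w j v : nat) :=
  hasn k (fun i => (i < in_size inp (walk r w j)) && (in_site inp (walk r w j) i == v)).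

Definition term_agree (r L w j a b : nat) :=
  alln (slots L) (fun x =>
    (~~ slot_first r w x || term_has r w j (slot_site r w x)) || (dig d x a == dig d x b)).

Definition ham_entry (r L w q a b : nat) : R[i] :=
  (\sum_(0 <= j < L.+1) if bit q j && term_agree r L w j a b
    then (in_coef inp (walk r w j))%:C%C *
         in_term inp (walk r w j) (term_code r L w j a) (term_code r L w j b) else 0%:R)%R.

Fixpoint pow_entry (r L w q m a b : nat) : R[i] :=
  if m is m'.+1 then
    (\sum_(0 <= c < d ^ slots L) if code_ok r L w c
       then ham_entry r L w q a c * pow_entry r L w q m' c b else 0%:R)%R
  else (nat_of_bool (a == b))%:R%R.

Definition state_entry (r L w a b : nat) : R[i] :=
  (\prod_(0 <= x < slots L) if slot_first r w x
     then in_state inp (slot_site r w x) (dig d x a) (dig d x b) else 1%:R)%R.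

Definition moment (r L w q m : nat) : R[i] :=
  (\sum_(0 <= a < d ^ slots L) \sum_(0 <= b < d ^ slots L)
     if code_ok r L w a && code_ok r L w b
     then pow_entry r L w q m a b * state_entry r L w b a else 0%:R)%R.

Definition moment_coef (r L w q m : nat) : R[i] :=
  ((\prod_(0 <= j < m) (0%:R - 'i%C)) / (\prod_(0 <= j < m) j.+1)%:R * moment r L w q m)%R.

Definition log_val (r L M w q : nat) : R[i] :=
  (\sum_(0 <= m < M.+1) logc (moment_coef r L w q) m * \prod_(0 <= j < m) in_time inp)%R.

Definition cluster_val (r L M w : nat) : R[i] :=
  (\sum_(0 <= q < 2 ^ L.+1) if mask_ok r L w q
     then mask_sgn r L w q * log_val r L M w q else 0%:R)%R.

(* Walks of length 2 M visit every connected set of at most M subsystems. Each visited set is taken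
   once, for the first walk that visits it and is started at its smallest element. *)
Definition root_val (r M : nat) : R[i] :=
  (\sum_(0 <= w < D.+1 ^ (2 * M)) if fresh r (2 * M) w && minr r (2 * M) w
     then cluster_val r (2 * M) M w else 0%:R)%R.

End Algorithm.

(** * The functions of the algorithm are computable *)

Section Computable.
Variable R : realType.
Variables (k d D : nat).
Local Notation ctx := (ctx R).
Implicit Types (c : ctx).
Local Notation compN := (@comp R KNat _).
Local Notation compC := (@comp R KCpx _).

Lemma comp_sumN' c (n : c -> nat) (F : c -> nat -> nat) : pN n ->
  (forall k (kc : clev c <= k), pN (c := varctx n kc) (fun p => p.2) ->
     compN (fun p : varctx n kc => F p.1 p.2)) ->
  compN (fun e => \sum_(0 <= i < n e) F e i).
Proof. by move=> [? pn] h; apply: comp_sumN => // k0 kc; apply: h; apply: pN_var. Qed.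

Lemma comp_sumC' c (n : c -> nat) (F : c -> nat -> R[i]) : pN n ->
  (forall k (kc : clev c <= k), pN (c := varctx n kc) (fun p => p.2) ->
     compC (fun p : varctx n kc => F p.1 p.2)) ->
  compC (fun e => \sum_(0 <= i < n e) F e i)%R.
Proof. by move=> [? pn] h; apply: comp_sumC => // k0 kc; apply: h; apply: pN_var. Qed.

Lemma comp_prodN' c (n : c -> nat) (F : c -> nat -> nat) : pN n ->
  (forall k (kc : clev c <= k), pN (c := varctx n kc) (fun p => p.2) ->
     compN (fun p : varctx n kc => F p.1 p.2)) ->
  compN (fun e => \prod_(0 <= i < n e) F e i).
Proof. by move=> [? pn] h; apply: comp_prodN => // k0 kc; apply: h; apply: pN_var. Qed.

Lemma comp_prodC' c (n : c -> nat) (F : c -> nat -> R[i]) : pN n ->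
  (forall k (kc : clev c <= k), pN (c := varctx n kc) (fun p => p.2) ->
     compC (fun p : varctx n kc => F p.1 p.2)) ->
  compC (fun e => \prod_(0 <= i < n e) F e i)%R.
Proof. by move=> [? pn] h; apply: comp_prodC => // k0 kc; apply: h; apply: pN_var. Qed.

Lemma comp_alln' c (n : c -> nat) (P : c -> nat -> bool) : pN n ->
  (forall k (kc : clev c <= k), pN (c := varctx n kc) (fun p => p.2) ->
     compB (fun p : varctx n kc => P p.1 p.2)) ->
  compB (fun e => alln (n e) (P e)).
Proof. by move=> [? pn] h; apply: comp_alln => // k0 kc; apply: h; apply: pN_var. Qed.

Lemma comp_hasn' c (n : c -> nat) (P : c -> nat -> bool) : pN n ->
  (forall k (kc : clev c <= k), pN (c := varctx n kc) (fun p => p.2) ->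
     compB (fun p : varctx n kc => P p.1 p.2)) ->
  compB (fun e => hasn (n e) (P e)).
Proof. by move=> [? pn] h; apply: comp_hasn => // k0 kc; apply: h; apply: pN_var. Qed.

Ltac hyp_leaf := solve [assumption | match goal with
  | H : @eN _ ?c ?f |- @eN _ ?c' _ => refine (@eN_map R c' c f _ H _); solve_ctxmap
  | H : @pN _ ?c ?f |- @pN _ ?c' _ => refine (@pN_map R c' c f _ H _); solve_ctxmap
  | H : @comp _ ?q ?c ?f |- @comp _ ?q ?c' _ => refine (@comp_map R q c' c f _ H _); solve_ctxmap
  | H : @compB _ ?c ?f |- @compB _ ?c' _ => refine (@comp_map R KNat c' c _ _ H _); solve_ctxmap
  end].

(* Redefined below whenever a new function has been shown to be computable. *)
Ltac cuser := fail.

Ltac cstep := cbv beta; first [hyp_leaf | cuser | lazymatch goal with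
  | |- @eN _ ?c (fun e => S (@?f e)) => apply (@eN_succ R c f)
  | |- @eN _ ?c (fun e => muln _ _) => first [apply: (@eN_mulc R c) | apply: (@eN_mulrc R c)]
  | |- @pN _ ?c (fun e => addn (@?f e) (@?g e)) => apply (@pN_addn R c f g)
  | |- @pN _ ?c (fun e => expn _ _) => apply: (@pN_expn R c)
  | |- @pN _ ?c (fun e => S (@?f e)) => apply (@pN_succ R c f)
  | |- @pN _ ?c (fun e => predn (@?f e)) => apply (@pN_pred R c f)
  | |- @pN _ ?c (fun e => divn (@?f e) (@?g e)) => apply (@pN_divn R c f g)
  | |- @pN _ ?c (fun e => modn (@?f e) (@?g e)) => apply (@pN_modn R c f g)
  | |- @pN _ ?c (fun e => muln (@?f e) (@?g e)) => apply (@pN_muln R c f g)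
  | |- @pN _ ?c _ => first [apply (@pN_const R c) | apply (@eN_pN R c)]
  | |- @comp _ KNat ?c (fun e => nat_of_bool (@?b e)) => change (@compB R c b)
  | |- @compB _ ?c (fun e => leq (@?f e) (@?g e)) => apply (@comp_leq R c f g)
  | |- @compB _ ?c (fun e => eq_op (@?f e) (@?g e)) => apply (@comp_eqn R c f g)
  | |- @compB _ ?c (fun e => andb (@?f e) (@?g e)) => apply (@comp_andb R c f g)
  | |- @compB _ ?c (fun e => orb (@?f e) (@?g e)) => apply (@comp_orb R c f g)
  | |- @compB _ ?c (fun e => negb (@?f e)) => apply (@comp_negb R c f)
  | |- @compB _ ?c (fun e => alln (@?n e) (@?P e)) => apply (@comp_alln' c n P); [|do 3 intro]
  | |- @compB _ ?c (fun e => hasn (@?n e) (@?P e)) => apply (@comp_hasn' c n P); [|do 3 intro]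
  | |- @comp _ ?q ?c (fun e => if _ then _ else _) => apply: (@comp_iteT R c q)
  | |- @comp _ KNat ?c (fun e => in_size (cinp _) (@?f e)) => apply (@comp_size R c f)
  | |- @comp _ KNat ?c (fun e => in_deg (cinp _) (@?f e)) => apply (@comp_deg R c f)
  | |- @comp _ KNat ?c (fun e => in_site (cinp _) (@?f e) (@?g e)) => apply (@comp_site R c f g)
  | |- @comp _ KNat ?c (fun e => in_nbr (cinp _) (@?f e) (@?g e)) => apply (@comp_nbr R c f g)
  | |- @comp _ KCpx ?c (fun e => real_complex_def _ (in_coef (cinp _) (@?f e))) => apply (@comp_coef R c f)
  | |- @comp _ KCpx ?c (fun e => in_term (cinp _) (@?f e) (@?g e) (@?h e)) =>
      apply (@comp_term R c f g h)
  | |- @comp _ KCpx ?c (fun e => in_state (cinp _) (@?f e) (@?g e) (@?h e)) =>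
      apply (@comp_state R c f g h)
  | |- @comp _ KCpx ?c (fun e => in_time (cinp _)) => apply (@comp_time R c)
  | |- @comp _ KCpx ?c (fun e => GRing.natmul 1%R (@?f e)) => apply (@comp_natC R c f)
  | |- @comp _ KCpx ?c (fun e => GRing.mul (@?f e) (GRing.inv (@?g e))) => apply (@comp_divC R c f g)
  | |- @comp _ KCpx ?c (fun e => GRing.mul (@?f e) (@?g e)) => apply (@comp_mulC R c f g)
  | |- @comp _ KCpx ?c (fun e => GRing.add (@?f e) (GRing.opp (@?g e))) => apply (@comp_subC R c f g)
  | |- @comp _ KCpx ?c (fun e => 'i%C) => apply (@comp_imag R c)
  | |- @comp _ KNat ?c (fun e => bigop 0%N (index_iota 0 (@?n e)) (fun i => BigBody i addn true (@?F e i))) =>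
      apply (@comp_sumN' c n F); [|do 3 intro]
  | |- @comp _ KNat ?c (fun e => bigop 1%N (index_iota 0 (@?n e)) (fun i => BigBody i muln true (@?F e i))) =>
      apply (@comp_prodN' c n F); [|do 3 intro]
  | |- @comp _ KCpx ?c (fun e => bigop 0%R (index_iota 0 (@?n e)) (fun i => BigBody i +%R true (@?F e i))) =>
      apply (@comp_sumC' c n F); [|do 3 intro]
  | |- @comp _ KCpx ?c (fun e => bigop 1%R (index_iota 0 (@?n e)) (fun i => BigBody i *%R true (@?F e i))) =>
      apply (@comp_prodC' c n F); [|do 3 intro]
  | |- @comp _ KNat ?c (fun e => S (@?f e)) => apply (@comp_succ R c f)
  | |- @comp _ KNat ?c (fun e => addn (@?f e) (@?g e)) => apply (@comp_addn R c f g)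
  | |- @comp _ KNat ?c (fun e => muln (@?f e) (@?g e)) => apply (@comp_muln R c f g)
  | |- @comp _ KNat ?c (fun e => expn _ _) => apply: (@eN_powM R c); [|apply pN_poly]
  | |- @comp _ KNat ?c _ => first [apply (@comp_const R c) | apply (@pN_comp R c)]
  end].

Ltac cauto := repeat cstep.

Lemma pN_dig c b (l a : c -> nat) : pN l -> pN a -> pN (fun e => dig b (l e) (a e)).
Proof. by move=> hl ha; rewrite /dig; cauto. Qed.

Ltac cuser ::= first [apply: pN_dig].

Lemma comp_bit c (q j : c -> nat) : pN q -> pN j -> compB (fun e => bit (q e) (j e)).
Proof. by move=> hq hj; rewrite /bit; cauto. Qed.

Lemma comp_walk c (r w i : c -> nat) : compN r -> pN w -> pN i ->
  compN (fun e => walk D (cinp e) (r e) (w e) (i e)).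
Proof.
move=> hr hw hi; apply: (@comp_rec R KNat c i (fun e => walk D (cinp e) (r e) (w e)) hi) => l lc.
set c1 := tabctx _ _ _.
have h2 : pN (c := c1) (fun p => p.2) by apply: pN_tabvar; apply: poly_succ; case: hi.
have h : compN (fun p : c1 => if p.2 == 0 then r p.1 else
    step (cinp p.1) (walk D (cinp p.1) (r p.1) (w p.1) p.2.-1) (dig D.+1 p.2.-1 (w p.1))).
  apply: comp_if; [by cauto|by cauto|].
  set c2 := domctx _.
  have hY : compN (fun p : c2 => walk D (cinp p.1) (r p.1) (w p.1) p.2.-1).
    refine (@comp_tabget R KNat c (fun e => (i e).+1) (fun e => walk D (cinp e) (r e) (w e)) l lc c2 (fun p => p) (fun p => p.2.-1) _ _ _).
    - by solve_ctxmap.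
    - by move=> p [_] /=; rewrite -lt0n ltn_predL.
    - by cauto.
  rewrite /step; cauto.
by apply: comp_eq h => -[e [|j]] _.
Qed.

Ltac cuser ::= first [apply: comp_walk | apply: comp_bit | apply: pN_dig].

Section Functions.
Variables (c : ctx) (r M L w : c -> nat).
Hypotheses (hr : compN r) (hM : eN M) (hL : eN L) (hw : pN w).

Lemma comp_covers (w' : c -> nat) : pN w' ->
  compB (fun e => covers D (cinp e) (r e) (L e) (w e) (w' e)).
Proof. by move=> hw'; rewrite /covers; cauto. Qed.

Lemma comp_minr : compB (fun e => minr D (cinp e) (r e) (L e) (w e)).
Proof. by rewrite /minr; cauto. Qed.

Lemma comp_first_at (i : c -> nat) : pN i ->
  compB (fun e => first_at D (cinp e) (r e) (w e) (i e)).
Proof. by move=> hi; rewrite /first_at; cauto. Qed.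

Lemma comp_slot_used (x : c -> nat) : pN x ->
  compB (fun e => slot_used k D (cinp e) (r e) (w e) (x e)).
Proof. by move=> hx; rewrite /slot_used; cauto. Qed.

Lemma comp_slot_site (x : c -> nat) : pN x ->
  compN (fun e => slot_site k D (cinp e) (r e) (w e) (x e)).
Proof. by move=> hx; rewrite /slot_site; cauto. Qed.

Lemma comp_term_has (j v : c -> nat) : pN j -> compN v ->
  compB (fun e => term_has k D (cinp e) (r e) (w e) (j e) (v e)).
Proof. by move=> hj hv; rewrite /term_has; cauto. Qed.

End Functions.

Ltac cuser ::= first [apply: comp_walk | apply: comp_bit | apply: pN_dig | apply: comp_covers
  | apply: comp_minr | apply: comp_first_at | apply: comp_slot_used | apply: comp_slot_site
  | apply: comp_term_has].

Section Functions2.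
Variables (c : ctx) (r M L w : c -> nat).
Hypotheses (hr : compN r) (hM : eN M) (hL : eN L) (hw : pN w).

Lemma comp_fresh : compB (fun e => fresh D (cinp e) (r e) (L e) (w e)).
Proof. by rewrite /fresh; cauto. Qed.

Lemma comp_mask_ok (q : c -> nat) : pN q ->
  compB (fun e => mask_ok D (cinp e) (r e) (L e) (w e) (q e)).
Proof. by move=> hq; rewrite /mask_ok; cauto. Qed.

Lemma comp_mask_sgn (q : c -> nat) : pN q ->
  compC (fun e => mask_sgn D (cinp e) (r e) (L e) (w e) (q e)).
Proof. by move=> hq; rewrite /mask_sgn; cauto. Qed.

Lemma comp_slot_first (x : c -> nat) : pN x ->
  compB (fun e => slot_first k D (cinp e) (r e) (w e) (x e)).
Proof. by move=> hx; rewrite /slot_first; cauto. Qed.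

Lemma eN_slots : eN (fun e => slots k (L e)).
Proof. by rewrite /slots; cauto. Qed.

End Functions2.

Ltac cuser ::= first [apply: comp_walk | apply: comp_bit | apply: pN_dig | apply: comp_covers
  | apply: comp_minr | apply: comp_first_at | apply: comp_slot_used | apply: comp_slot_site
  | apply: comp_term_has | apply: comp_fresh | apply: comp_mask_ok | apply: comp_mask_sgn
  | apply: comp_slot_first | apply: eN_slots].

Section Functions3.
Variables (c : ctx) (r M L w : c -> nat).
Hypotheses (hr : compN r) (hM : eN M) (hL : eN L) (hw : pN w).

Lemma comp_code_ok (a : c -> nat) : pN a ->
  compB (fun e => code_ok k d D (cinp e) (r e) (L e) (w e) (a e)).
Proof. by move=> ha; rewrite /code_ok; cauto. Qed.

Lemma comp_site_dig (v a : c -> nat) : compN v -> pN a ->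
  compN (fun e => site_dig k d D (cinp e) (r e) (L e) (w e) (v e) (a e)).
Proof. by move=> hv ha; rewrite /site_dig; cauto. Qed.

Lemma comp_state_entry (a b : c -> nat) : pN a -> pN b ->
  compC (fun e => state_entry k d D (cinp e) (r e) (L e) (w e) (a e) (b e)).
Proof. by move=> ha hb; rewrite /state_entry; cauto. Qed.

Lemma comp_term_agree (j a b : c -> nat) : pN j -> pN a -> pN b ->
  compB (fun e => term_agree k d D (cinp e) (r e) (L e) (w e) (j e) (a e) (b e)).
Proof. by move=> hj ha hb; rewrite /term_agree; cauto. Qed.

End Functions3.

Ltac cuser ::= first [apply: comp_walk | apply: comp_bit | apply: pN_dig | apply: comp_covers
  | apply: comp_minr | apply: comp_first_at | apply: comp_slot_used | apply: comp_slot_site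
  | apply: comp_term_has | apply: comp_fresh | apply: comp_mask_ok | apply: comp_mask_sgn
  | apply: comp_slot_first | apply: eN_slots | apply: comp_code_ok | apply: comp_site_dig
  | apply: comp_state_entry | apply: comp_term_agree].

Section Functions4.
Variables (c : ctx) (r M L w : c -> nat).
Hypotheses (hr : compN r) (hM : eN M) (hL : eN L) (hw : pN w).

Lemma comp_term_code (j a : c -> nat) : pN j -> pN a ->
  compN (fun e => term_code k d D (cinp e) (r e) (L e) (w e) (j e) (a e)).
Proof. by move=> hj ha; rewrite /term_code; cauto. Qed.

End Functions4.

Ltac cuser2 := first [apply: comp_walk | apply: comp_bit | apply: pN_dig | apply: comp_covers
  | apply: comp_minr | apply: comp_first_at | apply: comp_slot_used | apply: comp_slot_site
  | apply: comp_term_has | apply: comp_fresh | apply: comp_mask_ok | apply: comp_mask_sgn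
  | apply: comp_slot_first | apply: eN_slots | apply: comp_code_ok | apply: comp_site_dig
  | apply: comp_state_entry | apply: comp_term_agree | apply: comp_term_code].

Ltac cuser ::= cuser2.

Lemma comp_ham_entry c (r L w q a b : c -> nat) : compN r -> eN L -> pN w -> pN q ->
  pN a -> pN b -> compC (fun e => ham_entry k d D (cinp e) (r e) (L e) (w e) (q e) (a e) (b e)).
Proof. by move=> hr hL hw hq ha hb; rewrite /ham_entry; cauto. Qed.

Ltac cuser ::= first [apply: comp_ham_entry | cuser2].

Lemma comp_pow_entry c (r L w q m a b : c -> nat) : compN r -> eN L -> pN w -> pN q ->
  pN m -> pN a -> pN b -> (forall e, cdom e -> a e < d ^ slots k (L e)) ->
  compC (fun e => pow_entry k d D (cinp e) (r e) (L e) (w e) (q e) (m e) (a e) (b e)).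
Proof.
move=> hr hL hw hq hm ha hb aN; pose N e := d ^ slots k (L e).
have hN : pN N by rewrite /N; cauto.
(* The pairs (m, a) are flattened row by row into one index, so that the row for m - 1 is complete
   when the row for m is computed. The bound on [a e] makes the pair recoverable by division. *)
pose i e := m e * N e + a e; have hi : pN i by rewrite /i; cauto.
pose A e y := pow_entry k d D (cinp e) (r e) (L e) (w e) (q e) (y %/ N e) (y %% N e) (b e).
suff : compC (fun e => A e (i e)).
  apply: comp_eq => e de; have h := aN e de; have N0 : 0 < N e by apply: leq_ltn_trans h.
  by rewrite /A /i divnMDl // modnMDl divn_small // modn_small // addn0.
apply: (@comp_rec R KCpx c i A hi) => l lc; set c1 := tabctx _ _ _.
have h2 : pN (c := c1) (fun p => p.2) by apply: pN_tabvar; apply: poly_succ; case: hi.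
have h : compC (fun p : c1 => if p.2 %/ N p.1 == 0 then (nat_of_bool (p.2 %% N p.1 == b p.1)%N)%:R%R else
    (\sum_(0 <= x < N p.1) if code_ok k d D (cinp p.1) (r p.1) (L p.1) (w p.1) x
     then ham_entry k d D (cinp p.1) (r p.1) (L p.1) (w p.1) (q p.1) (p.2 %% N p.1)%N x *
       A p.1 ((p.2 %/ N p.1).-1 * N p.1 + x)%N else 0%:R)%R).
  apply: comp_if; [by cauto|by cauto|]; set c2 := domctx _.
  have hN2 : pN (fun p : c2 => N p.1) by cauto.
  apply: (@comp_sumC' c2 (fun p => N p.1) (fun p x =>
    if code_ok k d D (cinp p.1) (r p.1) (L p.1) (w p.1) x
     then ham_entry k d D (cinp p.1) (r p.1) (L p.1) (w p.1) (q p.1) (p.2 %% N p.1)%N x *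
       A p.1 ((p.2 %/ N p.1).-1 * N p.1 + x)%N else 0%:R)%R hN2) => l3 lc3 h3.
  set c3 := varctx _ _ in h3 *.
  have hA : compC (fun p : c3 => A p.1.1 ((p.1.2 %/ N p.1.1).-1 * N p.1.1 + p.2)).
    refine (@comp_tabget R KCpx c (fun e => (i e).+1) A l lc c3 (fun p => p.1)
      (fun p => (p.1.2 %/ N p.1.1).-1 * N p.1.1 + p.2) _ _ _).
    - by solve_ctxmap.
    - move=> [[e y] x] [[_ y0] xN] /=; move: y0 xN => /=; rewrite -lt0n => y0 xN.
      rewrite {2}(divn_eq y (N e)) -{2}(ltn_predK y0) mulSn; lia.
    - by cauto.
  by cauto.
apply: comp_eq h => -[e y] [_ _] /=; rewrite /A.
case E : (y %/ N e) => [|x] //=; apply: eq_big_nat => z /andP[_ zN].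
have N0 : 0 < N e by apply: leq_ltn_trans zN.
have -> : (x * N e + z) %/ N e = x by rewrite divnMDl // divn_small // addn0.
by rewrite modnMDl (modn_small zN).
Qed.

Ltac cuser ::= first [apply: comp_pow_entry | apply: comp_ham_entry | cuser2].

Lemma comp_moment c (r L w q m : c -> nat) : compN r -> eN L -> pN w -> pN q -> pN m ->
  compC (fun e => moment k d D (cinp e) (r e) (L e) (w e) (q e) (m e)).
Proof.
move=> hr hL hw hq hm; rewrite /moment.
have hN : pN (fun e => d ^ slots k (L e)) by cauto.
by cauto => -[[e x] y] /= [[_ xN] yN].
Qed.

Ltac cuser ::= first [apply: comp_moment | cuser2].

Lemma comp_moment_coef c (r L w q m : c -> nat) : compN r -> eN L -> pN w -> pN q -> pN m ->
  compC (fun e => moment_coef k d D (cinp e) (r e) (L e) (w e) (q e) (m e)).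
Proof. by move=> hr hL hw hq hm; rewrite /moment_coef; cauto. Qed.

(** The sequence f is evaluated inside the contexts of a table and of a loop, so its computability
    is required along all maps into c. *)
Lemma comp_logc c (f : c -> nat -> R[i]) (m : c -> nat) : pN m ->
  (forall c' (phi : c' -> c) (n : c' -> nat), ctxmap phi -> pN n -> compC (fun e => f (phi e) (n e))) ->
  compC (fun e => logc (f e) (m e)).
Proof.
move=> hm hf.
apply: (@comp_rec R KCpx c m (fun e => logc (f e)) hm) => l lc; set c1 := tabctx _ _ _.
have h2 : pN (c := c1) (fun p => p.2) by apply: pN_tabvar; apply: poly_succ; case: hm.
have h : compC (fun p : c1 => if p.2 == 0 then (0%:R : R[i])%R else
    (f p.1 p.2 - (\sum_(0 <= j < p.2) j%:R * logc (f p.1) j * f p.1 (p.2 - j)%N) / p.2%:R)%R).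
  apply: comp_if; [by cauto|by cauto|]; set c2 := domctx _.
  have h22 : pN (fun p : c2 => p.2) by cauto.
  have hf2 : compC (fun p : c2 => f p.1 p.2).
    by apply: (hf c2 fst snd) => //; solve_ctxmap.
  have hs : compC (fun p : c2 => \sum_(0 <= j < p.2) j%:R * logc (f p.1) j * f p.1 (p.2 - j)%N)%R.
    apply: (@comp_sumC' c2 (fun p => p.2) (fun p j => j%:R * logc (f p.1) j * f p.1 (p.2 - j)%N)%R h22) => l3 lc3 h3.
    set c3 := varctx _ _ in h3 *.
    have hA : compC (fun p : c3 => logc (f p.1.1) p.2).
      refine (@comp_tabget R KCpx c (fun e => (m e).+1) (fun e => logc (f e)) l lc c3 (fun p => p.1)
        (fun p => p.2) _ _ _).
      - by solve_ctxmap.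
      - by move=> p [_].
      - by cauto.
    have hs : pN (fun p : c3 => p.1.2 - p.2).
      have h1 : pN (fun p : c3 => p.1.2) by cauto.
      split; first by apply: comp_subn; cauto.
      by apply: poly_le_mono (pN_poly h1) => p _; apply: leq_subr.
    have hff : compC (fun p : c3 => f p.1.1 (p.1.2 - p.2)).
      by apply: (hf c3 (fun p => p.1.1) _ _ hs); solve_ctxmap.
    by cauto.
  by cauto.
by apply: comp_eq h => -[e y] _ /=; rewrite [RHS]logcE.
Qed.

Lemma comp_log_val c (r L M w q : c -> nat) : compN r -> eN L -> eN M -> pN w -> pN q ->
  compC (fun e => log_val k d D (cinp e) (r e) (L e) (M e) (w e) (q e)).
Proof.
move=> hr hL hM hw hq; rewrite /log_val.
have hM1 : pN (fun e => (M e).+1) by cauto.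
apply: (@comp_sumC' c (fun e => (M e).+1) (fun e m =>
  logc (moment_coef k d D (cinp e) (r e) (L e) (w e) (q e)) m * \prod_(0 <= j < m) in_time (cinp e))%R hM1).
move=> l lc h2; set c1 := varctx _ _ in h2 *.
have hl : compC (fun p : c1 => logc (moment_coef k d D (cinp p.1) (r p.1) (L p.1) (w p.1) (q p.1)) p.2).
  apply: (@comp_logc c1 (fun p => moment_coef k d D (cinp p.1) (r p.1) (L p.1) (w p.1) (q p.1)) _ h2).
  move=> c' phi n mp hn.
  have h1 := @comp_map R KNat c' c1 (fun p => r p.1) phi _ mp.
  have h3 := @eN_map R c' c1 (fun p => L p.1) phi _ mp.
  have h4 := @pN_map R c' c1 (fun p => w p.1) phi _ mp.
  have h5 := @pN_map R c' c1 (fun p => q p.1) phi _ mp.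
  have h : compC (fun e => moment_coef k d D (cinp e) (r (phi e).1) (L (phi e).1) (w (phi e).1) (q (phi e).1) (n e)).
    by apply: comp_moment_coef hn; [apply: h1|apply: h3|apply: h4|apply: h5]; cauto.
  by apply: comp_eq h => e _; case: mp => /(_ e) /= <-.
by cauto.
Qed.

Ltac cuser ::= first [apply: comp_log_val | cuser2].

Lemma comp_root_val c (r M : c -> nat) : compN r -> eN M ->
  compC (fun e => root_val k d D (cinp e) (r e) (M e)).
Proof. by move=> hr hM; rewrite /root_val /cluster_val; cauto. Qed.

End Computable.

(** * Correctness of the algorithm *)

Section Digits.
Variable b : nat.

Definition undig (n : nat) (f : nat -> nat) := \sum_(i < n) f i * b ^ i.

Lemma undigS n f : undig n.+1 f = f 0 + b * undig n (fun i => f i.+1).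
Proof.
rewrite /undig big_ord_recl expn0 muln1 big_distrr /=; congr (_ + _).
by apply: eq_bigr => i _; rewrite /bump /= add1n expnS mulnCA.
Qed.

Lemma dig_succ i x : dig b i.+1 x = dig b i (x %/ b).
Proof. by rewrite /dig expnS divnMA. Qed.

Lemma undig_lt n f : (forall i, i < n -> f i < b) -> undig n f < b ^ n.
Proof.
elim: n f => [|n IH] f h; first by rewrite /undig big_ord0.
rewrite undigS expnS; have h0 := h 0 isT.
have := IH (fun i => f i.+1) (fun i => h i.+1).
move: (undig _ _) (b ^ n) => u p up.
by apply: (@leq_trans (b * u.+1)); [rewrite mulnS ltn_add2r | rewrite leq_mul2l up orbT].
Qed.

Lemma dig_undig n f i : (forall i, i < n -> f i < b) -> i < n -> dig b i (undig n f) = f i.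
Proof.
elim: n f i => // n IH f i h; have h0 := h 0 isT.
have b0 : 0 < b by apply: leq_ltn_trans h0.
rewrite undigS mulnC addnC; case: i => [|i] iN.
  by rewrite /dig expn0 divn1 modnMDl modn_small.
rewrite dig_succ divnMDl // divn_small // addn0.
by apply: IH => // j jn; apply: h.
Qed.

Lemma undig_dig n x : x < b ^ n -> undig n (fun i => dig b i x) = x.
Proof.
elim: n x => [|n IH] x; first by rewrite /undig big_ord0; case: x.
rewrite expnS mulnC => xn; rewrite undigS /dig expn0 divn1.
have -> : undig n (fun i => x %/ b ^ i.+1 %% b) = undig n (fun i => dig b i (x %/ b)).
  by apply: eq_bigr => i _; rewrite -[x %/ b ^ i.+1 %% b]/(dig b i.+1 x) dig_succ.
have b0 : 0 < b by case: b xn => //; rewrite muln0.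
by rewrite IH ?ltn_divLR // mulnC addnC -divn_eq.
Qed.

Lemma eq_undig n f g : (forall i, i < n -> f i = g i) -> undig n f = undig n g.
Proof. by move=> fg; apply: eq_bigr => i _; rewrite fg. Qed.

Lemma dig_lt l x : 0 < b -> dig b l x < b.
Proof. exact: ltn_pmod. Qed.

End Digits.

(** A loop that counts only first occurrences becomes a sum over the distinct values. It is used for
    the sites and the subsystems of a walk and for the sets visited by walks. *)
Lemma big_first (M : Type) (idx : M) (op : Monoid.com_law idx) (I : finType) (y : nat -> I)
    (P : pred I) (F : I -> M) N :
  \big[op/idx]_(0 <= i < N)
     (if alln i (fun j => y j != y i) && P (y i) then F (y i) else idx) =
  \big[op/idx]_(g | hasn N (fun i => y i == g) && P g) F g.
Proof.
elim: N => [|N IH]; first by rewrite big_geq // big1 // => g /andP[/hasnP[]].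
rewrite big_nat_recr //= IH; set h := hasn N (fun i => y i == y N).
have hE : alln N (fun j => y j != y N) = ~~ h by rewrite /alln all_predC.
have eN g : hasn N.+1 (fun i => y i == g) = hasn N (fun i => y i == g) || (y N == g).
  by rewrite /hasn -addn1 iotaD has_cat /= orbF.
rewrite [RHS]big_mkcond [RHS](bigD1 (y N)) //= [X in op X _ = _]big_mkcond [X in op X _ = _](bigD1 (y N)) //= -/h.
rewrite hE eN -/h eqxx orbT /=.
have -> : \big[op/idx]_(i | i != y N) (if hasn N.+1 (fun i0 => y i0 == i) && P i then F i else idx)
   = \big[op/idx]_(i | i != y N) (if hasn N (fun i0 => y i0 == i) && P i then F i else idx).
  by apply: eq_bigr => i iN; rewrite eN [y N == i]eq_sym (negPf iN) orbF.
by rewrite Monoid.mulmAC; congr (op _ _); clear hE; case: h; case: (P _); rewrite /= ?Monoid.mulm1 ?Monoid.mul1m.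
Qed.

(** * Encoded configurations and the moments of a walk *)

Section Sites.
Variables (R : realType) (V : finType) (d k D n : nat) (i0 : 'I_d).
Hypothesis i00 : i0 = 0 :> nat.
Variables (rho : V -> 'M[R[i]]_d) (inp : input R) (vid : V -> nat).
Variables (X : 'I_n -> {set V}) (ord : 'I_n -> seq V) (lam : 'I_n -> R) (h : 'I_n -> op R V d).
Hypothesis vid_inj : injective vid.
Hypothesis X_card : forall i, #|X i| <= k.
Hypothesis ord_perm : forall i, perm_eq (ord i) (enum (X i)).
Hypothesis site_ok : forall i : 'I_n, mkseq (in_site inp i) (in_size inp i) = [seq vid v | v <- ord i].
Hypothesis coef_ok : forall i : 'I_n, in_coef inp i = lam i.
Hypothesis term_ok : forall (i : 'I_n) s s', agree_on (~: X i) s s' ->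
  in_term inp i (config_code (ord i) s) (config_code (ord i) s') = entry (h i) s s'.
Hypothesis state_ok : forall (v : V) (a b : 'I_d), in_state inp (vid v) a b = rho v a b.
Hypothesis h_supp : forall i, acts_within (X i) (h i).
Hypothesis rho_density : forall v, density_op (rho v).
Variables (r L w : nat) (wk : nat -> 'I_n).
Hypothesis wk_ok : forall i, walk D inp r w i = wk i.
Local Notation config := (config V d).

Lemma in_sizeE (i : 'I_n) : in_size inp i = size (ord i).
Proof. by have := congr1 size (site_ok i); rewrite size_mkseq size_map. Qed.

Lemma in_siteE (i : 'I_n) j v0 : j < size (ord i) -> in_site inp i j = vid (nth v0 (ord i) j).
Proof.
move=> js; have := congr1 (fun s => nth 0 s j) (site_ok i).
by rewrite nth_mkseq ?in_sizeE // (nth_map v0).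
Qed.

Lemma size_ord_le (i : 'I_n) : size (ord i) <= k.
Proof. by rewrite (perm_size (ord_perm i)) -cardE. Qed.

Lemma mem_ord (i : 'I_n) v : (v \in ord i) = (v \in X i).
Proof. by rewrite (perm_mem (ord_perm i)) mem_enum. Qed.

Definition slot x : option V := nth None [seq Some v | v <- ord (wk (x %/ k))] (x %% k).

Local Notation Q := (slots k L).
Local Notation first_slot := (slot_first k D inp r w).

Lemma slot_usedE x : slot_used k D inp r w x = isSome (slot x).
Proof.
rewrite /slot_used /slot wk_ok in_sizeE; case: ltnP => hx.
  by case: (ord _) hx => // v0 s hx; rewrite (nth_map v0).
by rewrite nth_default // size_map.
Qed.

Lemma slot_siteE x v : slot x = Some v -> slot_site k D inp r w x = vid v.
Proof.
rewrite /slot /slot_site wk_ok.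
case: (ltnP (x %% k) (size (ord (wk (x %/ k))))) => hx; last by rewrite nth_default // size_map.
by rewrite (nth_map v) // => -[vE]; rewrite (in_siteE v) // vE.
Qed.

Lemma slot_firstE x : first_slot x = alln x (fun y => slot y != slot x) && isSome (slot x).
Proof.
rewrite /slot_first slot_usedE; case E : (slot x) => [v|]; last by rewrite andbF.
rewrite andbT /=; apply: eq_in_all => y _; rewrite slot_usedE (slot_siteE E).
case E' : (slot y) => [u|] //=; rewrite (slot_siteE E') (inj_eq vid_inj).
by rewrite (inj_eq Some_inj).
Qed.

Definition region := \bigcup_(i < L.+1) X (wk i).

Lemma mem_region v : (v \in region) = hasn Q (fun x => slot x == Some v).
Proof.
apply/bigcupP/hasnP => [[i _ vi]|[x xQ /eqP xv]].
  have vo : v \in ord (wk i) by rewrite mem_ord.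
  have io : index v (ord (wk i)) < k by apply: leq_trans (size_ord_le (wk i)); rewrite index_mem.
  exists (i * k + index v (ord (wk i))).
    by rewrite /slots; have := ltn_ord i; move: (nat_of_ord i) io => j; nia.
  rewrite /slot divnMDl ?(leq_ltn_trans _ io) // divn_small // addn0 modnMDl modn_small //.
  by rewrite (nth_map v) ?index_mem // nth_index.
have k0 : 0 < k by case: (k) xQ => //; rewrite /slots muln0.
have xL : x %/ k < L.+1 by rewrite ltn_divLR.
exists (Ordinal xL) => //=; rewrite -mem_ord; move: xv; rewrite /slot.
case: (ltnP (x %% k) (size (ord (wk (x %/ k))))) => hx; last by rewrite nth_default // size_map.
by rewrite (nth_map v) // => -[<-]; apply: mem_nth.
Qed.

Lemma big_slots (M : Type) (idx : M) (op : Monoid.com_law idx) (F : V -> M) :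
  \big[op/idx]_(0 <= x < Q) (if first_slot x then oapp F idx (slot x) else idx) =
  \big[op/idx]_(v in region) F v.
Proof.
under eq_bigr => x _ do rewrite slot_firstE.
rewrite (big_first op slot isSome (oapp F idx)).
rewrite (reindex_omap (Some : V -> option V) id) /=; last by move=> [v|] //=; rewrite andbF.
by apply: eq_bigl => v; rewrite mem_region eqxx !andbT.
Qed.

Lemma first_slot_inj x y v : first_slot x -> first_slot y -> slot x = Some v -> slot y = Some v -> x = y.
Proof.
rewrite !slot_firstE => /andP[/allnP hx _] /andP[/allnP hy _] xv yv.
case: (ltngtP x y) => // xy; first by have := hy _ xy; rewrite xv yv eqxx.
by have := hx _ xy; rewrite xv yv eqxx.
Qed.

Lemma region_first v : v \in region -> exists x, [/\ x < Q, first_slot x & slot x = Some v].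
Proof.
rewrite mem_region => /hasnP vQ.
have ex : exists x, (x < Q) && (slot x == Some v) by case: vQ => x xQ xv; exists x; rewrite xQ.
case: (ex_minnP ex) => x /andP[xQ /eqP xv] xmin; exists x; split=> //.
rewrite slot_firstE xv andbT; apply/allnP => y yx; apply/eqP => yv.
by have := xmin y; rewrite yv eqxx (ltn_trans yx xQ) => /(_ isT); rewrite leqNgt yx.
Qed.

Lemma site_digE v a : site_dig k d D inp r L w (vid v) a =
  \sum_(x < Q | first_slot x && (slot x == Some v)) dig d x a.
Proof.
rewrite /site_dig big_mkord [RHS]big_mkcond; apply: eq_bigr => x _.
have -> // : first_slot x && (slot_site k D inp r w x == vid v) = first_slot x && (slot x == Some v).
rewrite slot_firstE; case E : (slot x) => [u|]; rewrite ?andbF //.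
by rewrite (slot_siteE E) (inj_eq vid_inj) (inj_eq Some_inj).
Qed.

Lemma site_dig_first x v a : x < Q -> first_slot x -> slot x = Some v ->
  site_dig k d D inp r L w (vid v) a = dig d x a.
Proof.
move=> xQ xf xv; rewrite site_digE (big_pred1 (Ordinal xQ)) // => y /=.
apply/andP/eqP => [[yf /eqP yv]|->]; last by rewrite /= xf xv.
by apply/val_inj/(first_slot_inj yf xf yv).
Qed.

Lemma site_dig_out v a : v \notin region -> site_dig k d D inp r L w (vid v) a = 0.
Proof.
move=> vW; rewrite site_digE big_pred0 // => x; apply/negbTE; apply: contra vW => /andP[_ xv].
by rewrite mem_region; apply/hasnP; exists (x : nat).
Qed.

Definition code (s : config) :=
  undig d Q (fun x => if first_slot x then oapp (fun v => s v : nat) 0 (slot x) else 0).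

(** Sites off the region receive the digit 0. This is why [i0] has to be 0: the decoded
    configuration is then the representative chosen by [restr]. *)
Definition decode (a : nat) : config := [ffun v => insubd i0 (site_dig k d D inp r L w (vid v) a)].

Let d_gt0 : 0 < d. Proof. exact: leq_ltn_trans (ltn_ord i0). Qed.

Let code_digit (s : config) x : (if first_slot x then oapp (fun v => s v : nat) 0 (slot x) else 0) < d.
Proof. by case: ifP => // _; case: (slot x) => [v|] //=; apply: ltn_ord. Qed.

Lemma code_lt s : code s < d ^ Q.
Proof. by apply: undig_lt => x _. Qed.

Lemma dig_code s x : x < Q -> dig d x (code s) =
  if first_slot x then oapp (fun v => s v : nat) 0 (slot x) else 0.
Proof. by move=> xQ; rewrite dig_undig. Qed.

Lemma code_ok_code s : code_ok k d D inp r L w (code s).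
Proof. by apply/allnP => x xQ; rewrite dig_code //; case: (first_slot x). Qed.

Lemma site_dig_code s v : v \in region -> site_dig k d D inp r L w (vid v) (code s) = s v.
Proof.
by move=> /region_first[x [xQ xf xv]]; rewrite (site_dig_first _ xQ xf xv) dig_code // xf xv.
Qed.

Lemma code_decode a : a < d ^ Q -> code_ok k d D inp r L w a -> code (decode a) = a.
Proof.
move=> aQ /allnP aok; rewrite -[RHS](undig_dig aQ); apply: eq_undig => x xQ.
case: ifP => xf; last by have := aok x xQ; rewrite xf => /eqP.
have := xf; rewrite slot_firstE; case E : (slot x) => [v|]; last by rewrite andbF.
by rewrite /= ffunE (site_dig_first _ xQ xf E) val_insubd ltn_pmod.
Qed.

Lemma decode_code s : (decode (code s) == s) = (s \in cfg i0 region).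
Proof.
suff -> : decode (code s) = restr i0 region s by rewrite inE.
apply/ffunP => v; rewrite restrE ffunE; apply: val_inj; rewrite val_insubd.
case: (boolP (v \in region)) => vW; first by rewrite site_dig_code // ltn_ord.
by rewrite site_dig_out // d_gt0; apply: esym.
Qed.

Lemma sum_codes (F : nat -> R[i]) :
  (\sum_(0 <= a < d ^ Q) (if code_ok k d D inp r L w a then F a else 0)
   = \sum_(s in cfg i0 region) F (code s))%R.
Proof.
rewrite big_mkord -big_mkcond /=.
rewrite (reindex_onto (fun s => Ordinal (code_lt s)) (fun a => decode a)) /=; last first.
  by move=> a aok; apply: val_inj; rewrite /= code_decode.
by apply: eq_bigl => s; rewrite code_ok_code decode_code.
Qed.

Lemma code_inj s s' : s \in cfg i0 region -> s' \in cfg i0 region -> code s = code s' -> s = s'.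
Proof. by rewrite -!decode_code => /eqP e1 /eqP e2 e3; rewrite -e1 e3. Qed.

Lemma term_codeE j (s : config) : j <= L -> term_code k d D inp r L w j (code s) = config_code (ord (wk j)) s.
Proof.
move=> jL; rewrite /term_code wk_ok in_sizeE.
have -> : config_code (ord (wk j)) s = undig d (size (ord (wk j))) (fun i => nth 0 [seq val (s v) | v <- ord (wk j)] i).
  elim: (ord _) => [|v l IH] /=; first by rewrite /undig big_ord0.
  by rewrite undigS /= -IH.
rewrite /undig -(big_mkord predT (fun i => nth 0 [seq val (s v) | v <- ord (wk j)] i * d ^ i)).
rewrite (big_nat_widen _ _ _ _ _ (size_ord_le (wk j))) /= [RHS]big_mkcond /=.
apply: eq_big_nat => i _; case: ifP => // il.
case E : (ord (wk j)) il => [//|v0 l]; rewrite -E => il.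
rewrite (in_siteE v0) // site_dig_code ?(nth_map v0) //.
have jL1 : j < L.+1 by [].
by apply/bigcupP; exists (Ordinal jL1) => //=; rewrite -mem_ord mem_nth.
Qed.

Lemma term_hasE j v : term_has k D inp r w j (vid v) = (v \in X (wk j)).
Proof.
rewrite -mem_ord; apply/hasnP/idP => [[i ik]|vo].
  rewrite wk_ok in_sizeE => /andP[il]; rewrite (in_siteE v) // (inj_eq vid_inj) => /eqP <-.
  exact: mem_nth.
exists (index v (ord (wk j))); first by apply: leq_trans (size_ord_le (wk j)); rewrite index_mem.
by rewrite wk_ok in_sizeE index_mem vo (in_siteE v) ?index_mem // nth_index ?eqxx.
Qed.

(** Comparing digits in first slots is enough, because both configurations equal [i0] off the
    region. *)
Lemma term_agreeE j (s s' : config) : s \in cfg i0 region -> s' \in cfg i0 region ->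
  term_agree k d D inp r L w j (code s) (code s') = agree_on (~: X (wk j)) s s'.
Proof.
move=> sW s'W; apply/allnP/agreeCP => hh.
  move=> v vX; have [vW|vW] := boolP (v \in region); last first.
    by rewrite -(cfgE sW) -(cfgE s'W) !restrE (negPf vW).
  have [x [xQ xf xv]] := region_first vW.
  have := hh x xQ; rewrite xf (slot_siteE xv) term_hasE (negPf vX) /= !dig_code // xf xv /=.
  by move=> /eqP/val_inj.
move=> x xQ; rewrite !dig_code //; case: ifP => xf //; rewrite /=.
have := xf; rewrite slot_firstE; case E : (slot x) => [v|]; last by rewrite andbF.
by rewrite (slot_siteE E) term_hasE /=; case: (boolP (v \in X (wk j))) => // /hh ->; rewrite eqxx.
Qed.

Lemma state_entryE (s s' : config) : state_entry k d D inp r L w (code s) (code s') =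
  (\prod_(v in region) rho v (s v) (s' v))%R.
Proof.
rewrite -(big_slots *%R) /state_entry; apply: eq_big_nat => x /andP[_ xQ].
case: ifP => // xf; rewrite !dig_code // xf.
by have := xf; rewrite slot_firstE; case E : (slot x) => [v|]; rewrite ?andbF //= (slot_siteE E) state_ok.
Qed.

Variable q : nat.
Hypothesis q_ok : mask_ok D inp r L w q.

Definition masked : {set 'I_n} := [set y | hasn L.+1 (fun j => bit q j && (wk j == y))].

(** A valid mask has no bits at repeated visits, so it is determined by the set that it marks. *)
Lemma bit_first j : j <= L -> bit q j = alln j (fun i => wk i != wk j) && (wk j \in masked).
Proof.
have fE i : first_at D inp r w i = alln i (fun i' => wk i' != wk i).
  by apply: eq_in_all => i' _; rewrite !wk_ok.
move=> jL; have := allnP _ _ q_ok j jL; rewrite fE.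
case: (boolP (bit q j)) => bj; rewrite ?orbF ?orbT.
  by move=> ->; rewrite inE; apply/esym/hasnP; exists j => //; rewrite bj eqxx.
move=> _; apply/esym/negbTE/andP => -[/allnP fj]; rewrite inE => /hasnP[i iL /andP[bi /eqP ij]].
have := allnP _ _ q_ok i iL; rewrite fE bi orbF => /allnP fi.
case: (ltngtP i j) => [ltij|ltji|eij]; first by have := fj i ltij; rewrite ij eqxx.
  by have := fi j ltji; rewrite ij eqxx.
by rewrite eij in bi; rewrite bi in bj.
Qed.

Lemma masked_visited y : y \in masked -> hasn L.+1 (fun j => wk j == y).
Proof. by rewrite inE => /hasnP[j jL /andP[_ yj]]; apply/hasnP; exists j. Qed.

Lemma ham_entryE (s s' : config) : s \in cfg i0 region -> s' \in cfg i0 region ->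
  ham_entry k d D inp r L w q (code s) (code s') = entry (partial_ham lam h masked) s s'.
Proof.
move=> sW s'W; rewrite /ham_entry.
transitivity (\sum_(0 <= j < L.+1) (if alln j (fun i => wk i != wk j) && (wk j \in masked)
    then (lam (wk j))%:C%C * entry (h (wk j)) s s' else 0))%R.
  apply: eq_big_nat => j /andP[_ jL]; rewrite wk_ok term_agreeE // bit_first //.
  case: (alln _ _ && _) => //=; rewrite coef_ok !term_codeE //.
  by case: ifP => [/term_ok ->|ag] //; rewrite (loc_acts i0 (h_supp _)) ag mulr0.
rewrite (big_first +%R wk (mem masked) (fun y => (lam y)%:C%C * entry (h y) s s')%R).
rewrite /partial_ham /entry summxE; apply: eq_big => [y|y _]; last by rewrite mxE.
by apply: andb_idl => /masked_visited.
Qed.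

Lemma masked_loc : loc i0 region (partial_ham lam h masked).
Proof.
apply: (partial_ham_loc i0 lam h_supp) => y /masked_visited/hasnP[j jL /eqP <-].
exact: (bigcup_sup (Ordinal jL)).
Qed.

Lemma pow_entryE m (s s' : config) : s \in cfg i0 region -> s' \in cfg i0 region ->
  pow_entry k d D inp r L w q m (code s) (code s') = entry (partial_ham lam h masked ^+ m)%R s s'.
Proof.
move=> sW s'W; elim: m s sW => [|m IH] s sW.
  rewrite expr0 -[1%R]/(1%:M)%R entry1 /=; congr (_%:R)%R; congr nat_of_bool.
  by apply/eqP/eqP => [/(code_inj sW s'W)|->].
rewrite [LHS]/= sum_codes exprS -[(_ * _)%R]/(_ *m _)%R.
rewrite (locM_entry masked_loc (locX _ masked_loc)); last first.
  by rewrite -(cfgE sW) -(cfgE s'W) agreeC_restr.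
rewrite (cfgE sW) (cfgE s'W); apply: eq_bigr => u uW.
by rewrite ham_entryE // IH.
Qed.

Lemma momentE m : moment k d D inp r L w q m = expect rho (partial_ham lam h masked ^+ m)%R.
Proof.
rewrite (expect_loc (density_tr rho_density) (locX _ masked_loc)) /moment.
transitivity (\sum_(0 <= a < d ^ Q) if code_ok k d D inp r L w a then
  \sum_(0 <= b < d ^ Q) (if code_ok k d D inp r L w b then
     pow_entry k d D inp r L w q m a b * state_entry k d D inp r L w b a else 0) else 0)%R.
  apply: eq_big_nat => a _; case: ifP => _ //=; by rewrite big1.
rewrite sum_codes; apply: eq_bigr => s sW; rewrite sum_codes; apply: eq_bigr => s' s'W.
by rewrite pow_entryE // state_entryE.
Qed.

Lemma moment_coefE m : moment_coef k d D inp r L w q m = echo_coef rho (partial_ham lam h masked) m.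
Proof.
rewrite /moment_coef /echo_coef momentE prodr_const_nat subn0 sub0r; congr (_ / _%:R * _)%R.
by rewrite fact_prod big_add1.
Qed.

End Sites.

(** * Masks of a walk as subsets of the visited set *)

Section Masks.
Variables (R : realType) (D n : nat) (inp : input R) (r L w : nat) (wk : nat -> 'I_n).
Hypothesis wk_ok : forall i, walk D inp r w i = wk i.

Definition range_set : {set 'I_n} := [set y | hasn L.+1 (fun j => wk j == y)].

Let first_atE i : first_at D inp r w i = alln i (fun i' => wk i' != wk i).
Proof. by apply: eq_in_all => i' _; rewrite !wk_ok. Qed.

Definition mask_of (B : {set 'I_n}) :=
  undig 2 L.+1 (fun j => alln j (fun i => wk i != wk j) && (wk j \in B)).

Lemma mask_of_lt B : mask_of B < 2 ^ L.+1.
Proof. by apply: undig_lt => j _; case: (_ && _). Qed.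

Lemma bit_mask_of B j : j <= L -> bit (mask_of B) j = alln j (fun i => wk i != wk j) && (wk j \in B).
Proof.
by move=> jL; rewrite /bit dig_undig //; [case: (_ && _) | move=> i _; case: (_ && _)].
Qed.

Lemma mask_of_ok B : mask_ok D inp r L w (mask_of B).
Proof.
apply/allnP => j jL; rewrite first_atE bit_mask_of //.
by case: (alln _ _).
Qed.

Lemma range_first y : y \in range_set -> exists j, [/\ j <= L, alln j (fun i => wk i != wk j) & wk j = y].
Proof.
rewrite inE => /hasnP yL.
have ex : exists j, (j < L.+1) && (wk j == y) by case: yL => j jL yj; exists j; rewrite jL.
case: (ex_minnP ex) => j /andP[jL /eqP jy] jmin; exists j; split=> //.
apply/allnP => i ij; apply/eqP => ii.
by have := jmin i; rewrite ii jy eqxx (ltn_trans ij jL) => /(_ isT); rewrite leqNgt ij.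
Qed.

Lemma masked_mask_of B : masked L wk (mask_of B) = range_set :&: B.
Proof.
apply/setP => y; rewrite !inE; apply/hasnP/andP => [[j jL /andP[]]|[yr yB]].
  rewrite bit_mask_of // => /andP[_ jB] /eqP yj; rewrite -yj jB; split=> //.
  by apply/hasnP; exists j.
have [|j [jL jf jy]] := @range_first y; first by rewrite inE.
by exists j; rewrite // bit_mask_of // jf jy yB eqxx.
Qed.

Lemma mask_of_masked q : q < 2 ^ L.+1 -> mask_ok D inp r L w q -> mask_of (masked L wk q) = q.
Proof.
move=> qL qok; rewrite -[RHS](undig_dig qL); apply: eq_undig => j jL.
rewrite -(bit_first wk_ok qok) // /bit; have := dig_lt j q (isT : 0 < 2).
by case: (dig 2 j q) => [|[|]].
Qed.

Lemma sum_masks (F : nat -> R[i]) :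
  (\sum_(0 <= q < 2 ^ L.+1) (if mask_ok D inp r L w q then F q else 0)
   = \sum_(B : {set 'I_n} | B \subset range_set) F (mask_of B))%R.
Proof.
rewrite big_mkord -big_mkcond /=.
rewrite (reindex_onto (fun B => Ordinal (mask_of_lt B)) (fun q => masked L wk q)) /=; last first.
  by move=> q qok; apply: val_inj; rewrite /= mask_of_masked.
apply: eq_bigl => B; rewrite mask_of_ok masked_mask_of.
by apply/eqP/setIidPr.
Qed.

Lemma mask_sgnE (B : {set 'I_n}) : B \subset range_set ->
  mask_sgn D inp r L w (mask_of B) = ((-1) ^+ (#|range_set| + #|B|) : R[i])%R.
Proof.
move=> Br; transitivity (\prod_(y in range_set) (if y \in B then 1 else -1) : R[i])%R.
  transitivity (\prod_(0 <= j < L.+1) (if alln j (fun i => wk i != wk j) && true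
     then (if wk j \in B then 1 else -1) else 1) : R[i])%R.
    apply: eq_big_nat => j /andP[_ jL]; rewrite first_atE bit_mask_of // andbT sub0r.
    by case: (alln _ _) => //=; case: (_ \in _).
  rewrite (big_first *%R wk predT (fun y => if y \in B then 1 else -1)%R).
  by apply: eq_bigl => y; rewrite [RHS]inE /= andbT.
rewrite (bigID (mem B)) /= [X in (X * _)%R]big1 ?mul1r; last by move=> y /andP[_ ->].
rewrite (eq_bigr (fun _ => -1)%R); last by move=> y /andP[_ /negPf ->].
rewrite prodr_const.
have <- : #|range_set :\: B| = #|[pred y in range_set | y \notin B]|.
  by apply: eq_card => y; rewrite !inE andbC.
have c : #|range_set| = #|B| + #|range_set :\: B|.
  by rewrite -(cardsID B range_set) (setIidPr Br).
by rewrite c addnAC exprD addnn -mul2n exprM sqrrN !expr1n mul1r.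
Qed.

End Masks.

(** * Each visited set is counted exactly once *)

Section Family.
Variables (R : realType) (V : finType) (d k D n : nat) (i0 : 'I_d).
Hypothesis i00 : i0 = 0 :> nat.
Variables (rho : V -> 'M[R[i]]_d) (inp : input R) (vid : V -> nat).
Variables (X : 'I_n -> {set V}) (ord : 'I_n -> seq V) (lam : 'I_n -> R) (h : 'I_n -> op R V d).
Hypothesis vid_inj : injective vid.
Hypothesis X_card : forall i, #|X i| <= k.
Hypothesis ord_perm : forall i, perm_eq (ord i) (enum (X i)).
Hypothesis site_ok : forall i : 'I_n, mkseq (in_site inp i) (in_size inp i) = [seq vid v | v <- ord i].
Hypothesis coef_ok : forall i : 'I_n, in_coef inp i = lam i.
Hypothesis term_ok : forall (i : 'I_n) s s', agree_on (~: X i) s s' ->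
  in_term inp i (config_code (ord i) s) (config_code (ord i) s') = entry (h i) s s'.
Hypothesis state_ok : forall (v : V) (a b : 'I_d), in_state inp (vid v) a b = rho v a b.
Hypothesis h_supp : forall i, acts_within (X i) (h i).
Hypothesis rho_density : forall v, density_op (rho v).
Hypothesis lam_le : (forall i, `|lam i| <= 1)%R.
Hypothesis h_norm : (forall i, opnorm (h i) = 1)%R.
Hypothesis deg_le : forall i : 'I_n, in_deg inp i <= D.
Hypothesis nbr_lt : forall (i : 'I_n) j, j < in_deg inp i -> in_nbr inp i j < n.
Hypothesis nbr_adj : forall i y : 'I_n, touch X i y -> exists2 j, j < in_deg inp i & in_nbr inp i j = y.

Lemma step_lt (x : 'I_n) j : step inp x j < n.
Proof. by rewrite /step; case: ifP => [/nbr_lt|_]. Qed.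

Definition nb (x : 'I_n) j : 'I_n := Ordinal (step_lt x j).

Fixpoint walk_ord (r : 'I_n) w i : 'I_n :=
  if i is i'.+1 then nb (walk_ord r w i') (dig D.+1 i' w) else r.

Lemma walk_ordE (r : 'I_n) w i : walk D inp r w i = walk_ord r w i.
Proof. by elim: i => //= i ->. Qed.

Variables (M : nat) (t : R[i]).
Hypothesis time_ok : in_time inp = t.

Definition log_poly (H : op R V d) : R[i] := (\sum_(m < M.+1) logc (echo_coef rho H) m * t ^+ m)%R.

Local Notation ham := (partial_ham lam h).
Local Notation L := (2 * M).

Lemma log_valE (r : 'I_n) w q : mask_ok D inp r L w q ->
  log_val k d D inp r L M w q = log_poly (ham (masked L (walk_ord r w) q)).
Proof.
move=> qok; rewrite /log_val big_mkord; apply: eq_bigr => m _.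
rewrite prodr_const_nat subn0 time_ok; congr (_ * _)%R; apply: eq_logc => j.
exact: (moment_coefE i00 vid_inj X_card ord_perm site_ok coef_ok term_ok state_ok h_supp rho_density
  (walk_ordE r w) qok).
Qed.

Definition cluster (r : 'I_n) w := range_set L (walk_ord r w).

Lemma cluster_valE (r : 'I_n) w :
  cluster_val k d D inp r L M w = mob (fun B => log_poly (ham B)) (cluster r w).
Proof.
rewrite /cluster_val (sum_masks L (walk_ordE r w)); apply: eq_bigr => B Br.
rewrite (mask_sgnE (L := L) (walk_ordE r w) Br) log_valE; last exact: (mask_of_ok L (walk_ordE r w)).
by rewrite (masked_mask_of _ _ B) (setIidPr Br).
Qed.

Lemma mem_cluster (r : 'I_n) w y : (y \in cluster r w) = hasn L.+1 (fun j => walk_ord r w j == y).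
Proof. by rewrite inE. Qed.

Lemma root_cluster (r : 'I_n) w : r \in cluster r w.
Proof. by rewrite mem_cluster; apply/hasnP; exists 0. Qed.

Lemma coversE (r : 'I_n) w w' : covers D inp r L w w' = (cluster r w \subset cluster r w').
Proof.
apply/allnP/subsetP => hs.
  move=> y; rewrite !mem_cluster => /hasnP[j jL /eqP <-].
  by have := hs j jL; rewrite /hasn; apply: sub_has => i /=; rewrite !walk_ordE.
move=> j jL; have := hs (walk_ord r w j); rewrite !mem_cluster.
have -> : hasn L.+1 (fun i => walk_ord r w i == walk_ord r w j) by apply/hasnP; exists j.
by move=> /(_ isT); rewrite /hasn; apply: sub_has => i /=; rewrite !walk_ordE.
Qed.

Lemma freshE (r : 'I_n) w : fresh D inp r L w = alln w (fun w' => cluster r w' != cluster r w).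
Proof. by apply: eq_all => w'; rewrite !coversE -eqEsubset eq_sym. Qed.

Lemma minrE (r : 'I_n) w : minr D inp r L w = [forall y in cluster r w, r <= y].
Proof.
apply/allnP/forall_inP => hs.
  by move=> y; rewrite mem_cluster => /hasnP[j jL /eqP <-]; have := hs j jL; rewrite walk_ordE.
by move=> j jL; rewrite walk_ordE; apply: hs; rewrite mem_cluster; apply/hasnP; exists j.
Qed.

Definition rooted (r : 'I_n) (g : {set 'I_n}) :=
  hasn (D.+1 ^ L) (fun w => cluster r w == g) && [forall y in g, r <= y].

Definition family : {set {set 'I_n}} := [set g | [exists r, rooted r g]].

Lemma sum_root_val :
  (\sum_(0 <= r < n) root_val k d D inp r M = \sum_(g in family) mob (fun B => log_poly (ham B)) g)%R.
Proof.
rewrite big_mkord; transitivity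
    (\sum_(r < n) \sum_(g | rooted r g) mob (fun B => log_poly (ham B)) g)%R.
  apply: eq_bigr => r _; rewrite /root_val.
  rewrite -(big_first +%R (cluster r) (fun g : {set 'I_n} => [forall y in g, r <= y])
    (mob (fun B => log_poly (ham B))) (D.+1 ^ L)).
  by apply: eq_bigr => w _; rewrite freshE minrE cluster_valE.
rewrite (exchange_big_dep predT) //= [RHS]big_mkcond /=; apply: eq_bigr => g _.
rewrite inE; case: (boolP [exists r, rooted r g]) => [/existsP[r rg]|/existsPn nr]; last first.
  by rewrite big1 // => r; rewrite (negPf (nr r)).
(* The root is unique: it lies in the set and is its least element. *)
rewrite (big_pred1 r) // => r'; apply/idP/eqP => [rg'|->//].
case/andP: rg => /hasnP[w _ /eqP wg] /forall_inP gr.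
case/andP: rg' => /hasnP[w' _ /eqP wg'] /forall_inP gr'.
have rr : r \in g by rewrite -wg root_cluster.
have rr' : r' \in g by rewrite -wg' root_cluster.
by apply/val_inj/eqP; rewrite eqn_leq gr // gr'.
Qed.

Lemma conn_family (g : {set 'I_n}) x : conn (touch X) g x -> #|g| <= M -> g \in family.
Proof.
move=> cg gM; have xg : x \in g by case/connP: cg.
pose r := [arg min_(y < x in g) (y : nat)].
have [rg rmin] : r \in g /\ forall y, y \in g -> r <= y.
  by rewrite /r; case: arg_minnP.
(* Connectedness is moved from x to r: a separated part that contains r but not x would have a
   separated complement containing x, and this complement would be all of g. *)
have cr : conn (touch X) g r.
  apply/connP; split=> // B rB Bg sB; case/connP: cg => _ cx.
  have [xB|xB] := boolP (x \in B); first exact: cx.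
  have gB : g :\: (g :\: B) = B by rewrite setDDr setDv set0U; apply/setIidPr.
  have := cx (g :\: B); rewrite inE xB xg subsetDl gB => /(_ isT isT) e.
  have : r \in g :\: B.
    rewrite e //; apply/separatedP => u v ug vB.
    by rewrite eq_sym (touch_sym X) ; move/separatedP: sB => /(_ v u vB ug).
  by rewrite inE rB.
have gL : 2 * #|g|.-1 <= L by lia.
have nadj x' y : touch X x' y -> exists2 j, j <= D & nb x' j = y.
  move=> /nbr_adj[j jd jy]; exists j; first exact: leq_trans (ltnW jd) (deg_le x').
  by apply: val_inj; rewrite /= /step jd.
have nstay x' : nb x' D = x'.
  by apply: val_inj; rewrite /= /step ltnNge deg_le.
have [s [sL sD sg]] := conn_walk (touch_sym X) nadj nstay cr gL.
rewrite inE; apply/existsP; exists r; apply/andP; split; last by apply/forall_inP.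
have sD' i : i < L -> nth 0 s i < D.+1.
  by move=> iL; rewrite ltnS; apply: (allP sD); rewrite mem_nth // sL.
(* The moves of the walk, read as digits in base D + 1, give its number in the loop. *)
apply/hasnP; exists (undig D.+1 L (nth 0 s)); first exact: undig_lt.
have wE i : i <= L -> walk_ord r (undig D.+1 L (nth 0 s)) i = nth r (r :: scanl nb r s) i.
  elim: i => // i IH iL; rewrite [LHS]/= IH ?(ltnW iL) // dig_undig //.
  rewrite nth_cons_scanl ?sL ?(ltnW iL) // [RHS]/= nth_scanl ?sL //.
  by rewrite (take_nth 0) ?sL // -cats1 foldl_cat.
apply/eqP; rewrite -sg; apply/setP => y; rewrite mem_cluster inE.
have sz : size (r :: scanl nb r s) = L.+1 by rewrite /= size_scanl sL.
apply/hasnP/(nthP r) => [[j jL /eqP jy]|[j jL jy]].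
  by exists j; rewrite ?sz // -wE.
by rewrite sz in jL; exists j => //; rewrite wE ?jy.
Qed.

Lemma sum_root_valE :
  (\sum_(0 <= r < n) root_val k d D inp r M = log_poly (ham [set: 'I_n]))%R.
Proof.
rewrite sum_root_val /log_poly.
transitivity (\sum_(m < M.+1) \sum_(g in family)
    mob (fun B => logc (echo_coef rho (ham B)) m) g * t ^+ m)%R.
  rewrite exchange_big /=; apply: eq_bigr => g _; rewrite /mob.
  under [RHS]eq_bigr => m _ do rewrite mulr_suml.
  rewrite exchange_big /=; apply: eq_bigr => B _.
  by rewrite mulr_sumr; apply: eq_bigr => m _; rewrite mulrA.
apply: eq_bigr => m _; rewrite -mulr_suml; congr (_ * _)%R.
apply: esym; apply: (@logc_sum_family _ _ (touch X) (fun B => echo_coef rho (ham B)) (seq_coef rho lam h)).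
- by move=> B j; apply: echo_coef_seq.
- by move=> B; apply: echo_coef0.
- by move=> B C j sBC; apply: (echo_coefM i0 rho_density).
- by move=> g x cg gm; apply: conn_family cg (leq_trans gm _); rewrite -ltnS.
Qed.

End Family.

Lemma max_degree_le (V : finType) (S : {set {set V}}) Y : Y \in S -> #|neighbours S Y| <= max_degree S.
Proof. exact: (@leq_bigmax_cond _ (mem S) (fun Y => #|neighbours S Y|)). Qed.

(** Two overlapping subsystems share a site. This excludes the degenerate cases: S is nonempty, and
    the site has a state of trace 1, so d is positive. *)
Lemma max_degree_site (V : finType) (S : {set {set V}}) : 0 < max_degree S ->
  exists X v, X \in S /\ v \in X.
Proof.
move=> deg; have S0 : 0 < #|mem S|.
  by apply/card_gt0P; have [S0|[Y YS]] := set_0Vmem S; [move: deg; rewrite /max_degree S0 big_set0 | exists Y].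
have [X XS Xdeg] := @eq_bigmax_cond _ (mem S) (fun Y => #|neighbours S Y|) S0.
have : 0 < #|neighbours S X| by rewrite -Xdeg.
case/card_gt0P => Y; rewrite inE => /andP[_ /andP[_ /set0Pn[v]]].
by rewrite inE => /andP[vX _]; exists X, v.
Qed.

(** * From the numbered input back to the set of subsystems *)

Section Indexing.
Variables (R : realType) (V : finType) (d : nat) (S : {set {set V}}) (X : 'I_#|S| -> {set V}).
Hypothesis X_inj : injective X.
Hypothesis X_S : forall i, X i \in S.

Lemma X_image : X @: [set: 'I_#|S|] = S.
Proof.
apply/eqP; rewrite eqEcard card_imset // cardsT card_ord leqnn andbT.
by apply/subsetP => Y /imsetP[i _ ->].
Qed.

Lemma partial_ham_index (lam : {set V} -> R) (h : {set V} -> op R V d) :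
  partial_ham (fun i => lam (X i)) (fun i => h (X i)) [set: 'I_#|S|] = hamiltonian S lam h.
Proof.
rewrite /hamiltonian -[in RHS]X_image big_imset /=; last by move=> i j _ _; apply: X_inj.
by [].
Qed.

Lemma touch_neighbours i j : touch X i j = (X j \in neighbours S (X i)).
Proof. by rewrite /touch inE X_S /= (inj_eq X_inj) eq_sym. Qed.

Lemma touch_degree i : #|[set j | touch X i j]| <= max_degree S.
Proof.
apply: leq_trans (max_degree_le (X_S i)).
rewrite -(card_imset _ X_inj); apply/subset_leq_card/subsetP => Y /imsetP[j].
by rewrite inE touch_neighbours => ? ->.
Qed.

End Indexing.

Section Presentation.
Variables (R : realType) (V : finType) (d k D : nat) (S : {set {set V}}).
Variables (lam : {set V} -> R) (h : {set V} -> op R V d) (rho : V -> 'M[R[i]]_d).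
Hypothesis h_supp : forall X, X \in S -> is_supp (h X) X.
Hypothesis S_card : forall X, X \in S -> #|X| <= k.
Hypothesis S_deg : max_degree S = D.
Hypothesis S_gt0 : 0 < #|S|.
Hypothesis d_gt0 : 0 < d.
Hypothesis rho_density : forall v, density_op (rho v).

Lemma presents_sum (t : R[i]) (eps : R) (inp : input R) M : presents S lam h rho t eps inp ->
  (\sum_(0 <= r < #|S|) root_val k d D inp r M = log_poly rho M t (hamiltonian S lam h))%R.
Proof.
move=> [vid [sid [ord [[ns nsub tE epsE] [vid_inj vid_lt] [sid_inj sid_lt] hX hst]]]].
(* X inverts the numbering [sid], which is a bijection from S to the numbers below |S| by
   counting. *)
have [X [X_S X_sid]] : exists X : 'I_#|S| -> {set V}, (forall i, X i \in S) /\ (forall i, sid (X i) = i).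
  pose f Y : 'I_#|S| := insubd (Ordinal S_gt0) (sid Y).
  have fE Y : Y \in S -> f Y = sid Y :> nat by move=> YS; rewrite val_insubd sid_lt.
  have f_inj : {in S &, injective f}.
    by move=> Y Z YS ZS /(congr1 val); rewrite /= !fE // => /sid_inj; apply.
  have fT : f @: S = [set: 'I_#|S|].
    by apply/eqP; rewrite eqEcard subsetT cardsT card_ord card_in_imset /=.
  have ex i : exists Y, (Y \in S) && (f Y == i).
    have : i \in f @: S by rewrite fT in_setT.
    by case/imsetP => Y YS ->; exists Y; rewrite YS eqxx.
  exists (fun i => xchoose (ex i)); split=> i; case/andP: (xchooseP (ex i)) => // YS /eqP fi.
  by rewrite -fE // fi.
have X_inj : injective X by move=> i j /(congr1 sid); rewrite !X_sid => /val_inj.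
rewrite -(partial_ham_index X_inj X_S).
have h1 i := hX _ (X_S i).
have nbE (i : 'I_#|S|) : perm_eq (mkseq (in_nbr inp i) (in_deg inp i)) [seq sid Y | Y <- enum (neighbours S (X i))].
  by have [_ _ e _ _] := h1 i; rewrite X_sid in e.
apply: (@sum_root_valE R V d k D #|S| (Ordinal d_gt0) _ rho inp vid X (fun i => ord (X i))) => //.
- by move=> i; apply: S_card.
- by move=> i; have [] := h1 i.
- by move=> i; have [_ e _ _ _] := h1 i; rewrite X_sid in e.
- by move=> i; have [_ _ _ e _] := h1 i; rewrite X_sid in e.
- by move=> i s s' ss; have [_ _ _ _ e] := h1 i; rewrite -(e s s' ss) X_sid.
- by move=> i; case: (h_supp (X_S i)).
- move=> i; have := perm_size (nbE i); rewrite size_mkseq size_map -cardE => ->.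
  rewrite -S_deg; exact: (max_degree_le (X_S i)).
- move=> i j jd; have : in_nbr inp i j \in [seq sid Y | Y <- enum (neighbours S (X i))].
    by rewrite -(perm_mem (nbE i)); apply/mapP; exists j; rewrite // mem_iota.
  by case/mapP => Y; rewrite mem_enum inE => /andP[YS _] ->; apply: sid_lt.
move=> i y; rewrite (touch_neighbours X_inj X_S) => yn.
have : nat_of_ord y \in mkseq (in_nbr inp i) (in_deg inp i).
  by rewrite (perm_mem (nbE i)) -X_sid; apply: map_f; rewrite mem_enum.
by case/mapP => j; rewrite mem_iota /= => jd ->; exists j.
Qed.

End Presentation.

Section Coefficients.
Variables (R : realType) (V : finType) (d D : nat) (i0 : 'I_d) (S : {set {set V}}).
Variables (lam : {set V} -> R) (h : {set V} -> op R V d) (rho : V -> 'M[R[i]]_d).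
Hypothesis lam_le : forall X, X \in S -> (`|lam X| <= 1)%R.
Hypothesis h_supp : forall X, X \in S -> is_supp (h X) X.
Hypothesis h_norm : forall X, X \in S -> opnorm (h X) = 1%R.
Hypothesis S_deg : max_degree S = D.
Hypothesis D_gt0 : 0 < D.
Hypothesis rho_density : forall v, density_op (rho v).

Lemma log_coef_le (r : R) N : (0 < r -> 10%:R * D%:R * D.+1%:R * r <= 1 ->
  \sum_(m < N) cabs (logc (echo_coef rho (hamiltonian S lam h)) m) * r ^+ m <= #|S|%:R)%R.
Proof.
move=> r0 r_le; pose X : 'I_#|S| -> {set V} := fun i => enum_val i.
have X_inj : injective X by apply: enum_val_inj.
have X_S i : X i \in S by apply: enum_valP.
rewrite -(partial_ham_index X_inj X_S) -lecR.
have := @logc_norm_le R[i] 'I_#|S| (touch X) D (touch_sym X) _ D_gt0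
  (fun B => echo_coef rho (partial_ham (fun i => lam (X i)) (fun i => h (X i)) B))
  (seq_coef rho (fun i => lam (X i)) (fun i => h (X i))) _ _ _ _ r%:C%C [set: _] N.
rewrite cardsT card_ord !rmorph_nat rmorph_sum /= => hh.
under eq_bigr => m _ do rewrite rmorphM rmorphXn /= -cabsE.
apply: hh.
- by move=> i; rewrite -S_deg; apply: touch_degree.
- by move=> B j; apply: echo_coef_seq.
- by apply: seq_coef_le => // i; [apply: lam_le | apply: h_norm].
- by move=> B; apply: echo_coef0.
- by move=> B C j sBC; apply: (echo_coefM i0 rho_density) sBC => i; case: (h_supp (X_S i)).
- by rewrite ltcR.
by rewrite -lecR in r_le; move: r_le; rewrite !rmorphM !rmorph_nat.
Qed.

End Coefficients.

From mathcomp Require Import all_classical all_reals all_analysis.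
Import numFieldNormedType.Exports.

(** * Complex limits and power series *)

Local Open Scope classical_set_scope.
Local Open Scope complex_scope.
Local Open Scope ring_scope.

Section ComplexLimits.
Variable R : realType.
Implicit Types (u v : nat -> R[i]) (z w l : R[i]).
Local Notation Re := (@complex.Re R).
Local Notation Im := (@complex.Im R).

Lemma Re_le_cabs z : `|Re z| <= cabs z.
Proof. by rewrite -lecR -cabsE normc_ge_Re. Qed.

Lemma Im_le_cabs z : `|Im z| <= cabs z.
Proof.
have -> : Im z = Re (- 'i%C * z) by case: z => a b /=; ring.
apply: le_trans (Re_le_cabs _) _.
rewrite cabsM (_ : cabs _ = 1) ?mul1r //.
by apply: complexI; rewrite -cabsE normrN normc_def /= expr0n add0r expr1n sqrtr1.
Qed.

Lemma cabs_le_ReIm z : cabs z <= `|Re z| + `|Im z|.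
Proof.
rewrite {1}(complexE z); apply: le_trans (cabsD _ _) _.
rewrite cabsM !cabs_norm (_ : cabs 'i%C = 1) ?mul1r //.
by apply: complexI; rewrite -cabsE normc_def /= expr0n add0r expr1n sqrtr1.
Qed.

(** Taking real and imaginary parts lets the theorems on real limits be used; [ccvg_lim] leads back
    to the limit in R[i]. *)
Definition ccvg u l :=
  (fun n => Re (u n)) @ \oo --> Re l /\ (fun n => Im (u n)) @ \oo --> Im l.

Lemma ccvg_dist u l (eps : R) : ccvg u l -> 0 < eps ->
  \forall n \near \oo, cabs (l - u n) < eps.
Proof.
move=> [/cvgrPdist_lt h1 /cvgrPdist_lt h2] e0.
have e2 : 0 < eps / 2 by rewrite divr_gt0.
near=> n; apply: le_lt_trans (cabs_le_ReIm _) _.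
rewrite (splitr eps) !raddfB /=; apply: ltrD.
  by near: n; apply: h1.
by near: n; apply: h2.
Unshelve. all: by end_near. Qed.

Lemma ccvg_le u l w (E : R) n0 : ccvg u l ->
  (forall n, (n0 <= n)%N -> cabs (u n - w) <= E) -> cabs (l - w) <= E.
Proof.
move=> ul h; apply/ler_addgt0Pr => e e0.
have /ccvg_dist/(_ e0) [N _ hN] := ul.
have -> : l - w = (u (maxn n0 N) - w) + (l - u (maxn n0 N)) by ring.
apply: le_trans (cabsD _ _) _; apply: lerD; first by apply: h; rewrite leq_maxl.
by apply: ltW; apply: hN => /=; rewrite leq_maxr.
Qed.

Lemma ccvg_lim u l : ccvg u l -> (limn (u : nat -> R[i]^o) : R[i]) = l.
Proof.
move=> ul; apply: (@cvg_lim (R[i]^o)); first exact: norm_hausdorff.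
apply/cvgrPdist_lt => e e0.
have eE : e = (Re e)%:C by rewrite RRe_real // gtr0_real.
have := ccvg_dist ul; move/(_ (Re e)) => h.
near=> n; rewrite eE cabsE ltcR; near: n; apply: h.
by rewrite -ltcR -eE.
Unshelve. all: by end_near. Qed.

Lemma ccvg_eq u v l : u =1 v -> ccvg u l -> ccvg v l.
Proof. by move=> uv; rewrite /ccvg; under eq_fun do rewrite uv; under [X in _ /\ X @ _ --> _]eq_fun do rewrite uv. Qed.

Lemma ccvg_cst l : ccvg (fun _ => l) l.
Proof. by split; apply: cvg_cst. Qed.

Lemma ccvgD u v z w : ccvg u z -> ccvg v w -> ccvg (fun n => u n + v n) (z + w).
Proof.
move=> [u1 u2] [v1 v2]; split; under eq_fun do rewrite raddfD; rewrite raddfD; exact: cvgD.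
Qed.

Lemma ccvgN u z : ccvg u z -> ccvg (fun n => - u n) (- z).
Proof. by move=> [u1 u2]; split; under eq_fun do rewrite raddfN; rewrite raddfN; apply: cvgN. Qed.

Lemma complex_ReD z w : Re (z + w) = Re z + Re w.
Proof. by case: z => a b; case: w. Qed.

Lemma complex_ImD z w : Im (z + w) = Im z + Im w.
Proof. by case: z => a b; case: w. Qed.

Lemma complex_ReM z w : Re (z * w) = Re z * Re w - Im z * Im w.
Proof. by case: z => a b; case: w. Qed.

Lemma complex_ImM z w : Im (z * w) = Re z * Im w + Im z * Re w.
Proof. by case: z => a b; case: w. Qed.

Lemma ccvgM u v z w : ccvg u z -> ccvg v w -> ccvg (fun n => u n * v n) (z * w).
Proof.
move=> [u1 u2] [v1 v2]; split.
  by under eq_fun do rewrite complex_ReM; rewrite complex_ReM; apply: cvgB; apply: cvgM.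
by under eq_fun do rewrite complex_ImM; rewrite complex_ImM; apply: cvgD; apply: cvgM.
Qed.

Lemma ccvg_sum (I : Type) (r : seq I) (F : I -> nat -> R[i]) (L : I -> R[i]) :
  (forall i, ccvg (F i) (L i)) ->
  ccvg (fun n => \sum_(i <- r) F i n) (\sum_(i <- r) L i).
Proof.
move=> h; elim: r => [|i r IH].
  by rewrite big_nil; apply: ccvg_eq (ccvg_cst 0) => n; rewrite big_nil.
rewrite big_cons; apply: ccvg_eq (ccvgD (h i) IH) => n.
by rewrite big_cons.
Qed.

Lemma ccvg_uniq u z w : ccvg u z -> ccvg u w -> z = w.
Proof. by move=> uz uw; rewrite -(ccvg_lim uz) (ccvg_lim uw). Qed.

Lemma ccvg_cexp u z : ccvg u z -> ccvg (fun n => cexp (u n)) (cexp z).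
Proof.
move=> [u1 u2]; rewrite /cexp; apply: ccvgM.
  by split; rewrite /=; [apply: continuous_cvg u1; apply: continuous_expR | apply: cvg_cst].
by split => /=; [apply: continuous_cvg u2; apply: continuous_cos | apply: continuous_cvg u2; apply: continuous_sin].
Qed.

Lemma rsum_cvg (c : nat -> R) (B : R) :
  (forall N, \sum_(m < N) `|c m| <= B) -> cvgn (series c).
Proof.
move=> h; apply: normed_cvg; apply: nondecreasing_is_cvgn.
  by apply: nondecreasing_series => n _ _; apply: normr_ge0.
by exists B => _ [N _ <-]; rewrite /normed_series_of /series /= big_mkord.
Qed.

Lemma csum_cvg (c : nat -> R[i]) (B : R) :
  (forall N, \sum_(m < N) cabs (c m) <= B) ->
  exists l, ccvg (fun N => \sum_(m < N) c m) l.
Proof.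
move=> h.
have h1 : cvgn (series (fun m => Re (c m))).
  apply: (@rsum_cvg _ B) => N; apply: le_trans (h N).
  by apply: ler_sum => m _; apply: Re_le_cabs.
have h2 : cvgn (series (fun m => Im (c m))).
  apply: (@rsum_cvg _ B) => N; apply: le_trans (h N).
  by apply: ler_sum => m _; apply: Im_le_cabs.
exists (limn (series (fun m => Re (c m))) +i* limn (series (fun m => Im (c m)))).
split => /=.
  by under eq_fun do rewrite raddf_sum -(big_mkord xpredT (fun m => Re (c m))).
by under eq_fun do rewrite raddf_sum -(big_mkord xpredT (fun m => Im (c m))).
Qed.

End ComplexLimits.

(** * Complex functions of a real variable *)

Section RealDerivatives.
Variable R : realType.
Implicit Types (u v : R -> R[i]) (z w : R[i]) (s : R).
Local Notation Re := (@complex.Re R).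
Local Notation Im := (@complex.Im R).

Lemma is_derive_add (f g : R -> R) s a b : is_derive s 1 f a -> is_derive s 1 g b ->
  is_derive s 1 (fun x => f x + g x) (a + b).
Proof. by move=> fa gb; apply: is_deriveD. Qed.

Lemma is_derive_sub (f g : R -> R) s a b : is_derive s 1 f a -> is_derive s 1 g b ->
  is_derive s 1 (fun x => f x - g x) (a - b).
Proof. by move=> fa gb; apply: is_deriveB. Qed.

Lemma is_derive_mul (f g : R -> R) s a b : is_derive s 1 f a -> is_derive s 1 g b ->
  is_derive s 1 (fun x => f x * g x) (a * g s + f s * b).
Proof.
move=> fa gb; have h : is_derive s 1 (f * g) (f s *: b + g s *: a) by apply: is_deriveM.
by apply: is_derive_eq h _; rewrite /GRing.scale /=; ring.
Qed.

Definition cder u s w :=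
  is_derive s 1 (fun x => Re (u x) : R) (Re w) /\
  is_derive s 1 (fun x => Im (u x) : R) (Im w).

Lemma cder_cst z s : cder (fun _ => z) s 0.
Proof. by split; apply: is_derive_cst. Qed.

Lemma cder_id s : cder (fun x => x%:C) s 1.
Proof. by split => /=; [apply: is_derive_id | apply: is_derive_cst]. Qed.

Lemma cderD u v s w w' : cder u s w -> cder v s w' ->
  cder (fun x => u x + v x) s (w + w').
Proof.
move=> [u1 u2] [v1 v2]; split; under eq_fun do rewrite raddfD; rewrite raddfD.
  exact: is_derive_add.
exact: is_derive_add.
Qed.

Lemma cderM u v s w w' : cder u s w -> cder v s w' ->
  cder (fun x => u x * v x) s (w * v s + u s * w').
Proof.
move=> [u1 u2] [v1 v2]; split.
  under eq_fun do rewrite complex_ReM.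
  have k := (is_derive_sub (is_derive_mul u1 v1) (is_derive_mul u2 v2)).
  apply: is_derive_eq k _; rewrite complex_ReD !complex_ReM; ring.
under eq_fun do rewrite complex_ImM.
have k := (is_derive_add (is_derive_mul u1 v2) (is_derive_mul u2 v1)).
apply: is_derive_eq k _; rewrite complex_ImD !complex_ImM; ring.
Qed.

Lemma cder_cexp u s w : cder u s w -> cder (fun x => cexp (u x)) s (w * cexp (u s)).
Proof.
move=> [u1 u2].
have dE : is_derive s 1 (fun x => expR (Re (u x))) (expR (Re (u s)) * Re w).
  by apply: is_derive1_comp.
have dC : is_derive s 1 (fun x => cos (Im (u x))) (- sin (Im (u s)) * Im w).
  by apply: is_derive1_comp.
have dS : is_derive s 1 (fun x => sin (Im (u x))) (cos (Im (u s)) * Im w).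
  by apply: is_derive1_comp.
split; rewrite /cexp.
  under eq_fun do rewrite complex_ReM /= mul0r subr0.
  have k := (is_derive_mul dE dC).
  apply: is_derive_eq k _; rewrite complex_ReM /=; ring.
under eq_fun do rewrite complex_ImM /= mul0r addr0.
have k := (is_derive_mul dE dS).
apply: is_derive_eq k _; rewrite complex_ImM /=; ring.
Qed.

Lemma cder_horner (p : {poly R[i]}) z s :
  cder (fun x => p.[z * x%:C]) s (z * p^`().[z * s%:C]).
Proof.
have dz : cder (fun x => z * x%:C) s z.
  have := cderM (cder_cst z s) (cder_id s).
  by rewrite mul0r add0r mulr1.
elim/poly_ind: p => [|p c IH].
  rewrite deriv0 horner0 mulr0 (_ : (fun x => _) = (fun _ => 0)); last first.
    by apply/funext => x; rewrite horner0.
  exact: cder_cst.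
rewrite (_ : (fun x => _) = (fun x => p.[z * x%:C] * (z * x%:C) + c)); last first.
  by apply/funext => x; rewrite hornerMXaddC.
have := cderD (cderM IH dz) (cder_cst c s).
by rewrite addr0 derivMXaddC hornerD hornerM hornerX; congr cder; ring.
Qed.

(** The mean value theorem is applied to the real and the imaginary part separately, hence the
    factor 2. *)
Lemma cder_bound u (du : R -> R[i]) (E : R) :
  (forall s, cder u s (du s)) -> (forall s, 0 <= s <= 1 -> cabs (du s) <= E) ->
  cabs (u 1 - u 0) <= 2 * E.
Proof.
move=> hu hE.
have bnd (g dg : R -> R) : (forall s, is_derive s 1 g (dg s)) ->
    (forall s, 0 <= s <= 1 -> `|dg s| <= E) -> `|g 1 - g 0| <= E.
  move=> hg hb; have [|c c01 ->] := @MVT R g dg 0 1 ltr01 (fun s _ => hg s).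
    apply: derivable_within_continuous => s _; exact: ex_derive.
  rewrite subr0 mulr1; apply: hb; move: c01; rewrite in_itv /= => /andP[h1 h2].
  by rewrite !ltW.
apply: le_trans (cabs_le_ReIm _) _; rewrite !raddfB /= mulr_natl mulr2n; apply: lerD.
  apply: (bnd (fun x => Re (u x)) (fun x => Re (du x))) => s; first by case: (hu s).
  by move=> /hE; apply: le_trans; apply: Re_le_cabs.
apply: (bnd (fun x => Im (u x)) (fun x => Im (du x))) => s; first by case: (hu s).
by move=> /hE; apply: le_trans; apply: Im_le_cabs.
Qed.

Lemma cabs_cexp z : cabs (cexp z) = expR (Re z).
Proof.
rewrite /cexp cabsM cabs_norm ger0_norm ?expR_ge0 // (_ : cabs _ = 1) ?mulr1 //.
by apply: complexI; rewrite -cabsE normc_def /= cos2Dsin2 sqrtr1.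
Qed.

Lemma cexpN z : cexp z * cexp (- z) = 1.
Proof.
case: z => x y; rewrite /cexp /= cosN sinN expRN.
have e0 : (expR x)%:C != 0 :> R[i] by rewrite (inj_eq (@complexI R) _ 0) gt_eqF ?expR_gt0.
rewrite fmorphV /=.
have -> : (expR x)%:C * (cos y +i* sin y) * ((expR x)%:C^-1 * (cos y +i* (- sin y)))
  = ((expR x)%:C / (expR x)%:C) * ((cos y +i* sin y) * (cos y +i* (- sin y))) by ring.
rewrite divff // mul1r; apply/eqP; rewrite eq_complex /=.
have -> : cos y * cos y - sin y * - sin y = 1 by rewrite -(cos2Dsin2 y); ring.
by rewrite eqxx /=; apply/eqP; ring.
Qed.

Lemma cexp0 : cexp (0 : R[i]) = 1.
Proof.
by rewrite /cexp /= expR0 cos0 sin0 mul1r.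
Qed.

End RealDerivatives.

(** * Power series, holomorphy and the logarithm *)

Section PowerSeries.
Variable R : realType.
Implicit Types (z w : R[i]).

Lemma cabsX z n : cabs (z ^+ n) = cabs z ^+ n.
Proof.
elim: n => [|n IH]; last by rewrite !exprS cabsM IH.
by rewrite !expr0 -[1]/(1%:C) cabs_norm normr1.
Qed.

Lemma cabsN z : cabs (- z) = cabs z.
Proof. by rewrite /cabs normrN. Qed.

Lemma cabs0 : cabs (0 : R[i]) = 0.
Proof. by apply/eqP; rewrite cabs_eq0. Qed.

Lemma cabs_sum (I : Type) (s : seq I) (P : pred I) (F : I -> R[i]) :
  cabs (\sum_(i <- s | P i) F i) <= \sum_(i <- s | P i) cabs (F i).
Proof.
elim/big_rec2: _ => [|i x y _ h]; first by rewrite cabs0.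
by apply: le_trans (cabsD _ _) _; rewrite lerD2l.
Qed.

(** With p = sqrt q, m p^m is at most the sum of p^i for i < m, hence at most 1 / (1 - p); squaring
    gives the claim. *)
Lemma sqr_geom_bounded (q : R) : 0 <= q < 1 -> exists2 c, 0 <= c &
  forall m, m%:R ^+ 2 * q ^+ m <= c.
Proof.
move=> /andP[q0 q1]; pose p := Num.sqrt q.
have pq : q = p ^+ 2 by rewrite sqr_sqrtr.
have p0 : 0 <= p by apply: sqrtr_ge0.
have p1 : p < 1 by rewrite -(@ltr_pXn2r _ 2) ?nnegrE // expr1n -pq.
exists ((1 - p)^-1 ^+ 2); first by rewrite exprn_ge0 ?invr_ge0 ?subr_ge0 ?ltW.
move=> m; rewrite pq exprAC -exprMn lerXn2r ?nnegrE ?invr_ge0 ?subr_ge0 ?(ltW p1) ?mulr_ge0 ?exprn_ge0 //.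
apply: le_trans (geom_le m p0 p1).
rewrite mulr_natl -[X in _ *+ X](card_ord m) -sumr_const; apply: ler_sum => i _.
by apply: ler_wiXn2l => //; [apply: ltW | apply: ltnW].
Qed.

(** By induction on m, using m^2 + m <= (m + 1)^2. The factor s^2 on the left avoids the exponent m
    - 2. *)
Lemma power_taylor_le w z (s : R) m : 0 <= s -> cabs w <= s -> cabs z <= s ->
  cabs (w ^+ m - z ^+ m - (w - z) * (m%:R * z ^+ m.-1)) * s ^+ 2
    <= cabs (w - z) ^+ 2 * (m%:R ^+ 2 * s ^+ m).
Proof.
move=> s0 ws zs; elim: m => [|m IH].
  by rewrite !expr0 mul0r mulr0 subr0 subrr cabs0 !mul0r expr0n /= mul0r mulr0.
have -> : w ^+ m.+1 - z ^+ m.+1 - (w - z) * (m.+1%:R * z ^+ m.+1.-1)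
  = w * (w ^+ m - z ^+ m - (w - z) * (m%:R * z ^+ m.-1))
     + (w - z) ^+ 2 * (m%:R * z ^+ m.-1).
  case: m {IH} => [|m]; first by rewrite /= !expr1 !expr0; ring.
  by rewrite /= -natr1 !exprS; ring.
apply: le_trans (ler_wpM2r _ (cabsD _ _)) _; first by rewrite exprn_ge0.
rewrite mulrDl cabsM.
have h1 : cabs w * cabs (w ^+ m - z ^+ m - (w - z) * (m%:R * z ^+ m.-1)) * s ^+ 2
   <= s * (cabs (w - z) ^+ 2 * (m%:R ^+ 2 * s ^+ m)).
  by rewrite -mulrA; apply: ler_pM; rewrite ?cabs_ge0 ?mulr_ge0 ?cabs_ge0 ?exprn_ge0.
have h2 : cabs ((w - z) ^+ 2 * (m%:R * z ^+ m.-1)) * s ^+ 2 <=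
    cabs (w - z) ^+ 2 * (m%:R * s ^+ m.+1).
  rewrite cabsM cabsX -mulrA ler_wpM2l ?exprn_ge0 ?cabs_ge0 // cabsM.
  rewrite (_ : cabs m%:R = m%:R); last first.
    by apply: complexI; rewrite -cabsE normr_nat rmorph_nat.
  case: m {IH h1} => [|m] /=; first by rewrite !mul0r.
  rewrite -mulrA ler_wpM2l // cabsX -[m.+2]addn2 exprD ler_wpM2r ?exprn_ge0 //.
  by rewrite lerXn2r ?nnegrE ?cabs_ge0.
apply: le_trans (lerD h1 h2) _.
rewrite mulrCA -mulrDr ler_wpM2l ?exprn_ge0 ?cabs_ge0 //.
rewrite mulrCA -exprS -mulrDl ler_wpM2r ?exprn_ge0 // -natr1 -subr_ge0.
have -> : (m%:R + 1) ^+ 2 - (m%:R ^+ 2 + m%:R) = m%:R + 1 :> R by ring.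
by rewrite addr_ge0.
Qed.

Section OneSeries.
Variables (r B : R) (a : nat -> R[i]).
Hypothesis r0 : 0 < r.
Hypothesis aB : forall N, \sum_(m < N) cabs (a m) * r ^+ m <= B.

Definition psum z N := \sum_(m < N) a m * z ^+ m.

Definition pseries_sum z : R[i] := limn (psum z : nat -> R[i]^o).

Lemma pseries_bound_ge0 : 0 <= B.
Proof. by have := aB 0; rewrite big_ord0. Qed.

Lemma weight_bound (k : nat -> R) (s c : R) N : 0 <= c ->
  (forall m, k m * (s / r) ^+ m <= c) ->
  \sum_(m < N) cabs (a m) * (k m * s ^+ m) <= c * B.
Proof.
move=> c0 kc.
apply: le_trans (ler_wpM2l c0 (aB N)); rewrite mulr_sumr; apply: ler_sum => m _.
rewrite [leRHS]mulrCA ler_wpM2l ?cabs_ge0 //.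
by have := kc m; rewrite expr_div_n mulrA ler_pdivrMr ?exprn_gt0.
Qed.

Lemma psum_le z N : cabs z <= r -> \sum_(m < N) cabs (a m * z ^+ m) <= B.
Proof.
move=> zr; apply: le_trans (aB N); apply: ler_sum => m _.
by rewrite cabsM cabsX ler_wpM2l ?cabs_ge0 // lerXn2r ?nnegrE ?cabs_ge0 // ltW.
Qed.

Lemma psum_cvg z : cabs z <= r -> ccvg (psum z) (pseries_sum z).
Proof.
move=> zr; have [l pl] := @csum_cvg _ (fun m => a m * z ^+ m) B (fun N => psum_le N zr).
by rewrite /pseries_sum (ccvg_lim pl).
Qed.

(** From degree N on, |z|^m is at most (|z|/r)^N r^m. *)
Lemma pseries_tail z N : cabs z <= r ->
  cabs (pseries_sum z - psum z N) <= (cabs z / r) ^+ N * B.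
Proof.
move=> zr; apply: (@ccvg_le _ _ _ _ _ N (psum_cvg zr)) => n Nn.
rewrite /psum -(big_mkord xpredT (fun m => a m * z ^+ m)) (big_cat_nat _ Nn) //=.
rewrite big_mkord addrAC subrr add0r; apply: le_trans (cabs_sum _ _ _) _.
have q0 : 0 <= cabs z / r by rewrite divr_ge0 ?cabs_ge0 // ltW.
have q1 : cabs z / r <= 1 by rewrite ler_pdivrMr // mul1r.
apply: le_trans (ler_wpM2l _ (aB n)); last by rewrite exprn_ge0.
rewrite mulr_sumr -(big_mkord xpredT (fun m => (cabs z / r) ^+ N * (cabs (a m) * r ^+ m))).
rewrite [leRHS](big_cat_nat _ Nn) //= ler_wpDl //.
  by apply: sumr_ge0 => m _; rewrite !mulr_ge0 ?exprn_ge0 ?cabs_ge0 // ltW.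
rewrite !big_nat; apply: ler_sum => m /andP[Nm _].
rewrite cabsM cabsX [leRHS]mulrCA ler_wpM2l ?cabs_ge0 //.
apply: le_trans (_ : (cabs z / r) ^+ m * r ^+ m <= _).
  by rewrite -exprMn divfK // gt_eqF.
by rewrite ler_wpM2r ?exprn_ge0 ?(ltW r0) // ler_wiXn2l.
Qed.

Lemma pseries_sum0 : pseries_sum 0 = a 0%N.
Proof.
have z0 : cabs (0 : R[i]) <= r by rewrite cabs0 ltW.
apply: ccvg_uniq (psum_cvg z0) _; split; apply: cvg_near_cst; exists 1%N => // n /= n1.
  by rewrite /psum -(subnK n1) addn1 big_ord_recl big1 /= ?expr0 ?mulr1 ?addr0 // => m _; rewrite expr0n mulr0.
by rewrite /psum -(subnK n1) addn1 big_ord_recl big1 /= ?expr0 ?mulr1 ?addr0 // => m _; rewrite expr0n mulr0.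
Qed.

(** The second-order Taylor bound holds for the partial sums with a constant independent of N, so it
    survives the limit; the radius s between |z| and r absorbs the factor m^2. *)
Lemma pseries_holomorphic z : cabs z < r -> holomorphic_at pseries_sum z.
Proof.
move=> zr; have z0 := cabs_ge0 z.
have [s zs sr] : exists2 s, cabs z < s & s < r by exists ((cabs z + r) / 2); lra.
have s0 : 0 < s by apply: le_lt_trans zs.
have q01 : 0 <= s / r < 1 by rewrite divr_ge0 ?(ltW s0) ?(ltW r0) //= ltr_pdivrMr // mul1r.
have [c c0 hc] := sqr_geom_bounded q01.
(* Adding 1 keeps C positive, as it is divided by below. *)
pose C := c * B / s ^+ 2 + 1.
have C0 : 0 < C by rewrite ltr_wpDl // divr_ge0 ?exprn_ge0 ?(ltW s0) // mulr_ge0 ?pseries_bound_ge0.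
pose dsum N := \sum_(m < N) a m * (m%:R * z ^+ m.-1).
have [l dl] : exists l, ccvg dsum l.
  apply: (@csum_cvg _ (fun m => a m * (m%:R * z ^+ m.-1)) (c * B / s)) => N; rewrite ler_pdivlMr // mulr_suml.
  apply: le_trans (weight_bound N c0 hc); apply: ler_sum => m _.
  rewrite cabsM -mulrA ler_wpM2l ?cabs_ge0 // cabsM cabsX.
  rewrite (_ : cabs m%:R = m%:R); last first.
    by apply: complexI; rewrite -cabsE normr_nat rmorph_nat.
  case: m => -[|m] mN /=; first by rewrite !mul0r expr0n /= mul0r.
  rewrite -mulrA; apply: ler_pM; rewrite ?mulr_ge0 ?exprn_ge0 ?(ltW s0) //.
    by rewrite expr2 ler_peMl // ler1n.
  by rewrite [s ^+ _]exprSr ler_wpM2r ?(ltW s0) // lerXn2r ?nnegrE ?(ltW s0) ?(ltW zs).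
have taylor w : cabs w <= s ->
    cabs (pseries_sum w - pseries_sum z - (w - z) * l) <= C * cabs (w - z) ^+ 2.
  move=> ws; rewrite -[X in cabs X]subr0.
  have wr : cabs w <= r by apply: le_trans ws (ltW sr).
  apply: (@ccvg_le _ (fun N => psum w N - psum z N - (w - z) * dsum N) _ _ _ 0%N).
    apply: ccvgD; last by apply: ccvgN; apply: ccvgM => //; apply: ccvg_cst.
    by apply: ccvgD; [|apply: ccvgN]; apply: psum_cvg => //; apply: ltW.
  move=> N _; rewrite subr0 /psum /dsum mulr_sumr -!sumrB.
  apply: le_trans (cabs_sum _ _ _) _.
  apply: le_trans (_ : _ <= c * B / s ^+ 2 * cabs (w - z) ^+ 2) _; last first.
    by rewrite ler_wpM2r ?exprn_ge0 ?cabs_ge0 // /C lerDl.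
  rewrite mulrAC ler_pdivlMr ?exprn_gt0 // mulr_suml.
  apply: le_trans (ler_wpM2r _ (weight_bound N c0 hc)); last by rewrite exprn_ge0 ?cabs_ge0.
  rewrite mulr_suml; apply: ler_sum => m _.
  have -> : a m * w ^+ m - a m * z ^+ m - (w - z) * (a m * (m%:R * z ^+ m.-1))
    = a m * (w ^+ m - z ^+ m - (w - z) * (m%:R * z ^+ m.-1)) by ring.
  rewrite cabsM -[leLHS]mulrA -[leRHS]mulrA ler_wpM2l ?cabs_ge0 //.
  by rewrite [leRHS]mulrC; apply: power_taylor_le => //; exact: ltW.
apply/cvg_ex; exists l; apply/cvgrPdist_le => e e0.
have eE : e = (complex.Re e)%:C by rewrite RRe_real // gtr0_real.
have e0' : 0 < complex.Re e by rewrite -ltcR -eE.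
near=> h.
have h0 : h != 0 by near: h; exact: nbhs_dnbhs_neq.
have hs : cabs h <= s - cabs z.
  rewrite -lecR -cabsE; near: h; apply: dnbhs0_le.
  by rewrite ltcR subr_gt0.
have he : cabs h <= complex.Re e / C.
  rewrite -lecR -cabsE; near: h; apply: dnbhs0_le.
  by rewrite ltcR divr_gt0.
rewrite eE cabsE lecR /=.
have hC : 0 < cabs h by rewrite lt_def cabs_eq0 h0 cabs_ge0.
rewrite /GRing.scale /= mulr1.
have hz : cabs (h + z) <= s by apply: le_trans (cabsD _ _) _; lra.
have := taylor _ hz; rewrite addrK => tl.
rewrite -(ler_pM2l hC) -cabsM mulrBr mulVKf //.
rewrite -cabsN opprB; apply: le_trans tl _.
rewrite expr2 mulrCA ler_pM2l // mulrC.
by rewrite -ler_pdivlMr.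
Unshelve. all: by end_near. Qed.

End OneSeries.

Section LogBranch.
Variables (r Ba Bf : R) (f : nat -> R[i]) (F : R[i] -> R[i]).
Hypothesis r0 : 0 < r.
Hypothesis f0 : f 0%N = 1.
Hypothesis aB : forall N, \sum_(m < N) cabs (logc f m) * r ^+ m <= Ba.
Hypothesis fB : forall N, \sum_(m < N) cabs (f m) * r ^+ m <= Bf.
Hypothesis FE : forall z, cabs z < r -> ccvg (psum f z) (F z).

Lemma psum_horner (b : nat -> R[i]) z N : psum b z N = (\poly_(m < N) b m).[z].
Proof. by rewrite horner_poly. Qed.

Lemma cabs_nat n : cabs (n%:R : R[i]) = n%:R.
Proof. by apply: complexI; rewrite -cabsE normr_nat rmorph_nat. Qed.

Lemma nrm_cabs L (p : {poly R[i]}) (s : R) :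
  nrm L s%:C p = (\sum_(i < L) cabs p`_i * s ^+ i)%:C.
Proof. by rewrite rmorph_sum; apply: eq_bigr => i _; rewrite cabsE -rmorphXn -rmorphM. Qed.

Lemma nrm_poly_le (b : nat -> R[i]) (Bb s : R) N L : 0 <= s <= r ->
  (forall n, \sum_(m < n) cabs (b m) * r ^+ m <= Bb) ->
  nrm L s%:C (\poly_(m < N) b m) <= Bb%:C.
Proof.
move=> /andP[s0 sr] bB; rewrite nrm_cabs lecR; apply: le_trans (bB L).
apply: ler_sum => i _; rewrite coef_poly; case: ifP => _.
  by rewrite ler_wpM2l ?cabs_ge0 // lerXn2r ?nnegrE // ltW.
by rewrite cabs0 mul0r mulr_ge0 ?cabs_ge0 ?exprn_ge0 // ltW.
Qed.

Lemma nrm_eul_le (b : nat -> R[i]) (Bb s c : R) N L : 0 <= c -> 0 <= s ->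
  (forall m, m%:R ^+ 2 * (s / r) ^+ m <= c) ->
  (forall n, \sum_(m < n) cabs (b m) * r ^+ m <= Bb) ->
  nrm L s%:C (eul (\poly_(m < N) b m)) <= (c * Bb)%:C.
Proof.
move=> c0 s0 hc bB; rewrite nrm_cabs lecR.
have hc' m : m%:R * (s / r) ^+ m <= c.
  apply: le_trans (hc m); rewrite ler_wpM2r ?exprn_ge0 ?divr_ge0 ?(ltW r0) //.
  by case: m => [|m]; rewrite ?expr0n // expr2 ler_peMl // ler1n.
apply: le_trans (weight_bound r0 bB L c0 hc'); apply: ler_sum => i _.
rewrite coef_eul -[_ *+ i]mulr_natr cabsM cabs_nat -mulrA coef_poly; case: ifP => _ //.
by rewrite cabs0 mul0r !mulr_ge0 ?cabs_ge0 ?exprn_ge0.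
Qed.

(** For the truncations P of f and G of its logarithm, P exp(-G) has on the segment from 0 to z a
    derivative of order q^N, because the logarithmic equation fails only from degree N on. In the
    limit F exp(-log) equals its value 1 at 0. *)
Lemma log_branch_pseries : log_branch F r (pseries_sum (logc f)).
Proof.
split; first by move=> z; apply: pseries_holomorphic aB _.
  move=> z zr; have [->|z0] := eqVneq z 0.
    rewrite (pseries_sum0 r0 aB) logcE /= cexp0.
    have c0 : cabs (0 : R[i]) < r by rewrite cabs0.
    have c0' := ltW c0.
    have := ccvg_uniq (FE c0) (psum_cvg r0 fB c0').
    by rewrite (pseries_sum0 r0 fB) f0.
  have Z0 : 0 < cabs z by rewrite lt_def cabs_eq0 z0 cabs_ge0.
  have [s zs sr] : exists2 s, cabs z < s & s < r by exists ((cabs z + r) / 2); lra.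
  have s0 : 0 < s by apply: lt_trans zs.
  have q01 : 0 <= s / r < 1 by rewrite divr_ge0 ?(ltW s0) ?(ltW r0) //= ltr_pdivrMr // mul1r.
  have [c c0 hc] := sqr_geom_bounded q01.
  pose BB := c * Bf + c * Ba * Bf.
  pose q := cabs z / s.
  have q0 : 0 <= q by rewrite divr_ge0 ?(ltW Z0) ?(ltW s0).
  have q1 : q < 1 by rewrite ltr_pdivrMr // mul1r.
  have key N : cabs (psum f z N * cexp (- psum (logc f) z N) - psum f 0 N) <=
      2 * (q ^+ N * (BB * expR Ba)).
    pose PN := \poly_(m < N) f m; pose GN := \poly_(m < N) logc f m.
    pose Q := PN^`() - GN^`() * PN; pose E := eul PN - eul GN * PN.
    have EQ : E = 'X * Q by rewrite /E /Q /eul; ring.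
    have E0 i : (i < N)%N -> E`_i = 0.
      move=> iN; have [_ /(_ i iN)] := islog_logc N f0.
      by rewrite -/PN -/GN /E coefB => ->; rewrite subrr.
    (* With E = X Q the left side is at most the sum of |E_j| |z|^j over j >= N, and |z|^j <= q^N
       s^j there. The norms at s < r are finite although the Euler operator multiplies coefficients
       by their degree. *)
    have QB w : cabs w <= cabs z -> cabs z * cabs Q.[w] <= q ^+ N * BB.
      move=> wz; pose L := (size Q).+1.
      apply: (@le_trans _ _ (\sum_(j < L) cabs E`_j * cabs z ^+ j)).
        rewrite big_ord_recl ler_wpDl ?mulr_ge0 ?cabs_ge0 // horner_coef.
        apply: le_trans (ler_wpM2l (ltW Z0) (cabs_sum _ _ _)) _.
        rewrite mulr_sumr; apply: ler_sum => i _.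
        rewrite lift0 EQ coefXM /= cabsM cabsX exprS mulrCA.
        rewrite ler_wpM2l ?cabs_ge0 // ler_wpM2l ?cabs_ge0 //.
        by rewrite lerXn2r ?nnegrE ?cabs_ge0.
      apply: (@le_trans _ _ (q ^+ N * \sum_(j < L) cabs E`_j * s ^+ j)).
        rewrite mulr_sumr; apply: ler_sum => j _.
        have [jN|Nj] := ltnP j N; first by rewrite E0 // cabs0 !mul0r mulr0.
        rewrite mulrCA ler_wpM2l ?cabs_ge0 // -[cabs z](@divfK _ s) ?gt_eqF //.
        by rewrite exprMn ler_wpM2r ?exprn_ge0 ?(ltW s0) // ler_wiXn2l // ltW.
      rewrite ler_wpM2l ?exprn_ge0 // -lecR -nrm_cabs.
      have sC : 0 <= s%:C by rewrite ler0c ltW.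
      apply: le_trans (nrmD L sC _ _) _; rewrite nrmN rmorphD /=; apply: lerD.
        by apply: nrm_eul_le => //; exact: ltW.
      apply: le_trans (nrmM L sC _ _) _; rewrite rmorphM /=.
      apply: ler_pM; rewrite ?nrm_ge0 //.
        by apply: nrm_eul_le => //; exact: ltW.
      by apply: nrm_poly_le => //; rewrite !ltW.
    pose u x := PN.[z * x%:C] * cexp ((- GN).[z * x%:C]).
    have := @cder_bound R u _ (q ^+ N * (BB * expR Ba)) (fun x =>
      cderM (cder_horner PN z x) (cder_cexp (cder_horner (- GN) z x))).
    rewrite {1 2}/u mulr1 mulr0 !hornerN -!psum_horner.
    rewrite (_ : psum (logc f) 0 N = 0); last first.
      rewrite /psum big1 // => -[[|m] mN] _ /=; last by rewrite expr0n mulr0.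
      by rewrite logcE mul0r.
    rewrite oppr0 cexp0 mulr1; apply => x /andP[x0 x1].
    have -> : z * PN^`().[z * x%:C] * cexp (- GN).[z * x%:C] +
        PN.[z * x%:C] * (z * (- GN)^`().[z * x%:C] * cexp (- GN).[z * x%:C])
      = z * Q.[z * x%:C] * cexp (- GN).[z * x%:C].
      by rewrite /Q derivN !(hornerD, hornerN, hornerM); ring.
    have wz : cabs (z * x%:C) <= cabs z.
      by rewrite cabsM cabs_norm ger0_norm // ler_piMr ?cabs_ge0.
    rewrite cabsM cabsM mulrA; apply: ler_pM; rewrite ?mulr_ge0 ?cabs_ge0 ?QB //.
    rewrite cabs_cexp ler_expR; apply: le_trans (ler_norm _) _.
    apply: le_trans (Re_le_cabs _) _; rewrite hornerN cabsN -psum_horner.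
    apply: le_trans (cabs_sum _ _ _) _; apply: (psum_le r0 aB).
    by apply: le_trans wz (ltW zr).
  have lim1 : ccvg (fun N => psum f z N * cexp (- psum (logc f) z N))
      (F z * cexp (- pseries_sum (logc f) z)).
    apply: ccvgM; first exact: FE.
    by apply: ccvg_cexp; apply: ccvgN; apply: (psum_cvg r0 aB); exact: ltW.
  have BB0 : 0 <= BB * expR Ba.
    have hA := pseries_bound_ge0 aB; have hF := pseries_bound_ge0 fB.
    by rewrite mulr_ge0 ?expR_ge0 // addr_ge0 // !mulr_ge0.
  have e1 : F z * cexp (- pseries_sum (logc f) z) = 1.
    apply/eqP; rewrite -subr_eq0 -cabs_eq0 eq_le cabs_ge0 andbT.
    have bnd n : cabs (F z * cexp (- pseries_sum (logc f) z) - 1) <= 2 * (q ^+ n * (BB * expR Ba)).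
      apply: (ccvg_le (n0 := n.+1) lim1) => N nN.
      have := key N; rewrite (_ : psum f 0 N = 1) => [k|].
        apply: le_trans k _; rewrite ler_wpM2l // ler_wpM2r //.
        by apply: ler_wiXn2l; rewrite ?(ltW q1) // ltnW.
      rewrite /psum -(subnK (leq_ltn_trans (leq0n n) nN)) addn1 big_ord_recl big1 => [|m _].
        by rewrite f0 expr0 mulr1 addr0.
      by rewrite expr0n mulr0.
    have cv : (fun n => 2 * (q ^+ n * (BB * expR Ba))) @ \oo --> 2 * (0 * (BB * expR Ba)).
      apply: cvgM; first exact: cvg_cst.
      by apply: cvgM; [apply: cvg_expr; rewrite ger0_norm | apply: cvg_cst].
    move: cv; rewrite mul0r mulr0 => cv; rewrite leNgt; apply/negP => x0.
    have [n _ /(_ n (leqnn n))] := cvgr_lt _ cv _ x0.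
    by rewrite /= ltNge bnd.
  (* Both [F z] and the exponential of the series are inverse to the same number. *)
  have := cexpN (pseries_sum (logc f) z); rewrite -e1.
  move/mulIf; apply; apply/eqP => h.
  by have := cexpN (pseries_sum (logc f) z); rewrite h mulr0 => /eqP; rewrite eq_sym oner_eq0.
by rewrite (pseries_sum0 r0 aB) logcE.
Qed.

End LogBranch.
End PowerSeries.

(** * Matrix exponentials and the series of the echo *)

Section ExponentialSeries.
Variable R : realType.

Lemma exp_partial_le (x : R) N : 0 <= x -> \sum_(m < N) x ^+ m / m`!%:R <= expR x.
Proof.
move=> x0; have := @nondecreasing_cvgn_le R (series (exp_coeff x)).
rewrite /expR => /(_ _ (is_cvg_series_exp_coeff x) N).
have <- : series (exp_coeff x) N = \sum_(m < N) x ^+ m / m`!%:R.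
  by rewrite /series /= big_mkord.
apply.
apply: nondecreasing_series => n _ _; rewrite /exp_coeff /=.
by rewrite divr_ge0 ?exprn_ge0.
Qed.

Lemma entry_expr_le n (A : 'M[R[i]]_n) m a b :
  cabs ((A ^+ m) a b) <= (\sum_i \sum_j cabs (A i j)) ^+ m.
Proof.
set c := \sum_i _; have c0 : 0 <= c.
  by do 2!(apply: sumr_ge0 => ? _); apply: cabs_ge0.
elim: m a b => [|m IH] a b.
  rewrite !expr0 mxE; case: eqP => _; last by rewrite cabs0.
  by rewrite (cabs_nat R 1).
rewrite !exprS mxE; apply: le_trans (cabs_sum _ _ _) _.
apply: (@le_trans _ _ (\sum_j cabs (A a j) * c ^+ m)).
  by apply: ler_sum => j _; rewrite cabsM ler_wpM2l ?cabs_ge0.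
rewrite -mulr_suml ler_wpM2r ?exprn_ge0 // /c [leRHS](bigD1 a) //= lerDl.
by do 2!(apply: sumr_ge0 => ? _); apply: cabs_ge0.
Qed.

Lemma expmx_cvg n (A : 'M[R[i]]_n) a b :
  ccvg (fun N => \sum_(m < N) (A ^+ m) a b / m`!%:R) (expmx A a b).
Proof.
set c := \sum_i \sum_j cabs (A i j).
have c0 : 0 <= c by do 2!(apply: sumr_ge0 => ? _); apply: cabs_ge0.
have [l hl] : exists l, ccvg (fun N => \sum_(m < N) (A ^+ m) a b / m`!%:R) l.
  apply: (@csum_cvg _ (fun m => (A ^+ m) a b / m`!%:R) (expR c)) => N.
  apply: le_trans (exp_partial_le N c0); apply: ler_sum => m _.
  rewrite cabsM (_ : cabs (m`!%:R^-1) = m`!%:R^-1).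
    by rewrite ler_wpM2r ?invr_ge0 // entry_expr_le.
  by apply: complexI; rewrite -cabsE normfV normr_nat fmorphV rmorph_nat.
suff -> : expmx A a b = l by [].
have E : (series (fun m => (A ^+ m) a b / m`!%:R) : nat -> R[i]^o)
    = (fun N => \sum_(m < N) (A ^+ m) a b / m`!%:R).
  by apply/funext => N; rewrite /series /= big_mkord.
by rewrite mxE E; exact: ccvg_lim hl.
Qed.

Lemma expr_scalemx n (c : R[i]) (A : 'M[R[i]]_n) m : (c *: A) ^+ m = c ^+ m *: A ^+ m.
Proof.
elim: m => [|m IH]; first by rewrite !expr0 scale1r.
by rewrite !exprS IH -[LHS]/((c *: A) *m (c ^+ m *: A ^+ m)) -scalemxAl -scalemxAr scalerA.
Qed.

Section Echo.
Variables (V : finType) (d : nat) (rho : V -> 'M[R[i]]_d) (H : op R V d).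

Lemma loschmidt_cvg z :
  ccvg (psum (echo_coef rho H) z) (loschmidt H (product_state rho) z).
Proof.
rewrite /loschmidt; set A := _ *: H.
have -> : \tr (expmx A *m product_state rho) =
    \sum_a \sum_b expmx A a b * product_state rho b a.
  by apply: eq_bigr => a _; rewrite mxE.
pose u N := \sum_a \sum_b (\sum_(m < N) (A ^+ m) a b / m`!%:R) * product_state rho b a.
apply: (@ccvg_eq _ u); last first.
  apply: ccvg_sum => a; apply: ccvg_sum => b; apply: ccvgM; last exact: ccvg_cst.
  exact: expmx_cvg.
move=> N; rewrite /u /psum.
transitivity (\sum_(m < N) (m`!%:R^-1 * expect rho (A ^+ m))).
  rewrite /expect; under eq_bigr do (under eq_bigr do rewrite mulr_suml; rewrite exchange_big /=).
  rewrite exchange_big; apply: eq_bigr => m _ /=.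
  rewrite mulr_sumr; apply: eq_bigr => a _; rewrite mxE mulr_sumr; apply: eq_bigr => b _.
  by rewrite [_ / _]mulrC mulrA.
apply: eq_bigr => m _; rewrite /A expr_scalemx expectZ /echo_coef.
rewrite (_ : - ('i%C * z) = (- 'i%C) * z) ?exprMn; last by rewrite mulNr.
by ring.
Qed.

End Echo.

Section EchoBound.
Variables (V : finType) (d : nat) (i0 : 'I_d) (rho : V -> 'M[R[i]]_d).
Hypothesis rho_density : forall v, density_op (rho v).
Variables (T : finType) (lam : T -> R) (h : T -> op R V d).
Hypothesis lam_le : forall i, `|lam i| <= 1.
Hypothesis h_norm : forall i, opnorm (h i) = 1.

(** The m-th coefficient is a sum over at most |T|^m words, each of modulus at most 1/m!. *)
Lemma echo_coef_summable (B : {set T}) (r : R) N : 0 <= r ->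
  \sum_(m < N) cabs (echo_coef rho (partial_ham lam h B) m) * r ^+ m <= expR (#|T|%:R * r).
Proof.
move=> r0; have Tr0 : 0 <= #|T|%:R * r by rewrite mulr_ge0.
apply: le_trans (exp_partial_le N Tr0); apply: ler_sum => m _.
rewrite exprMn mulrAC ler_wpM2r ?exprn_ge0 // echo_coef_seq.
apply: le_trans (cabs_sum _ _ _) _.
apply: (@le_trans _ _ (\sum_(s : m.-tuple T) m`!%:R^-1)).
  rewrite big_mkcond; apply: ler_sum => s _; case: ifP => _; last by rewrite invr_ge0.
  rewrite -lecR -cabsE; apply: le_trans (seq_coef_le rho_density lam_le h_norm _) _.
  by rewrite size_tuple fmorphV rmorph_nat.
by rewrite sumr_const card_tuple -[_ *+ _]mulr_natl natrX.
Qed.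

End EchoBound.
End ExponentialSeries.

(** * The program *)

Section Program.
Variables (R : realType) (k d D : nat).

(** With 2^M as the base, polynomial time means a power of e^M, the quantity bounded in the
    statement. *)
Program Definition mainctx : ctx R :=
  @Ctx R (input R * nat * nat) (fun e => e.1.1) (fun e => 2 ^ e.1.2)%N (fun _ => True)
    (fun e s => imem s 0 0 = e.1.2 /\ imem s 1 0 = e.2) 2 _.
Next Obligation.
by move=> [[inp M] r] s s' ss [h1 h2]; have := ss KNat 0%N 0%N isT; have := ss KNat 1%N 0%N isT => /= -> ->.
Qed.

Lemma comp_main :
  @comp R KCpx mainctx (fun e => root_val k d D e.1.1 e.2 e.1.2).
Proof.
apply: (@comp_root_val R k d D mainctx (fun e => e.2) (fun e => e.1.2)).
  by apply: (@comp_leaf R KNat mainctx _ (IGet 1 (INum 0))) => e s _ [].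
split; first by apply: (@comp_leaf R KNat mainctx _ (IGet 0 (INum 0))) => e s _ [].
by exists 1%N, 1%N => e _; rewrite mul1n expn1 /= leqW.
Qed.

Definition exp_tL : cexpr :=
  CDiv (CNat (INum 1))
    (CMul (CMul (CMul (CNat (INum 2)) (CMul (CExp (CNat (INum 1))) (CExp (CNat (INum 1)))))
       (CNat (INum D))) (CAdd (CNat (INum D)) (CNat (INum 1)))).

Definition exp_ratio : cexpr := CDiv (CAbs CTime) exp_tL.

Lemma eval_tL inp s : ceval (R := R) inp s exp_tL = (tL R D)%:C.
Proof.
have c1 : cexp (1%:R : R[i]) = (expR 1)%:C.
  by rewrite /cexp /= cos0 sin0 -[RHS]mulr1.
by rewrite /exp_tL /tL /= c1 expr2 !(fmorphV, rmorphM, rmorphD, rmorph_nat, rmorph1).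
Qed.

Lemma eval_ratio inp s : ceval (R := R) inp s exp_ratio = (cabs (in_time inp) / tL R D)%:C.
Proof. by rewrite -[LHS]/((cabs (in_time inp))%:C / ceval inp s exp_tL) eval_tL; move: (tL R D) => y; rewrite rmorphM fmorphV. Qed.

Definition enough (inp : input R) (M : nat) :=
  (in_nsubs inp)%:R * (cabs (in_time inp) / tL R D) ^+ M.+1 <= in_eps inp.

(** One loop searches for the least order, keeping |S| x^(i+1) in a complex cell. A second one runs
    over the roots and adds up the values that the program of [comp_main] leaves in array 2. *)
Lemma main_program : exists (P : cmd) (K n : nat), forall (inp : input R) N,
  enough inp N -> (forall M, (M < N)%N -> ~~ enough inp M) ->
  exists T s, [/\ exec inp P (init R) T s,
    (T <= K * (in_nsubs inp).+1 * (2 ^ N).+1 ^ n)%N &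
    output s = \sum_(0 <= r < in_nsubs inp) root_val k d D inp r N].
Proof.
have [p [K [n hp]]] := comp_main (leqnn 2).
have natM (a : nat) (y : R) : (a%:R * y)%:C = a%:R * y%:C by rewrite rmorphM rmorph_nat.
pose z := INum 0.
pose b1 := BNot (BLeRe (CGet 1 z) CEps).
pose st1 := Seq (ISet 0 z (IAdd (IGet 0 z) (INum 1))) (CSet 1 z (CMul (CGet 1 z) exp_ratio)).
pose b2 := BNot (BLe INSubs (IGet 1 z)).
pose st2 := Seq p (Seq (CSet 0 z (CAdd (CGet 0 z) (CGet 2 z))) (ISet 1 z (IAdd (IGet 1 z) (INum 1)))).
exists (Seq (CSet 1 z (CMul (CNat INSubs) exp_ratio)) (Seq (While b1 st1) (While b2 st2))).
(* The additional power of 2^N + 1 pays for the N steps of the search, and 1000 is slack for the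
   constant costs. *)
exists (K + 1000)%N, n.+1 => inp N hN hM.
pose x := cabs (in_time inp) / tL R D.
pose I1 i (s : state R) := [/\ imem s 0 0 = i, imem s 1 0 = 0%N, cmem s 0 0 = 0
  & cmem s 1 0 = ((in_nsubs inp)%:R * x ^+ i.+1)%:C].
pose I2 i (s : state R) := [/\ imem s 0 0 = N, imem s 1 0 = i
  & cmem s 0 0 = \sum_(0 <= r < i) root_val k d D inp r N].
have hb1 i s : (i <= N)%N -> I1 i s -> beval inp s b1 = (i < N)%N.
  move=> iN [_ _ _ v]; rewrite /= v /=; case: ltnP => hi; first exact: hM.
  have -> : i = N by apply/eqP; rewrite eqn_leq iN.
  by apply/negbF; exact: hN.
have hs1 i s : (i < N)%N -> I1 i s -> exists T s', [/\ exec inp st1 s T s', (T <= 60)%N & I1 i.+1 s'].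
  move=> iN [v0 v1 w0 w1]; eexists; eexists; split.
  - by apply: ExSeq; [apply: ExISet | apply: ExCSet].
  - by [].
  - split; rewrite /= /upd /= ?v0 ?v1 ?w0 ?addn1 //.
    by have er := eval_ratio inp s; rewrite /= in er; rewrite w1 er -/x -rmorphM -mulrA -exprSr.
have [T1 [s1 [e1 t1 [v0 v1 w0 _]]]] : exists T s', [/\ exec inp (While b1 st1)
    (State (imem (init R)) (upd (cmem (init R)) 1 0 (((in_nsubs inp)%:R * x)%:C))) T s',
    (T <= N * (bcost b1 + 60).+1 + (bcost b1).+1)%N & I1 N s'].
  by apply: (while_loop hb1 hs1); split.
have hb2 i s : (i <= in_nsubs inp)%N -> I2 i s -> beval inp s b2 = (i < in_nsubs inp)%N.
  by move=> iN [_ v _]; rewrite /= v ltnNge.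
have hs2 i s : (i < in_nsubs inp)%N -> I2 i s -> exists T s',
    [/\ exec inp st2 s T s', (T <= K * (2 ^ N).+1 ^ n + 20)%N & I2 i.+1 s'].
  move=> iN [u0 u1 u2].
  have [|T [s' [ex tb sb vb]]] := hp (inp, N, i) s I; first by split.
  have q0 : imem s' 0 0 = N by have := sb KNat 0%N 0%N isT => /= ->.
  have q1 : imem s' 1 0 = i by have := sb KNat 1%N 0%N isT => /= ->.
  have q2 : cmem s' 0 0 = \sum_(0 <= r < i) root_val k d D inp r N.
    by have := sb KCpx 0%N 0%N isT => /= ->.
  eexists; eexists; split.
  - apply: ExSeq ex _; by apply: ExSeq; [apply: ExCSet | apply: ExISet].
  - by apply: leq_add.
  - split; rewrite /= /upd /= ?q0 ?q1 ?q2 ?addn1 //.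
    by rewrite big_nat_recr //=; congr (_ + _); exact: vb.
have [T2 [s2 [e2 t2 [_ _ o2]]]] : exists T s', [/\ exec inp (While b2 st2) s1 T s',
    (T <= in_nsubs inp * (bcost b2 + (K * (2 ^ N).+1 ^ n + 20)).+1 + (bcost b2).+1)%N
    & I2 (in_nsubs inp) s'].
  by apply: (while_loop hb2 hs2); split=> //; rewrite big_geq.
eexists; exists s2; split; last exact: o2.
- apply: ExSeq (ExSeq e1 e2).
  have := ExCSet inp (init R) 1 z (CMul (CNat INSubs) exp_ratio).
  have -> : ceval inp (init R) (CMul (CNat INSubs) exp_ratio) = ((in_nsubs inp)%:R * x)%:C.
    by rewrite -[LHS]/((in_nsubs inp)%:R * ceval inp (init R) exp_ratio) eval_ratio natM.
  by apply.
- have N2 : (N < 2 ^ N)%N by apply: ltn_expl.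
  have pn : (0 < (2 ^ N).+1 ^ n)%N by rewrite expn_gt0.
  have t0 : (icost z + ccost (CMul (CNat INSubs) exp_ratio) <= 60)%N by [].
  rewrite expnS; move: t0 t1 t2 N2 pn.
  have -> : bcost b1 = 5 by []; have -> : bcost b2 = 5 by [].
  move: (icost z + _)%N ((2 ^ N).+1 ^ n)%N (2 ^ N)%N (in_nsubs inp) => c0 a e S t0 t1 t2 N2 pn.
  nia.
Qed.

End Program.

(** * Numerical bounds and the choice of the truncation order *)

Section Bounds.
Variable R : realType.

(** Just enough for 2 e^2 >= 10 in [tL_le], and for 2 <= e in [pow2_le_powR]. *)
Lemma expR1_ge : 9 / 4 <= expR 1 :> R.
Proof.
have h : 3 / 2 <= expR (1 / 2) :> R by apply: le_trans (expR_ge1Dx _); lra.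
have -> : expR 1 = expR (1 / 2) * expR (1 / 2) :> R by rewrite -expRD; congr expR; lra.
nra.
Qed.

Lemma tL_gt0 D : (0 < D)%N -> 0 < tL R D.
Proof.
move=> D0; have D1 : 1 <= D%:R :> R by rewrite ler1n.
have e0 := expR_gt0 (1 : R).
by rewrite /tL divr_gt0 // !mulr_gt0 ?exprn_gt0 //; lra.
Qed.

Lemma tL_le D : (0 < D)%N -> 10%:R * D%:R * D.+1%:R * tL R D <= 1.
Proof.
move=> D0; have D1 : 1 <= D%:R :> R by rewrite ler1n.
have e0 := expR1_ge; rewrite /tL -[D.+1%:R]natr1; move: D%:R D1 (expR 1) e0 => y y1 e e0.
have e5 : 5 <= e ^+ 2 by rewrite expr2; nra.
have yy : 0 < y * (y + 1) by rewrite mulr_gt0 //; lra.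
rewrite mul1r ler_pdivrMr; last by rewrite -mulrA mulr_gt0 //; lra.
rewrite mul1r -mulrA -[leRHS]mulrA ler_wpM2r ?(ltW yy) //; lra.
Qed.

Lemma first_small_power (a x eps : R) : 0 <= x -> x < 1 -> 0 < eps -> 0 < a ->
  exists N : nat, a * x ^+ N.+1 <= eps /\ forall M, (M < N)%N -> ~~ (a * x ^+ M.+1 <= eps).
Proof.
move=> x0 x1 e0 a0; have : exists N : nat, a * x ^+ N.+1 <= eps.
  have cv : ((fun n => x ^+ n) @ \oo --> (0 : R))%classic by apply: cvg_expr; rewrite ger0_norm.
  move/cvgrPdist_le : cv => /(_ (eps / a) (divr_gt0 e0 a0)) [N _ h].
  exists N; have := h N.+1; rewrite /= leqnSn => /(_ isT).
  by rewrite sub0r normrN ger0_norm ?exprn_ge0 // ler_pdivlMr // mulrC.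
move=> ex; case: (ex_minnP ex) => N hN hmin; exists N; split=> // M MN.
by apply/negP => /hmin; rewrite leqNgt MN.
Qed.

(** Taking logarithms gives N ln(1/x) <= ln b, and 2^N <= e^N. *)
Lemma pow2_le_powR (x b : R) N : 0 < x -> x < 1 -> x ^- N <= b -> 2 ^+ N <= powR b (1 / ln x^-1).
Proof.
move=> x0 x1 hb; have xN : 0 < x ^- N by rewrite invr_gt0 exprn_gt0.
have b0 : 0 < b by apply: lt_le_trans hb.
have l0 : 0 < ln x^-1 by rewrite ln_gt0 // invf_gt1.
rewrite /powR gt_eqF // mul1r.
apply: (@le_trans _ _ (expR N%:R)); last first.
  rewrite ler_expR mulrC ler_pdivlMr // mulr_natl -lnXn ?invr_gt0 //.
  by rewrite ler_ln ?posrE ?exprn_gt0 ?invr_gt0 // exprVn.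
rewrite -[N%:R]mulr1 expRM_natl; apply: lerXn2r; rewrite ?nnegrE ?expR_ge0 //.
by have := expR1_ge; lra.
Qed.

Lemma iteration_bound (n : nat) (tl ct eps : R) N : (0 < n)%N -> 0 < eps -> 0 <= ct -> 0 < tl -> ct < tl ->
  (forall M, (M < N)%N -> ~~ (n%:R * (ct / tl) ^+ M.+1 <= eps)) ->
  2 ^+ N <= 1 + powR (n%:R / (1 - ct / tl) * (1 / eps)) (if ct == 0 then 0 else 1 / ln (tl / ct)).
Proof.
move=> n0 e0 c0 tl0 ctl hM; set b := _ * _.
(* The 1 in the bound covers N = 0, where minimality says nothing. *)
case: N hM => [|N] hM; first by rewrite expr0 lerDl powR_ge0.
have := hM N (ltnSn N); rewrite -ltNge => h.
(* At time 0 the error is 0 already for N = 0, so a positive N is contradictory. *)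
case: eqP h => [->|/eqP ct0]; first by rewrite mul0r exprS mul0r mulr0 => /(lt_trans e0); rewrite ltxx.
have cp : 0 < ct by rewrite lt_neqAle eq_sym ct0.
have x0 : 0 < ct / tl by rewrite divr_gt0.
have x1 : ct / tl < 1 by rewrite ltr_pdivrMr // mul1r.
have -> : tl / ct = (ct / tl)^-1 by rewrite invfM invrK mulrC.
move: x0 x1 @b; set y := ct / tl => y0 y1 b h.
apply: le_trans (pow2_le_powR y0 y1 (b := b) (N := N.+1) _) _; last by rewrite lerDr.
have n1 : 0 < n%:R :> R by rewrite ltr0n.
rewrite /b -[leLHS]mul1r ler_pdivrMr ?exprn_gt0 // div1r mulrAC ler_pdivlMr // mul1r.
apply: (le_trans (ltW h)); rewrite ler_wpM2r ?exprn_ge0 ?(ltW y0) //.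
(* Dividing |S| by 1 - |t|/tL only enlarges the base. *)
by rewrite ler_pdivlMr ?subr_gt0 // ler_piMr ?(ltW n1) // lerBlDr lerDl ltW.
Qed.

End Bounds.

Theorem theorem12 (R : realType) (k d D : nat) (hD : (1 <= D)%N) :
  exists (P : cmd) (C c : nat),
    forall (V : finType) (S : {set {set V}}) (lam : {set V} -> R)
      (h : {set V} -> op R V d) (rho : V -> 'M[R[i]]_d),
      (forall X : {set V}, X \in S -> `|lam X| <= 1) ->
      (forall X : {set V}, X \in S -> selfadjoint (h X)) ->
      (forall X : {set V}, X \in S -> is_supp (h X) X) ->
      (forall X : {set V}, X \in S -> opnorm (h X) = 1) ->
      (forall X : {set V}, X \in S -> (#|X| <= k)%N) ->
      max_degree S = D ->
      (forall v : V, density_op (rho v)) ->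
      exists logL : R[i] -> R[i],
        log_branch (loschmidt (hamiltonian S lam h) (product_state rho))
          (tL R D) logL /\
        forall (t : R[i]) (eps : R),
          cabs t < tL R D -> 0 < eps ->
          forall inp : input R, presents S lam h rho t eps inp ->
          exists (T : nat) (s : state R),
            [/\ exec inp P (init R) T s,
                T%:R <= #|S|%:R * (C%:R * (1 +
                  powR (#|S|%:R / (1 - cabs t / tL R D) * (1 / eps))
                    (if t == 0 then 0 else 1 / ln (tL R D / cabs t))) ^+ c)
              & cabs (logL t - output s) <= eps].
Proof.
have [P [K [n hP]]] := main_program R k d D.
exists P, (2 * K * 2 ^ n)%N, n => V S lam h rho lam_le _ h_supp h_norm S_card S_deg rho_density.
have [|X [v [XS _]]] := @max_degree_site V S; first by rewrite S_deg.
have S_gt0 : (0 < #|S|)%N by apply/card_gt0P; exists X.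
have d_gt0 : (0 < d)%N.
  rewrite lt0n; apply/eqP => d0; have := density_tr rho_density v.
  rewrite /mxtrace big1 => [/eqP|i]; first by rewrite eq_sym oner_eq0.
  by have := ltn_ord i; rewrite {2}d0.
have r0 := tL_gt0 R hD.
pose H := hamiltonian S lam h; pose f := echo_coef rho H.
have aB N : \sum_(m < N) cabs (logc f m) * tL R D ^+ m <= #|S|%:R.
  exact: (log_coef_le (Ordinal d_gt0) lam_le h_supp h_norm S_deg hD rho_density N r0 (tL_le R hD)).
have fB N : \sum_(m < N) cabs (f m) * tL R D ^+ m <= expR (#|{: 'I_#|S|}|%:R * tL R D).
  have X_inj : injective (fun i : 'I_#|S| => enum_val i) by apply: enum_val_inj.
  have X_S (i : 'I_#|S|) : enum_val i \in S by apply: enum_valP.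
  rewrite /f /H -(partial_ham_index X_inj X_S); apply: echo_coef_summable (ltW r0) => // i.
    exact: lam_le.
  exact: h_norm.
exists (pseries_sum (logc f)); split.
  apply: (log_branch_pseries r0 (echo_coef0 rho_density H) aB fB) => z _.
  exact: loschmidt_cvg.
move=> t eps tr e0 inp hinp.
have [ns [nt ne]] : in_nsubs inp = #|S| /\ in_time inp = t /\ in_eps inp = eps.
  by case: hinp => vid [sid [ord [[_ ? ? ?] _ _ _ _]]].
have t0 : 0 <= cabs t by apply: cabs_ge0.
have n1 : 0 < #|S|%:R :> R by rewrite ltr0n.
have [|N [hN hM]] := first_small_power (divr_ge0 t0 (ltW r0)) _ e0 n1.
  by rewrite ltr_pdivrMr // mul1r.
have [||T [s [ex Tb os]]] := hP inp N.
- by rewrite /enough ns nt ne.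
- by move=> M MN; rewrite /enough ns nt ne; apply: hM.
exists T, s; split=> //.
- have := iteration_bound S_gt0 e0 t0 r0 tr hM; rewrite cabs_eq0.
  set p := powR _ _ => hp; have p0 : 0 <= p by apply: powR_ge0.
  apply: (@le_trans _ _ (K * (#|S|).+1 * (2 ^ N).+1 ^ n)%:R); first by rewrite ler_nat -ns.
  (* From 2^N <= 1 + p one has 2^N + 1 <= 2 (1 + p). Together with |S| + 1 <= 2 |S| this explains
     the constant 2 K 2^n. *)
  have h1 : ((2 ^ N).+1 ^ n)%:R <= (2 ^ n)%:R * (1 + p) ^+ n :> R.
    rewrite !natrX -exprMn; apply: lerXn2r; rewrite ?nnegrE ?mulr_ge0 ?addr_ge0 //.
    by rewrite -natr1 natrX; lra.
  have h2 : (#|S|).+1%:R <= 2 * #|S|%:R :> R.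
    by have : 1 <= #|S|%:R :> R by [rewrite ler1n]; rewrite -natr1; lra.
  rewrite !natrM; have -> : #|S|%:R * (2 * K%:R * (2 ^ n)%:R * (1 + p) ^+ n) =
      K%:R * (2 * #|S|%:R) * ((2 ^ n)%:R * (1 + p) ^+ n) :> R by ring.
  by apply: ler_pM; rewrite ?mulr_ge0 // ler_wpM2l.
rewrite os ns (presents_sum h_supp S_card S_deg S_gt0 d_gt0 rho_density N hinp).
(* The output contains the degrees up to N, so the tail begins at N + 1, the exponent tested by the
   program. *)
have := pseries_tail r0 aB N.+1 (ltW tr); rewrite /psum /log_poly => tail.
by apply: le_trans tail _; rewrite mulrC.
Qed.
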